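(* Let $\theta\in[0,1]$. Suppose that $\beta>1/2$, $a_1\ge1$, $\sum_{k=1}^\infty\frac{c_k}{\gamma_k}<1$, and that $$c_k=\frac{\mathcal A}{k^\alpha}+O\left(\frac1{k^{\alpha+1}}\right),\qquad \gamma_k=\mathcal Bk^\beta+O(k^{\beta-1}),\qquad k\in\mathbb N,\ k\to+\infty,$$ with constants $\mathcal A>0$, $\mathcal B>0$, $0<\alpha\le1$, $\alpha+\beta>1$. Put $r:=\frac{\alpha+\beta-1}{\beta}$. Then, for each fixed $n\in\mathbb N$, the set of zeros of the meromorphic function $$\ell_n(\lambda)=\lambda^2+a_n^2\left(1-\frac{1}{a_n^{2(1-\theta)}}\sum_{k=1}^\infty\frac{c_k}{\lambda+\gamma_k}\right)$$ is the union of a countable set of real zeros $\{\lambda_{n,k}(\theta)\mid k\in\mathbb N\}$ satisfying $$\cdots-\gamma_k<\lambda_{n,k}(\theta)<\cdots<-\gamma_1<\lambda_{n,1}(\theta)<0\qquad\text{and}\qquad\lim_{n\to+\infty}\lambda_{n,k}(\theta)=-\gamma_k$$ (the inequalities meaning $-\gamma_k<\lambda_{n,k}(\theta)<-\gamma_{k-1}$ for $k\ge2$ and $-\gamma_1<\lambda_{n,1}(\theta)<0$), together with a pair of zeros $\lambda_n^\pm(\theta,r)$ which, for sufficiently large $n\in\mathbb N$, are non-real, complex-conjugate, $\lambda_n^+(\theta,r)=\overline{\lambda_n^-(\theta,r)}$, and are asymptotically represented, as $a_n\to+\infty$, in the following form. (i) If $r\in(0,\frac12)$ and $\theta\in[\frac12,1)$,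 then $$\lambda_n^\pm(\theta,r)=-\frac{\mathcal AD_1\mathcal B^{r-1}}{\beta a_n^{n_1(\theta,r)}}\pm i\left(a_n+\frac{\mathcal AD_2\mathcal B^{r-1}}{\beta a_n^{n_1(\theta,r)}}\right)+O\left(\frac{1}{a_n^{n_2(\theta,r)}}\right).$$ (ii) If $r\in(0,1)$ and ($r\in[\frac12,1)$ or $\theta\in(0,\frac12)$), then $$\lambda_n^\pm(\theta,r)=-\frac{\mathcal AD_1\mathcal B^{r-1}}{\beta a_n^{n_1(\theta,r)}}\pm i\left(a_n+\frac{\mathcal AD_2\mathcal B^{r-1}}{\beta a_n^{n_1(\theta,r)}}\right)+O\left(\frac{1}{a_n^{2(1-\theta)}}\right).$$ (iii) If $r=1$, then $$\lambda_n^\pm(\theta,r)=-\frac12\frac{\mathcal A}{\beta}\frac{\ln a_n}{a_n^{2(1-\theta)}}\pm ia_n+O\left(\frac{1}{a_n^{2(1-\theta)}}\right).$$ Here $n_1(\theta,r):=r+2\left(\frac12-\theta\right)$, $n_2(\theta,r):=\min\{2(1-\theta),\,2r+3-4\theta\}$, and $$D_1:=\frac{\pi}{2}\,\frac{\cos\left(\frac\pi2(r+1)\right)}{\sin(\pi r)},\qquad D_2:=-\frac\pi2\,\frac{\sin\left(\frac\pi2(r+1)\right)}{\sin(\pi r)} .$$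
   Context: $\{a_n\}_{n\ge1}$ is the sequence of eigenvalues, counted with multiplicity, $1\le a_1\le a_2\le\cdots$, $a_n\to+\infty$, of a self-adjoint positive operator $A$ with compact inverse in a separable Hilbert space $H$; $Ae_n=a_ne_n$ with $\{e_n\}$ an orthonormal basis. The numbers $c_k,\gamma_k$ satisfy $c_k>0$, $\gamma_{k+1}>\gamma_k>0$ for $k\in\mathbb N$, $\gamma_k\to+\infty$, and $\sup_{k\in\mathbb N}\{\gamma_k(\gamma_{k+1}-\gamma_k)\}=+\infty$. The function $\ell_n(\lambda)=(L(\lambda)e_n,e_n)$ is the restriction to the span of $e_n$ of $L(\lambda)=\lambda^2I+A^2-\widehat K(\lambda)A^{2\theta}$, where $\widehat K(\lambda)=\sum_{k=1}^\infty\frac{c_k}{\lambda+\gamma_k}$.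
   Formalization: The sign of D_1 is corrected to D_1 = -(π/2)cos(π(r+1)/2)/sin(πr), since the printed sign gives the zeros a positive real part, and the limit λ_{n,k} → -γ_k is claimed only for θ<1, since at θ=1 the limit is a zero of 1 - K̂ inside the gap. *)

(* Defs.v *)
From mathcomp Require Import all_boot all_order all_algebra.
From mathcomp Require Import all_classical all_reals all_analysis.
From mathcomp Require Import complex.

Set Implicit Arguments.
Unset Strict Implicit.
Unset Printing Implicit Defensive.

Import Order.TTheory GRing.Theory Num.Theory.
Import numFieldNormedType.Exports.

Local Open Scope classical_set_scope.
Local Open Scope complex_scope.
Local Open Scope ring_scope.

(* All sequences are indexed from 1: the value at index 0 is never used.
   R[i]^o is R[i] seen as a normed module over itself, which is what gives the
   complex numbers their topology in MathComp-Analysis. *)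

Definition Khat (R : realType) (c gamma : nat -> R) (z : R[i]) : R[i] :=
  limn (fun N => \sum_(1 <= k < N) (c k)%:C / (z + (gamma k)%:C) : R[i]^o).

(* [an] stands for a_n *)
Definition ell (R : realType) (c gamma : nat -> R) (theta an : R) (z : R[i])
    : R[i] :=
  z ^+ 2 + (an ^+ 2)%:C
    * (1 - (1 / an `^ (2 * (1 - theta)))%:C * Khat c gamma z).

(* The points - gamma k are poles of the meromorphic function [ell], but 0^-1 = 0
   gives the total function [ell] a junk value there, so they are excluded. *)
Definition ell_zeros (R : realType) (c gamma : nat -> R) (theta an : R)
    : set R[i] :=
  [set z | (forall k : nat, (1 <= k)%N -> z != (- gamma k)%:C)
           /\ ell c gamma theta an z = 0].

Definition n1 (R : realType) (theta r : R) : R := r + 2 * (1 / 2 - theta).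

Definition n2 (R : realType) (theta r : R) : R :=
  Num.min (2 * (1 - theta)) (2 * r + 3 - 4 * theta).

(* The source prints D1 without the leading minus sign. That is a misprint: by
   lambda = 'i * a_n * (1 - Khat lambda / (2 * a_n `^ (2 * (1 - theta))) + ...)
   and Khat lambda ~ C * lambda `^ (- r) with C > 0, the real part of the
   non-real zeros is negative, as it is in the case r = 1, whereas
   cos (pi / 2 * (r + 1)) = - sin (pi / 2 * r) < 0. *)
Definition D1 (R : realType) (r : R) : R :=
  - (pi / 2) * (cos (pi / 2 * (r + 1)) / sin (pi * r)).

Definition D2 (R : realType) (r : R) : R :=
  - (pi / 2) * (sin (pi / 2 * (r + 1)) / sin (pi * r)).

(* lambda_n^(+/-) = re n +/- 'i * im n + O(err n) *)
Definition pair_asymptotics (R : realType) (lp lm : nat -> R[i]^o)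
    (re im err : nat -> R) : Prop :=
  lp = (fun n => re n +i* im n : R[i]^o) +O_\oo (fun n => (err n)%:C : R[i]^o)
  /\
  lm = (fun n => re n -i* im n : R[i]^o) +O_\oo (fun n => (err n)%:C : R[i]^o).

(* Main.v *)
(* Dividing out two zeros w, w' (a conjugate pair, or two real zeros lying between
   the same poles) turns ell_n into (z - w)(z - w')(1 - b sum_k d_k/(z + gamma_k))
   with d_k = c_k/((w + gamma_k)(w' + gamma_k)) > 0, whose last factor is a
   Nevanlinna function with exactly one zero between consecutive poles. This
   yields the whole zero set. The non-real zero near i a_n, where a = a_n, is a
   fixed point of z - ell_n(z)/(2 i a), and
     z - i a = a^(2 theta) Khat(i a)/(2 i a) + O(a^(4 theta - 3) S^2),
   where S = sum_k c_k/(a + gamma_k). Comparing the sum Khat(i a) with the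
   integral of A x^(-alpha)/(i a + B x^beta) costs only O(1/a); the integral is
   evaluated by int_0^oo u^(s-1)/(1+u) du = pi/sin(pi s), which follows from the
   series sum_k (-1)^k/(s + k) and the Dirichlet kernel. *)
Require Import Defs.
From mathcomp Require Import all_boot all_order all_algebra.
From mathcomp Require Import all_classical all_reals all_analysis.
From mathcomp Require Import complex.
From mathcomp Require Import ring lra.

Set Implicit Arguments.
Unset Strict Implicit.
Unset Printing Implicit Defensive.

Import Order.TTheory GRing.Theory Num.Theory.
Import numFieldNormedType.Exports.

Local Open Scope classical_set_scope.
Local Open Scope complex_scope.
Local Open Scope ring_scope.

(** * Convergent real and complex series *)

Local Notation normc := Normc.normc.

Section Sums.
Variable R : realType.
Implicit Types (u v m : nat -> R) (f g : nat -> R[i]) (s t M : R).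

(** On the negative axis both [x ^+ 2] and [Kr] decrease, so their difference need not be monotone
    in a gap and one gap may contain several real zeros: sign changes alone cannot count them. After
    the division a strictly decreasing sum faces a constant, so uniqueness in a gap follows from
    monotonicity, and realness from positivity of the weights; no contour integral or argument
    principle is involved. The exponents of the error have two origins. An error [C / a] in [Khat]
    becomes [a^(2 theta - 2)] in the zero, because [b = a^(2 theta)] is divided by [2 i a]; the
    quadratic remainder is [a^(4 theta - 3 - 2 r)] for [r < 1], since then [S = O(a^(- r))]. The
    slower of these two decay rates is [n2]. *)

Definition rsum u s := (fun N => \sum_(1 <= k < N) u k) @ \oo --> s.

(** Convergence by real and imaginary parts reduces complex series to real ones; the topology of
    [R[i]] is met only when [limn] is evaluated in [csum_Khat]. *)
Definition csum f (s : R[i]) :=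
  rsum (fun k => complex.Re (f k)) (complex.Re s)
  /\ rsum (fun k => complex.Im (f k)) (complex.Im s).

Lemma rsum_ext u v s : (forall k, (1 <= k)%N -> u k = v k) ->
  rsum u s -> rsum v s.
Proof.
move=> uv; rewrite /rsum; have -> // : (fun N => \sum_(1 <= k < N) u k)
  = (fun N => \sum_(1 <= k < N) v k).
by apply/funext => N; apply: eq_big_nat => k /andP[k1 _]; exact: uv.
Qed.

Lemma rsum_unique u s t : rsum u s -> rsum u t -> s = t.
Proof.
by move=> us ut; rewrite -(cvg_lim (@Rhausdorff R) us) (cvg_lim (@Rhausdorff R) ut).
Qed.

Lemma rsumD u v s t : rsum u s -> rsum v t -> rsum (fun k => u k + v k) (s + t).
Proof.
move=> us vt; rewrite /rsum (_ : (fun N => _) =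
  (fun N => \sum_(1 <= k < N) u k + \sum_(1 <= k < N) v k)); first exact: cvgD.
by apply/funext => N; rewrite big_split.
Qed.

Lemma rsumZ a u s : rsum u s -> rsum (fun k => a * u k) (a * s).
Proof.
move=> us; rewrite /rsum (_ : (fun N => _) =
  (fun N => a * \sum_(1 <= k < N) u k)); first exact: cvgMl_tmp.
by apply/funext => N; rewrite mulr_sumr.
Qed.

Arguments rsumZ a [u s].

Lemma rsumN u s : rsum u s -> rsum (fun k => - u k) (- s).
Proof.
by move=> /(rsumZ (-1)); rewrite mulN1r; apply: rsum_ext => k _; rewrite mulN1r.
Qed.

Lemma rsumB u v s t : rsum u s -> rsum v t -> rsum (fun k => u k - v k) (s - t).
Proof. by move=> us /rsumN; exact: rsumD. Qed.

Lemma ler_rsum u v s t : (forall k, (1 <= k)%N -> u k <= v k) ->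
  rsum u s -> rsum v t -> s <= t.
Proof.
move=> uv us vt; apply: (ler_cvg_to us vt).
by apply: nearW => N; apply: ler_sum_nat => k /andP[k1 _]; exact: uv.
Qed.

Lemma rsum_part_le u s N : (forall k, (1 <= k)%N -> 0 <= u k) -> rsum u s ->
  \sum_(1 <= k < N) u k <= s.
Proof.
move=> u0 us; apply: (ler_cvg_to (cvg_cst _) us).
near=> M.
have NM : (N <= M)%N by near: M; exact: nbhs_infty_ge.
have [N1|N1] := leqP N 1.
  rewrite big_geq//; rewrite big_nat_cond sumr_ge0// => k /andP[/andP[k1 _] _].
  exact: u0.
rewrite (big_cat_nat (ltnW N1) NM)//= lerDl big_nat_cond sumr_ge0//.
move=> k /andP[/andP[k1 _] _]; apply: u0; exact: (leq_trans (ltnW N1)).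
Unshelve. all: by end_near. Qed.

Lemma rsum_term_le u s k : (forall k, (1 <= k)%N -> 0 <= u k) -> rsum u s ->
  (1 <= k)%N -> u k <= s.
Proof.
move=> u0 us k1; apply: le_trans (rsum_part_le k.+1 u0 us).
rewrite big_nat_recr//= lerDr big_nat_cond sumr_ge0// => j /andP[/andP[j1 _] _].
exact: u0.
Qed.

Lemma rsum_bounded u M : (forall k, (1 <= k)%N -> 0 <= u k) ->
  (forall N, \sum_(1 <= k < N) u k <= M) -> exists s, rsum u s.
Proof.
move=> u0 uM; set U := fun N => \sum_(1 <= k < N) u k.
have U_nd : nondecreasing_seq U.
  apply/nondecreasing_seqP => -[|N]; rewrite /U; first by rewrite !big_geq.
  by rewrite [leRHS]big_nat_recr//= lerDl u0.
exists (lim (U @ \oo)); apply: nondecreasing_is_cvgn => //.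
by exists M => _ [N _ <-]; exact: uM.
Qed.

(** Absolute convergence from monotone convergence: the terms of [u + m] lie between 0 and [2 m]. *)
Lemma rsum_major u m M : (forall k, (1 <= k)%N -> `|u k| <= m k) ->
  rsum m M -> exists s, rsum u s.
Proof.
move=> um mM.
have m0 k : (1 <= k)%N -> 0 <= m k by move=> /um; apply: le_trans.
have [|N|s hs] := @rsum_bounded (fun k => u k + m k) (M + M).
- by move=> k /um; rewrite ler_norml => /andP[+ _]; lra.
- apply: (@le_trans _ _ (\sum_(1 <= k < N) (m k + m k))).
    apply: ler_sum_nat => k /andP[/um + _]; rewrite ler_norml => /andP[_].
    by lra.
  by rewrite big_split /= lerD//; exact: rsum_part_le.
exists (s - M); apply: rsum_ext (rsumB hs mM) => k _; ring.
Qed.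

Lemma rsum_norm_le u m s M : (forall k, (1 <= k)%N -> `|u k| <= m k) ->
  rsum u s -> rsum m M -> `|s| <= M.
Proof.
move=> um us mM; rewrite ler_norml; apply/andP; split.
  apply: (ler_rsum _ (rsumN mM) us) => k /um.
  by rewrite ler_norml => /andP[].
by apply: (ler_rsum _ us mM) => k /um; rewrite ler_norml => /andP[].
Qed.

(** * Modulus, real and imaginary parts *)

Lemma normc_sqrtE (z : R[i]) :
  normc z = Num.sqrt (complex.Re z ^+ 2 + complex.Im z ^+ 2).
Proof. by case: z. Qed.

Lemma normc_ge0 (z : R[i]) : 0 <= normc z.
Proof. by rewrite normc_sqrtE sqrtr_ge0. Qed.

Lemma normcM (x y : R[i]) : normc (x * y) = normc x * normc y.
Proof. exact: Normc.normcM. Qed.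

Lemma normcV (x : R[i]) : normc x^-1 = (normc x)^-1.
Proof. exact: Normc.normcV. Qed.

Lemma normc_div (x y : R[i]) : normc (x / y) = normc x / normc y.
Proof. by rewrite normcM normcV. Qed.

Lemma ler_normcD (x y : R[i]) : normc (x + y) <= normc x + normc y.
Proof. exact: (@le_normcD R). Qed.

Lemma normcN (x : R[i]) : normc (- x) = normc x.
Proof. exact: (@normcN R). Qed.

Lemma normc_le_sum (z : R[i]) :
  normc z <= `|complex.Re z| + `|complex.Im z|.
Proof.
rewrite normc_sqrtE -ler_sqr ?nnegrE ?addr_ge0 ?sqrtr_ge0//.
rewrite sqr_sqrtr ?addr_ge0 ?sqr_ge0// sqrrD !real_normK ?num_real//.
have := mulr_ge0 (normr_ge0 (complex.Re z)) (normr_ge0 (complex.Im z)).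
by rewrite mulr2n; lra.
Qed.

Lemma normc_ge_Re (z : R[i]) : `|complex.Re z| <= normc z.
Proof.
by rewrite normc_sqrtE -sqrtr_sqr ler_wsqrtr// lerDl sqr_ge0.
Qed.

Lemma normc_ge_Im (z : R[i]) : `|complex.Im z| <= normc z.
Proof.
by rewrite normc_sqrtE -sqrtr_sqr ler_wsqrtr// lerDr sqr_ge0.
Qed.

Lemma normc_real (x : R) : normc x%:C = `|x|.
Proof. by rewrite normc_sqrtE /= expr0n addr0 sqrtr_sqr. Qed.

Lemma normc_eq0 (z : R[i]) : (normc z == 0) = (z == 0).
Proof.
apply/eqP/eqP => [|->]; first exact: Normc.eq0_normc.
by rewrite normc_real normr0.
Qed.

Lemma normc_gt0 (z : R[i]) : (0 < normc z) = (z != 0).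
Proof. by rewrite lt_neqAle normc_ge0 andbT eq_sym normc_eq0. Qed.

Lemma Re_add (x y : R[i]) : complex.Re (x + y) = complex.Re x + complex.Re y.
Proof. by case: x y => [a b] [a' b']. Qed.

Lemma Im_add (x y : R[i]) : complex.Im (x + y) = complex.Im x + complex.Im y.
Proof. by case: x y => [a b] [a' b']. Qed.

Lemma Re_mul (x y : R[i]) : complex.Re (x * y)
  = complex.Re x * complex.Re y - complex.Im x * complex.Im y.
Proof. by case: x y => [a b] [a' b']. Qed.

Lemma Im_mul (x y : R[i]) : complex.Im (x * y)
  = complex.Re x * complex.Im y + complex.Im x * complex.Re y.
Proof. by case: x y => [a b] [a' b']. Qed.

Lemma Re_sub (x y : R[i]) : complex.Re (x - y) = complex.Re x - complex.Re y.
Proof. by case: x y => [a b] [a' b']. Qed.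

Lemma Im_sub (x y : R[i]) : complex.Im (x - y) = complex.Im x - complex.Im y.
Proof. by case: x y => [a b] [a' b']. Qed.

(** * Complex series *)

Lemma csum_ext f g (s : R[i]) : (forall k, (1 <= k)%N -> f k = g k) ->
  csum f s -> csum g s.
Proof. by move=> fg [h1 h2]; split; [apply: rsum_ext h1|apply: rsum_ext h2] => k /fg ->. Qed.

Lemma csum_unique f (s t : R[i]) : csum f s -> csum f t -> s = t.
Proof.
case: s t => [a b] [a' b'] [/= h1 h2] [/= h3 h4].
by rewrite (rsum_unique h1 h3) (rsum_unique h2 h4).
Qed.

Lemma csumD f g (s t : R[i]) : csum f s -> csum g t -> csum (fun k => f k + g k) (s + t).
Proof.
move=> [h1 h2] [h3 h4]; split; rewrite (Re_add, Im_add).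
  by apply: rsum_ext (rsumD h1 h3) => k _; rewrite Re_add.
by apply: rsum_ext (rsumD h2 h4) => k _; rewrite Im_add.
Qed.

Lemma csumZ a f (s : R[i]) : csum f s -> csum (fun k => a * f k) (a * s).
Proof.
move=> [h1 h2]; split; rewrite (Re_mul, Im_mul).
  by apply: rsum_ext (rsumB (rsumZ _ h1) (rsumZ _ h2)) => k _; rewrite Re_mul.
by apply: rsum_ext (rsumD (rsumZ _ h2) (rsumZ _ h1)) => k _; rewrite Im_mul.
Qed.

Arguments csumZ a [f s].

Lemma csumB f g (s t : R[i]) : csum f s -> csum g t -> csum (fun k => f k - g k) (s - t).
Proof.
move=> hf /(csumZ (-1)); rewrite mulN1r => /(csumD hf).
by apply: csum_ext => k _; rewrite mulN1r.
Qed.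

Lemma csum_real u s : rsum u s -> csum (fun k => (u k)%:C) s%:C.
Proof.
move=> us; split=> //=; rewrite /rsum.
rewrite (_ : (fun _ => _) = cst 0); first exact: cvg_cst.
by apply/funext => N; rewrite big1.
Qed.

Lemma csum_major f m M : (forall k, (1 <= k)%N -> normc (f k) <= m k) ->
  rsum m M -> exists s : R[i], csum f s.
Proof.
move=> fm mM.
have [a ha] : exists a, rsum (fun k => complex.Re (f k)) a.
  by apply: rsum_major mM => k /fm; apply: le_trans (normc_ge_Re _).
have [b hb] : exists b, rsum (fun k => complex.Im (f k)) b.
  by apply: rsum_major mM => k /fm; apply: le_trans (normc_ge_Im _).
by exists (a +i* b).
Qed.

(* Rotating [s] onto the positive axis reduces the bound to real parts. *)
Lemma csum_norm_le f m (s : R[i]) M : (forall k, (1 <= k)%N -> normc (f k) <= m k) ->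
  csum f s -> rsum m M -> normc s <= M.
Proof.
move=> fm fs mM.
have [->|s0] := eqVneq s 0.
  rewrite normc_real normr0; apply: le_trans (rsum_part_le 1 _ mM).
    by rewrite big_geq.
  by move=> k /fm; apply: le_trans; exact: normc_ge0.
have n0 : 0 < normc s by rewrite normc_gt0.
have [h _] := csumZ s^*%C fs.
have e : complex.Re (s^*%C * s) = normc s ^+ 2.
  rewrite Re_mul normc_sqrtE sqr_sqrtr ?addr_ge0 ?sqr_ge0//.
  by case: (s) => a b /=; ring.
rewrite e in h.
have : normc s ^+ 2 <= normc s * M.
  apply: (ler_rsum _ h (rsumZ (normc s) mM)) => k k1.
  apply: le_trans (ler_norm _) _; apply: le_trans (normc_ge_Re _) _.
  rewrite normcM (_ : normc s^*%C = normc s) ?ler_wpM2l ?normc_ge0 ?fm//.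
  by rewrite !normc_sqrtE; case: (s) => a b /=; rewrite sqrrN.
by rewrite expr2 ler_pM2l.
Qed.

Lemma Re_sum (A : Type) (r : seq A) (P : pred A) (F : A -> R[i]) :
  complex.Re (\sum_(i <- r | P i) F i) = \sum_(i <- r | P i) complex.Re (F i).
Proof. by apply: (big_morph _ Re_add). Qed.

Lemma Im_sum (A : Type) (r : seq A) (P : pred A) (F : A -> R[i]) :
  complex.Im (\sum_(i <- r | P i) F i) = \sum_(i <- r | P i) complex.Im (F i).
Proof. by apply: (big_morph _ Im_add). Qed.

Lemma normcP (z : R[i]) : `|z| = (normc z)%:C.
Proof. by rewrite normc_def normc_sqrtE. Qed.

Lemma cvg_complex (w : nat -> R[i]^o) (l : R[i]^o) :
  (fun n => complex.Re (w n)) @ \oo --> complex.Re l ->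
  (fun n => complex.Im (w n)) @ \oo --> complex.Im l -> w @ \oo --> l.
Proof.
(* In the order of [R[i]] a positive number is real, so the radius has zero imaginary part. *)
move=> /cvgrPdist_lt hr /cvgrPdist_lt hi; apply/cvgrPdist_lt => -[e e'] /=; rewrite ltcE /= => /andP[/eqP -> e0].
near=> n.
rewrite normcP ltcR; apply: le_lt_trans (normc_le_sum _) _.
rewrite (splitr e) ltrD//.
- rewrite (_ : complex.Re _ = complex.Re l - complex.Re (w n)); last first.
    by case: (l) (w n) => [a b] [a' b'].
  by near: n; apply: hr; rewrite divr_gt0.
- rewrite (_ : complex.Im _ = complex.Im l - complex.Im (w n)); last first.
    by case: (l) (w n) => [a b] [a' b'].
  by near: n; apply: hi; rewrite divr_gt0.
Unshelve. all: by end_near. Qed.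

(** [limn] has a default value on divergent sequences, so [Khat] acquires its meaning only through
    this passage from an established sum. *)
Lemma csum_Khat c gamma (z s : R[i]) :
  csum (fun k => (c k)%:C / (z + (gamma k)%:C)) s -> Khat c gamma z = s.
Proof.
move=> [h1 h2].
have h : (fun N => \sum_(1 <= k < N) (c k)%:C / (z + (gamma k)%:C) : R[i]^o)
    @ \oo --> (s : R[i]^o).
  apply: cvg_complex.
    by under eq_fun do rewrite Re_sum; exact: h1.
  by under eq_fun do rewrite Im_sum; exact: h2.
exact: (cvg_lim (@norm_hausdorff R[i] R[i]^o) h).
Qed.

End Sums.

Arguments rsumZ {R} a [u s].
Arguments csumZ {R} a [f s].

(** * Partial fractions on the real line *)

Section PartialFractions.
Variable R : realType.
Variable gamma : nat -> R.
Hypothesis gamma_inc : forall k, (1 <= k)%N -> 0 < gamma k < gamma k.+1.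
Hypothesis gamma_oo : gamma @ \oo --> +oo.
Implicit Types (c d : nat -> R) (z w : R[i]).

(** Summability of [d k / gamma k] makes the partial fraction series converge at every point off the
    poles. Both [c] and the weights left after a division satisfy it. *)
Definition weight d := (forall k, (1 <= k)%N -> 0 < d k)
  /\ exists s, rsum (fun k => d k / gamma k) s.

Definition npole z := forall k, (1 <= k)%N -> z != (- gamma k)%:C.

Definition term d z k := (d k)%:C / (z + (gamma k)%:C).

Lemma gamma_gt0 k : (1 <= k)%N -> 0 < gamma k.
Proof. by move=> /gamma_inc/andP[]. Qed.

Lemma gamma_lt j k : (1 <= j)%N -> (j < k)%N -> gamma j < gamma k.
Proof.
move=> j1; elim: k => // k IHk; rewrite ltnS leq_eqVlt => /predU1P[<-|jk].
  by have /andP[] := gamma_inc j1.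
apply: lt_trans (IHk jk) _.
by have /andP[] := gamma_inc (leq_trans j1 (ltnW jk)).
Qed.

Lemma gamma_le j k : (1 <= j)%N -> (j <= k)%N -> gamma j <= gamma k.
Proof.
by move=> j1; rewrite leq_eqVlt => /predU1P[->//|jk]; rewrite ltW// gamma_lt.
Qed.

Lemma npoleP z : npole z <-> forall k, (1 <= k)%N -> z + (gamma k)%:C != 0.
Proof.
by split=> h k /h; rewrite addr_eq0 rmorphN.
Qed.

Lemma near_bounded (f : nat -> R) C : (\forall k \near \oo, f k <= C) ->
  exists2 C', 0 < C' & forall k, f k <= C'.
Proof.
move=> [N _ hN]; exists (1 + `|C| + \sum_(j < N) `|f j|).
  by rewrite ltr_wpDr ?sumr_ge0// ltr_pwDl.
move=> k; have [Nk|kN] := leqP N k.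
  apply: le_trans (hN k Nk) _; apply: le_trans (ler_norm _) _.
  by rewrite -addrA addrCA lerDl addr_ge0 ?sumr_ge0.
apply: le_trans (ler_norm _) _.
by rewrite (bigD1 (Ordinal kN))//= addrCA lerDl addr_ge0 ?sumr_ge0.
Qed.

(** The ratio [gamma k / |z + gamma k|] is eventually below 2 because [gamma] is unbounded, and
    finite for the other [k] because [z] is no pole; hence it is bounded, uniformly in [k]. *)
Lemma pole_dist z : npole z -> exists2 m, 0 < m &
  forall k, (1 <= k)%N -> m * gamma k <= normc (z + (gamma k)%:C).
Proof.
move=> /npoleP np.
have [|C C0 hC] := @near_bounded (fun k => gamma k / normc (z + (gamma k)%:C)) 2.
  near=> k.
  have zk : 2 * normc z + 1 <= gamma k by near: k; exact: (cvgryPge _).1 gamma_oo _.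
  have k0 : 0 < gamma k by apply: lt_le_trans zk; have := normc_ge0 z; lra.
  have h : gamma k <= normc (z + (gamma k)%:C) + normc z.
    have := ler_normcD (z + (gamma k)%:C) (- z).
    by rewrite addrAC subrr add0r normc_real normcN gtr0_norm.
  by rewrite ler_pdivrMr; lra.
exists C^-1; first by rewrite invr_gt0.
move=> k k1; have := hC k; rewrite ler_pdivrMr ?normc_gt0 ?np//.
by rewrite ler_pdivrMl.
Unshelve. all: by end_near. Qed.

Lemma csum_term d z : weight d -> npole z -> csum (term d z) (Khat d gamma z).
Proof.
move=> [d0 [s hs]] /[dup] np /pole_dist[m m0 hm].
have [k k1|t ht] := @csum_major _ (term d z) _ _ _ (rsumZ m^-1 hs).
  rewrite normc_div normc_real gtr0_norm ?d0//.
  have mg : 0 < m * gamma k by rewrite mulr_gt0 ?gamma_gt0.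
  have zg := lt_le_trans mg (hm _ k1).
  by rewrite mulrCA ler_pM2l ?d0// -invfM lef_pV2 ?posrE ?hm.
by rewrite (csum_Khat ht).
Qed.

Lemma csum_term2 d z w : weight d -> npole z -> npole w ->
  exists Q, csum (fun k => (d k)%:C / ((z + (gamma k)%:C) * (w + (gamma k)%:C))) Q.
Proof.
move=> [d0 [s hs]] /pole_dist[m m0 hm] /pole_dist[n n0 hn].
(* One factor [gamma k] is replaced by [gamma 1], since a single power already gives a summable
   majorant. *)
apply: (csum_major _ (rsumZ (m * n * gamma 1)^-1 hs)) => k k1.
rewrite normc_div normc_real gtr0_norm ?d0// normcM.
rewrite mulrCA ler_pM2l ?d0// -invfM.
have g1 := gamma_gt0 (leqnn 1); have gk := gamma_gt0 k1.
rewrite lef_pV2 ?posrE ?mulr_gt0//; last 2 first.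
- exact: lt_le_trans (mulr_gt0 m0 gk) (hm _ k1).
- exact: lt_le_trans (mulr_gt0 n0 gk) (hn _ k1).
apply: (@le_trans _ _ ((m * gamma k) * (n * gamma k))).
  have := gamma_le (leqnn 1) k1 => g1k.
  rewrite [leRHS](_ : _ = m * n * gamma k * gamma k); last by ring.
  by rewrite ler_pM2r// ler_pM2l// mulr_gt0.
by rewrite ler_pM ?hm ?hn// mulr_ge0// ltW.
Qed.

(** The resolvent identity summed over [k]: up to sign, [Q] is the difference quotient of [Khat]. *)
Lemma KhatB d z w Q : weight d -> npole z -> npole w ->
  csum (fun k => (d k)%:C / ((z + (gamma k)%:C) * (w + (gamma k)%:C))) Q ->
  Khat d gamma z - Khat d gamma w = - (z - w) * Q.
Proof.
move=> wd hz hw hQ.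
apply: csum_unique (csumZ (- (z - w)) hQ).
apply: csum_ext (csumB (csum_term wd hz) (csum_term wd hw)) => k k1.
rewrite /term; have /npoleP/(_ k k1) h1 := hz; have /npoleP/(_ k k1) h2 := hw.
by field; rewrite h1 h2.
Qed.

(** * The sum at real points *)

Definition Kr d (x : R) := complex.Re (Khat d gamma x%:C).

Lemma npole_real (x : R) :
  npole x%:C <-> forall k, (1 <= k)%N -> x + gamma k != 0.
Proof.
rewrite npoleP; split => h k /h; by rewrite -rmorphD (fmorph_eq0 (real_complex R)).
Qed.

Lemma term_real d (x : R) k : term d x%:C k = (d k / (x + gamma k))%:C.
Proof. by rewrite /term -rmorphD fmorph_div. Qed.

Lemma rsum_Kr d (x : R) : weight d -> npole x%:C ->
  rsum (fun k => d k / (x + gamma k)) (Kr d x).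
Proof.
move=> wd np; have [h _] := csum_term wd np.
by apply: rsum_ext h => k _; rewrite term_real.
Qed.

Lemma Khat_real d (x : R) : weight d -> npole x%:C ->
  Khat d gamma x%:C = (Kr d x)%:C.
Proof.
move=> wd np; apply: csum_Khat.
apply: csum_ext (csum_real (rsum_Kr wd np)) => k _; exact/esym/term_real.
Qed.

(** Positivity of all these products says that no pole separates [x] from [y] or equals either,
    without naming the gap. *)
Definition same_gap (x y : R) :=
  forall k, (1 <= k)%N -> 0 < (x + gamma k) * (y + gamma k).

Lemma same_gap_npole x y : same_gap x y -> npole x%:C /\ npole y%:C.
Proof.
by move=> h; split; apply/npole_real => k /h; apply: contraTneq => ->;
  rewrite ?mul0r ?mulr0 ltxx.
Qed.

(** Every term of the difference is nonnegative, so any single one is a lower bound. Choosing the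
    term of a neighbouring pole shows the blow-up at that end of the gap. *)
Lemma KrB_ge d x y k : weight d -> same_gap x y -> x <= y -> (1 <= k)%N ->
  d k / (x + gamma k) - d k / (y + gamma k) <= Kr d x - Kr d y.
Proof.
move=> wd /[dup] xy /same_gap_npole[hx hy] le_xy k1.
apply: (rsum_term_le _ (rsumB (rsum_Kr wd hx) (rsum_Kr wd hy)) k1) => j j1.
have /npole_real/(_ j j1) xj := hx; have /npole_real/(_ j j1) yj := hy.
rewrite (_ : _ - _ = d j * (y - x) / ((x + gamma j) * (y + gamma j))).
  by rewrite divr_ge0 ?(ltW (xy _ j1))// mulr_ge0 ?subr_ge0// ltW// wd.1.
by field; rewrite xj yj.
Qed.

Lemma Kr_lt d x y : weight d -> same_gap x y -> x < y -> Kr d y < Kr d x.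
Proof.
move=> wd /[dup] xy /same_gap_npole[hx hy] lt_xy; rewrite -subr_gt0.
have j1 := leqnn 1; apply: lt_le_trans (KrB_ge wd xy (ltW lt_xy) j1).
have /npole_real/(_ _ j1) xj := hx; have /npole_real/(_ _ j1) yj := hy.
rewrite (_ : _ - _ = d 1 * (y - x) / ((x + gamma 1) * (y + gamma 1))).
  by rewrite divr_gt0 ?xy// mulr_gt0 ?subr_gt0// wd.1.
by field; rewrite xj yj.
Qed.

Lemma Kr_inj d x y : weight d -> same_gap x y -> Kr d x = Kr d y -> x = y.
Proof.
move=> wd xy e; have yx : same_gap y x by move=> k; rewrite mulrC; exact: xy.
have [/(Kr_lt wd xy)|/(Kr_lt wd yx)|//] := ltgtP x y; by rewrite e ltxx.
Qed.

Lemma Kr_continuous d x : weight d -> npole x%:C -> {for x, continuous (Kr d)}.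
Proof.
move=> wd hx; have [m m0 hm] := pole_dist hx.
have [s hs] := wd.2; have d0 := wd.1.
have s0 : 0 <= s.
  apply: le_trans (rsum_part_le 1 _ hs); first by rewrite big_geq.
  by move=> k k1; rewrite divr_ge0// ltW ?d0 ?gamma_gt0.
have g1 := gamma_gt0 (leqnn 1).
(* A Lipschitz constant at [x]: with [|x + gamma k| >= m * gamma k] and at least half of that at
   [y], each term of the difference is at most [|x - y|] times [2 d k / (m^2 gamma 1 gamma k)]. *)
pose L := 2 / (m ^+ 2 * gamma 1) * s.
have L0 : 0 <= L by rewrite mulr_ge0// divr_ge0// mulr_ge0 ?sqr_ge0// ltW.
apply/cvgrPdist_le => e e0; near=> y.
have xy : `|x - y| <= m * gamma 1 / 2.
  near: y; apply: cvgr_dist_le; first exact: cvg_id.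
  by rewrite divr_gt0// mulr_gt0.
have xyL : `|x - y| <= e / (L + 1).
  near: y; apply: cvgr_dist_le; first exact: cvg_id.
  by rewrite divr_gt0// ltr_wpDl.
have lx k : (1 <= k)%N -> m * gamma k <= `|x + gamma k|.
  by move=> /hm; rewrite -rmorphD normc_real.
have ly k : (1 <= k)%N -> m * gamma k / 2 <= `|y + gamma k|.
  move=> k1; have := lx _ k1; have := gamma_le (leqnn 1) k1 => g1k h.
  have : `|x + gamma k| <= `|x - y| + `|y + gamma k|.
    by apply: le_trans (ler_normD _ _); rewrite addrA subrK.
  have : m * gamma 1 <= m * gamma k by rewrite ler_pM2l.
  by lra.
have hy : npole y%:C.
  apply/npole_real => k k1; rewrite -normr_gt0; apply: lt_le_trans (ly _ k1).
  by rewrite divr_gt0// mulr_gt0// gamma_gt0.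
have : `|Kr d x - Kr d y| <= `|x - y| * L.
  rewrite /L mulrA; apply: (rsum_norm_le _
    (rsumB (rsum_Kr wd hx) (rsum_Kr wd hy)) (rsumZ _ hs)) => k k1.
  have /npole_real/(_ k k1) xk := hx; have /npole_real/(_ k k1) yk := hy.
  have gk := gamma_gt0 k1; have g1k := gamma_le (leqnn 1) k1.
  rewrite (_ : _ - _ = d k * (y - x) / ((x + gamma k) * (y + gamma k))); last first.
    by field; rewrite xk yk.
  rewrite normrM normrM normfV gtr0_norm ?d0// distrC normrM.
  rewrite [leRHS](_ : _ = d k * `|x - y| *
    (2 / (m ^+ 2 * gamma 1) / gamma k)); last by ring.
  rewrite ler_wpM2l ?mulr_ge0 ?(ltW (d0 _ k1))//.
  apply: (@le_trans _ _ ((m * gamma k) * (m * gamma k / 2))^-1).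
    rewrite lef_pV2 ?posrE ?mulr_gt0 ?normr_gt0 ?invr_gt0// ler_pM ?lx ?ly//.
      by rewrite mulr_ge0// ltW.
    by rewrite divr_ge0// mulr_ge0// ltW.
  rewrite (_ : 2 / _ / _ = (m ^+ 2 * gamma 1 * gamma k / 2)^-1); last first.
    by field; rewrite !gt_eqF.
  rewrite lef_pV2 ?posrE ?mulr_gt0 ?exprn_gt0 ?invr_gt0//.
  rewrite [leRHS](_ : _ = m ^+ 2 * gamma k * gamma k / 2); last by field.
  by rewrite !ler_pM2r ?invr_gt0// ler_pM2l// exprn_gt0.
move=> /le_trans; apply.
apply: (@le_trans _ _ (e / (L + 1) * L)); first by rewrite ler_wpM2r.
rewrite mulrAC ler_pdivrMr ?ltr_wpDl// ler_pM2l//; lra.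
Unshelve. all: by end_near. Qed.

(** [gamma 0] carries no meaning, so the first gap is unbounded on the right; negativity is imposed
    separately where it is wanted. *)
Definition in_gap k (x : R) :=
  - gamma k < x /\ ((2 <= k)%N -> x < - gamma k.-1).

Lemma same_gap_in k x y : (1 <= k)%N -> in_gap k x -> in_gap k y -> same_gap x y.
Proof.
move=> k1 [x1 x2] [y1 y2] j j1; have [kj|jk] := leqP k j.
  have := gamma_le k1 kj => g; by rewrite mulr_gt0//; lra.
have k2 : (2 <= k)%N by rewrite (leq_trans _ jk).
have jk1 : (j <= k.-1)%N by rewrite -ltnS prednK// ltnW.
have := gamma_le j1 jk1; have := x2 k2; have := y2 k2 => *.
by rewrite nmulr_rgt0; lra.
Qed.

Lemma in_gap_npole k x : (1 <= k)%N -> in_gap k x -> npole x%:C.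
Proof. by move=> k1 h; have [] := same_gap_npole (same_gap_in k1 h h). Qed.

Lemma in_gap_exists x : npole x%:C -> exists2 k, (1 <= k)%N & in_gap k x.
Proof.
move=> np.
have ex : exists k, (1 <= k)%N && (- gamma k < x).
  have [N _ hN] := (cvgryPge _).1 gamma_oo (`|x| + 1).
  exists N.+1; have /= := hN N.+1 (leqnSn _).
  by have := ler_norm (- x); rewrite normrN; lra.
(* The least [k] with [- gamma k < x] names the gap. *)
case: (ex_minnP ex) => k /andP[k1 kx] kmin; exists k => //; split=> // k2.
have k11 : (1 <= k.-1)%N by rewrite -ltnS prednK// ltnW.
rewrite ltNge le_eqVlt; apply/negP => /predU1P[e|h].
  have /npole_real/(_ _ k11) := np; by rewrite -e addNr eqxx.
by have := kmin k.-1; rewrite k11 h => /(_ isT); rewrite leqNgt prednK// leqnn.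
Qed.

(** The first gap is cut at 0, where an explicit sign condition replaces the missing pole. *)
Definition gap_end k : R := if k == 1%N then 0 else - gamma k.-1.

(** Intermediate values. Near the left pole [Kr] exceeds [P / b]; near a right pole it is negative
    while [p >= 0]; for [k = 1] the sign at 0 is assumed. A general [p] serves both the original
    function, with [p x = x ^+ 2 + A], and the divided one, with [p = 1]. *)
Lemma zero_in_gap d b (p : R -> R) P k : weight d -> 0 < b ->
  (forall x, {for x, continuous p}) ->
  (forall x, - gamma k <= x <= 0 -> 0 <= p x <= P) ->
  b * Kr d 0 < p 0 -> (1 <= k)%N ->
  exists x, [/\ in_gap k x, x < 0 & p x = b * Kr d x].
Proof.
move=> wd b0 pc pP p0 k1.
pose lo := - gamma k; pose up := gap_end k.
have loE : lo = - gamma k by [].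
have gk := gamma_gt0 k1.
have dk := wd.1 _ k1.
have [lo_up up0] : lo < up /\ up <= 0.
  rewrite /lo /up /gap_end; case: eqVneq => [_|kn1]; first by rewrite oppr_lt0 gk lexx.
  have k11 : (1 <= k.-1)%N by case: (k) k1 kn1 => [|[]].
  have := gamma_gt0 k11; have := gamma_lt k11 (_ : k.-1 < k)%N.
  by rewrite prednK// => /(_ (leqnn _)) ? ?; split; lra.
have in_gapE x : lo < x < up -> in_gap k x.
  move=> /andP[h1 h2]; split=> // k2; move: h2; rewrite /up /gap_end.
  by case: eqVneq k2 => // ->.
pose mid := (lo + up) / 2.
have lo_mid : lo < mid by rewrite /mid; lra.
have mid_up : mid < up by rewrite /mid; lra.
have gmid : in_gap k mid by apply: in_gapE; rewrite lo_mid.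
have small (e q Q : R) : 0 < e -> 0 < q -> exists t, [/\ 0 < t, t <= e & Q < q / t].
  move=> e0 q0; have Q1 : 0 < `|Q| + 1 by rewrite ltr_wpDl.
  exists (Num.min e (q / (`|Q| + 1))); split.
  - by rewrite lt_min e0 divr_gt0.
  - by rewrite ge_min lexx.
  - have m0 : 0 < Num.min e (q / (`|Q| + 1)) by rewrite lt_min e0 divr_gt0.
    apply: (@lt_le_trans _ _ (`|Q| + 1)).
      by rewrite ltr_pwDr// ler_norm.
    by rewrite ler_pdivlMr// mulrC -ler_pdivlMr// ge_min lexx orbT.
have [xl [xl_lo xl_mid hxl]] :
    exists xl, [/\ lo < xl, xl <= mid & p xl - b * Kr d xl <= 0].
  (* The threshold is chosen so that [KrB_ge] between [lo + t] and [mid], at the pole [lo], yields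
     [Kr d (lo + t) >= P / b]. *)
  have [|t [t0 tm ht]] := small (mid - lo) (d k) (P / b - Kr d mid + d k / (mid - lo)) _ dk.
    by rewrite subr_gt0.
  exists (lo + t); split; [lra|lra|].
  have gx : in_gap k (lo + t) by apply: in_gapE; apply/andP; split; lra.
  have /andP[_ pP1] : 0 <= p (lo + t) <= P by apply: pP; apply/andP; split; lra.
  have le : lo + t <= mid by lra.
  have := KrB_ge wd (same_gap_in k1 gx gmid) le k1.
  rewrite (_ : lo + t + gamma k = t); last by rewrite /lo; lra.
  rewrite (_ : mid + gamma k = mid - lo); last by rewrite /lo; lra.
  move=> h; have : P / b <= Kr d (lo + t) by lra.
  by rewrite ler_pdivrMr// mulrC; lra.
have [xr [xr_mid xr_up hxr gxr]] :
    exists xr, [/\ mid <= xr, xr <= 0, 0 < p xr - b * Kr d xr & in_gap k xr].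
  have [k_1|kn1] := eqVneq k 1%N.
    exists 0; split => //; first by lra.
      by rewrite subr_gt0.
    by split; [lra|rewrite k_1].
  have k11 : (1 <= k.-1)%N by case: (k) k1 kn1 => [|[]].
  have upE : up = - gamma k.-1 by rewrite /up /gap_end (negbTE kn1).
  have [|t [t0 tm ht]] := small (up - mid) (d k.-1)
    (Kr d mid + d k.-1 / (up - mid)) _ (wd.1 _ k11).
    by rewrite subr_gt0.
  have gx : in_gap k (up - t) by apply: in_gapE; apply/andP; split; lra.
  exists (up - t); split => //; [lra|lra|].
  have /andP[pP1 _] : 0 <= p (up - t) <= P by apply: pP; apply/andP; split; lra.
  have le : mid <= up - t by lra.
  have := KrB_ge wd (same_gap_in k1 gmid gx) le k11.
  rewrite (_ : up - t + gamma k.-1 = - t); last by rewrite upE; lra.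
  rewrite (_ : mid + gamma k.-1 = - (up - mid)); last by rewrite upE; lra.
  rewrite !invrN !mulrN => h; have : b * Kr d (up - t) < b * 0.
    by rewrite ltr_pM2l//; lra.
  by rewrite mulr0; lra.
have sub x : xl <= x <= xr -> in_gap k x.
  move=> /andP[h1 h2]; split=> [|k2]; first by lra.
  exact: le_lt_trans h2 (gxr.2 k2).
have le : xl <= xr by lra.
have [||x] := @IVT R (fun x => p x - b * Kr d x) xl xr 0 le.
- apply: continuous_in_subspaceT => x; rewrite inE /= in_itv /= => /sub gx.
  apply: cvgB; first exact: pc.
  apply: cvgMl_tmp; apply: Kr_continuous => //; exact: in_gap_npole gx.
- by rewrite ge_min le_max hxl (ltW hxr) orbT.
rewrite in_itv /= => /andP[xl_x x_xr] /eqP; rewrite subr_eq0 => /eqP e.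
exists x; split=> //; first by apply: sub; rewrite xl_x.
rewrite lt_neqAle (le_trans x_xr)// andbT.
by apply: contraTneq p0 => x0; rewrite -x0 e ltxx.
Qed.

(** Only the pole at the left end can make [Kr] large and positive in the gap: poles on the right
    contribute negatively, those further left a bounded amount. This locates the gap zeros as [a_n]
    grows. *)
Lemma Kr_le d k : weight d -> (1 <= k)%N ->
  exists C, forall x, in_gap k x -> Kr d x <= d k / (x + gamma k) + C.
Proof.
move=> wd k1; have [s hs] := wd.2.
have gk := gamma_gt0 k1; have /andP[_ gk1] := gamma_inc k1.
(* For [j > k] one has [x + gamma j > gamma j - gamma k >= gamma j / M]. *)
pose M := gamma k.+1 / (gamma k.+1 - gamma k).
have M0 : 0 <= M by rewrite divr_ge0//; lra.
exists (M * s) => x gx.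
have hk : 0 < x + gamma k by case: gx => ? _; lra.
have rk : rsum (fun j => if j == k then d k / (x + gamma k) else 0)
    (d k / (x + gamma k)).
  rewrite /rsum; apply: cvg_near_cst; near=> N.
  have kN : (k < N)%N by near: N; exact: nbhs_infty_gt.
  by rewrite -big_mkcond /= big_nat1_eq k1 kN.
apply: (ler_rsum _ (rsum_Kr wd (in_gap_npole k1 gx)) (rsumD rk (rsumZ M hs))).
move=> j j1; have gj := gamma_gt0 j1; have dj := wd.1 _ j1.
have Md : 0 <= M * (d j / gamma j) by rewrite mulr_ge0// divr_ge0// ltW.
have [e|jk] := eqVneq j k; first by rewrite e in Md *; rewrite lerDl.
rewrite add0r; have [kj|{}jk] : (k < j)%N \/ (j < k)%N.
  by apply/orP; rewrite -neq_ltn eq_sym.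
- have g1 : gamma k.+1 <= gamma j by rewrite gamma_le.
  rewrite mulrCA ler_pM2l//.
  rewrite -lef_pV2 ?posrE; last 2 first.
  + by rewrite mulr_gt0 ?invr_gt0// divr_gt0//; lra.
  + by rewrite invr_gt0; case: gx => ? _; lra.
  rewrite invrK invfM invrK /M invf_div.
  apply: (@le_trans _ _ (gamma j - gamma k)); last by case: gx => ? _; lra.
  rewrite mulrAC ler_pdivrMr; last by lra.
  by nra.
- apply: le_trans Md; rewrite pmulr_rle0// invr_le0.
  have k2 : (2 <= k)%N by rewrite (leq_trans _ jk).
  have jk1 : (j <= k.-1)%N by rewrite -ltnS prednK// ltnW.
  have := gamma_le j1 jk1; have := gx.2 k2; lra.
Unshelve. all: by end_near. Qed.

End PartialFractions.

(** * The zeros of the characteristic function *)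

Section ZeroSet.
Variable R : realType.
Variable gamma : nat -> R.
Hypothesis gamma_inc : forall k, (1 <= k)%N -> 0 < gamma k < gamma k.+1.
Hypothesis gamma_oo : gamma @ \oo --> +oo.
Variable c : nat -> R.
Hypothesis wc : weight gamma c.
Variables A b : R.
Hypothesis b0 : 0 < b.
Hypothesis A0 : 0 < A.
Hypothesis bA : b * Kr gamma c 0 < A.
Implicit Types (z w : R[i]) (d : nat -> R).

Local Notation npole := (npole gamma).
Local Notation in_gap := (in_gap gamma).

(** This is [ell] with [A = a_n^2] and [b = a_n^(2 theta)]; only the inequality [bA] between the two
    matters for the shape of the zero set. *)
Definition charfun z : R[i] := z ^+ 2 + A%:C - b%:C * Khat c gamma z.

Definition charzeros : set R[i] := [set z | npole z /\ charfun z = 0].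

Lemma ReC z : complex.Re z^*%C = complex.Re z. Proof. by case: z. Qed.
Lemma ImC z : complex.Im z^*%C = - complex.Im z. Proof. by case: z. Qed.

Lemma mulcJ z : z * z^*%C = (normc z ^+ 2)%:C.
Proof.
rewrite normc_sqrtE sqr_sqrtr ?addr_ge0 ?sqr_ge0//.
by apply/eqP; rewrite eq_complex Re_mul Im_mul ReC ImC /=; apply/andP; split; apply/eqP; ring.
Qed.

Lemma conjcB z w : (z - w)^*%C = z^*%C - w^*%C. Proof. exact: (rmorphB conjc). Qed.
Lemma conjcD z w : (z + w)^*%C = z^*%C + w^*%C. Proof. exact: (rmorphD conjc). Qed.
Lemma conjcM z w : (z * w)^*%C = z^*%C * w^*%C. Proof. exact: (rmorphM conjc). Qed.

Lemma conj_shift z (x : R) : z^*%C + x%:C = (z + x%:C)^*%C.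
Proof. by rewrite conjcD conjc_real. Qed.

Lemma npole_conj z : npole z -> npole z^*%C.
Proof.
move=> /npoleP h; apply/npoleP => k /h; rewrite conj_shift; by rewrite conjc_eq0.
Qed.

Lemma npole_nonreal z : complex.Im z != 0 -> npole z.
Proof. by move=> h k _; apply: contraNneq h => ->. Qed.

Lemma Khat_conj d z : weight gamma d -> npole z ->
  Khat d gamma z^*%C = (Khat d gamma z)^*%C.
Proof.
move=> wd np; apply: csum_Khat.
have [h1 h2] := csum_term gamma_inc gamma_oo wd np.
have e k : (d k)%:C / (z^*%C + (gamma k)%:C) = (term gamma d z k)^*%C.
  by rewrite conj_shift /term conjcM conjc_real conjc_inv.
split; rewrite (ReC, ImC).
  by apply: rsum_ext h1 => k _; rewrite e ReC.
by apply: rsum_ext (rsumN h2) => k _; rewrite e ImC.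
Qed.

(* [- Khat] is a Nevanlinna function. *)
Lemma Khat_real_real d z (t : R) : weight gamma d -> npole z ->
  Khat d gamma z = t%:C -> complex.Im z = 0.
Proof.
move=> wd np e; have npc := npole_conj np.
have [Q hQ] := csum_term2 gamma_inc gamma_oo wd np npc.
have := KhatB gamma_inc gamma_oo wd np npc hQ.
rewrite Khat_conj// e conjc_real subrr => /esym/eqP.
(* At conjugate points the difference quotient is the sum of [d k / |z + gamma k|^2], which is
   positive, so equal values force [z] to be its own conjugate. *)
have Q0 : Q != 0.
  have [hr _] := hQ.
  have e1 k : complex.Re ((d k)%:C / ((z + (gamma k)%:C) * (z^*%C + (gamma k)%:C)))
      = d k / normc (z + (gamma k)%:C) ^+ 2.
    by rewrite conj_shift mulcJ -fmorph_div.
  have pos k : (1 <= k)%N -> 0 < d k / normc (z + (gamma k)%:C) ^+ 2.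
    move=> k1; rewrite divr_gt0 ?wd.1// exprn_gt0// normc_gt0.
    by have /npoleP := np; apply.
  have : 0 < complex.Re Q.
    apply: lt_le_trans (pos _ (leqnn 1)) _; rewrite -e1.
    by apply: (rsum_term_le _ hr) => // k /pos; rewrite e1; exact: ltW.
  by apply: contraTneq => ->; rewrite ltxx.
rewrite mulf_eq0 (negbTE Q0) orbF oppr_eq0 subr_eq0 eq_complex ImC => /andP[_].
by rewrite -addr_eq0 -mulr2n mulrn_eq0 /= => /eqP.
Qed.

Lemma charfun_conj z : npole z -> charfun z^*%C = (charfun z)^*%C.
Proof.
by move=> np; rewrite /charfun Khat_conj// conjcB conjcD conjcM !expr2 conjcM !conjc_real.
Qed.

Lemma charfun_real (x : R) : npole x%:C ->
  charfun x%:C = (x ^+ 2 + A - b * Kr gamma c x)%:C.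
Proof.
by move=> np; rewrite /charfun Khat_real// rmorphB rmorphD rmorphM expr2 rmorphM.
Qed.

Lemma npole_ge0 (x : R) : 0 <= x -> npole x%:C.
Proof.
move=> x0; apply/npole_real => k k1.
by rewrite gt_eqF// ltr_wpDl// (gamma_gt0 gamma_inc).
Qed.

(** For [x >= 0] the sum is at most [Kr gamma c 0], and [bA] keeps the function positive. Hence two
    real zeros have a positive product, as [charzeros_pair] requires. *)
Lemma charzeros_lt0 (x : R) : charzeros x%:C -> x < 0.
Proof.
move=> [np]; rewrite charfun_real// => /(@complexI R) e.
rewrite ltNge; apply/negP => x0.
have : Kr gamma c x <= Kr gamma c 0.
  move: x0; rewrite le_eqVlt => /predU1P[<-//|x0].
  apply/ltW/(Kr_lt gamma_inc gamma_oo wc) => // k k1.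
  have gk := gamma_gt0 gamma_inc k1.
  by rewrite add0r mulr_gt0// addr_gt0.
rewrite -(ler_pM2l b0) => h.
have : 0 < x ^+ 2 + A - b * Kr gamma c x.
  by rewrite -addrA ltr_wpDl ?sqr_ge0// subr_gt0 (le_lt_trans h).
by rewrite e ltxx.
Qed.

(** An equation in [R[i]] with real [d] covers conjugate pairs and pairs of real zeros at once. *)
Definition prod_weight d w w' := weight gamma d /\ forall k, (1 <= k)%N ->
  (d k)%:C = (c k)%:C / ((w + (gamma k)%:C) * (w' + (gamma k)%:C)).

(** The [d k] are themselves summable by [csum_term2]; division by [gamma k >= gamma 1] preserves
    this. *)
Lemma prod_weightP d w w' : npole w -> npole w' ->
  (forall k, (1 <= k)%N -> 0 < d k) ->
  (forall k, (1 <= k)%N ->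
     (d k)%:C = (c k)%:C / ((w + (gamma k)%:C) * (w' + (gamma k)%:C))) ->
  prod_weight d w w'.
Proof.
move=> np np' d0 dE; split => //; split => //.
have [Q [hQ _]] := csum_term2 gamma_inc gamma_oo wc np np'.
have g1 := gamma_gt0 gamma_inc (leqnn 1).
apply: (rsum_major (m := fun k => (gamma 1)^-1 *
  complex.Re ((c k)%:C / ((w + (gamma k)%:C) * (w' + (gamma k)%:C)))));
  last exact: rsumZ hQ.
move=> k k1; rewrite -dE//= mulrC normrM gtr0_norm ?invr_gt0 ?(gamma_gt0 gamma_inc)//.
rewrite gtr0_norm ?d0// ler_pM2r ?d0// lef_pV2 ?posrE ?(gamma_gt0 gamma_inc)//.
exact: (gamma_le gamma_inc).
Qed.

(** Newton interpolation of [Khat] at [w] and [w']: the second divided difference is [Khat d], and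
    the first one is known because both nodes are zeros. *)
Lemma charfun_factor d w w' z : prod_weight d w w' -> w != w' ->
  charzeros w -> charzeros w' -> npole z ->
  charfun z = (z - w) * (z - w') * (1 - b%:C * Khat d gamma z).
Proof.
move=> [wd dE] ww' [np Fw] [np' Fw'] hz.
have [Q hQ] := csum_term2 gamma_inc gamma_oo wc np np'.
(* Subtract the equations of the two zeros and cancel [w - w']. *)
have bQ : b%:C * Q = - (w + w').
  have := KhatB gamma_inc gamma_oo wc np np' hQ => e.
  apply: (@mulfI _ (w - w')); first by rewrite subr_eq0.
  rewrite (_ : _ * (b%:C * Q) = - (b%:C * (- (w - w') * Q))); last by ring.
  rewrite -e; move: Fw Fw'; rewrite /charfun => /subr0_eq Fw /subr0_eq Fw'.
  by rewrite mulrBr -Fw -Fw'; ring.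
have Kz : Khat c gamma z = Khat c gamma w - (z - w) * Q
    + (z - w) * (z - w') * Khat d gamma z.
  apply: csum_Khat.
  have h := csumD (csumB (csum_term gamma_inc gamma_oo wc np) (csumZ (z - w) hQ))
    (csumZ ((z - w) * (z - w')) (csum_term gamma_inc gamma_oo wd hz)).
  apply: csum_ext h => k k1; rewrite /term dE//.
  have /npoleP/(_ k k1) h1 := np; have /npoleP/(_ k k1) h2 := np'.
  by have /npoleP/(_ k k1) h3 := hz; field; rewrite h1 h2 h3.
move: Fw; rewrite /charfun => /subr0_eq Fw.
rewrite Kz mulrDr mulrBr -Fw.
rewrite (_ : b%:C * ((z - w) * Q) = (z - w) * (b%:C * Q)); last by ring.
by rewrite bQ; ring.
Qed.

Definition gap_seq (lam : nat -> R) :=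
  forall k, (1 <= k)%N -> in_gap k (lam k) /\ lam k < 0.

(* By partial fractions [charfun] is [(z - w) (z - w')] times
   [1 - b \sum_k d k / (z + gamma k)], and this last factor, whose weights are
   positive, has one zero in each gap and no other one. *)
Lemma charzeros_pair d w w' (P : R) : prod_weight d w w' -> w != w' ->
  charzeros w -> charzeros w' -> w * w' = P%:C -> 0 < P ->
  exists2 lam, gap_seq lam & charzeros =
    [set (lam k)%:C | k in [set k : nat | (1 <= k)%N]] `|` [set w; w'].
Proof.
move=> pw ww' zw zw' wP P0; have wd := pw.1.
have fac z : npole z -> charfun z = _ := charfun_factor pw ww' zw zw'.
have np0 := npole_ge0 (lexx 0).
(* The factorization at 0: the left side is positive by [bA] and so is [w * w'], hence the last
   factor is positive too. *)
have d0 : b * Kr gamma d 0 < 1.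
  have := fac _ np0; rewrite charfun_real// expr0n add0r.
  rewrite !sub0r mulrNN wP Khat_real// -rmorphM -[1]/(1%:C) -rmorphB -rmorphM.
  move=> /(@complexI R) e.
  have : 0 < P * (1 - b * Kr gamma d 0) by rewrite -e subr_gt0.
  by rewrite pmulr_rgt0// subr_gt0.
have lamP k : exists x : R, (1 <= k)%N ->
    [/\ in_gap k x, x < 0 & 1 = b * Kr gamma d x].
  have [k1|] := boolP (1 <= k)%N; last by exists 0.
  have [||x hx] := @zero_in_gap R gamma gamma_inc gamma_oo d b (cst 1) 1 k wd b0 _ _ d0 k1.
  - by move=> x; exact: cst_continuous.
  - by move=> x _; rewrite /= ler01 lexx.
  by exists x.
have [lam hlam] := choice lamP.
exists lam; first by move=> k /hlam[].
apply/seteqP; split => z.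
- move=> [np Fz]; have [->|zw1] := eqVneq z w; first by right; left.
  have [->|zw2] := eqVneq z w'; first by right; right.
  left; move: Fz; rewrite fac// => /eqP; rewrite !mulf_eq0 !subr_eq0.
  rewrite (negbTE zw1) (negbTE zw2) /= => /eqP e.
  have bC : b%:C != 0 :> R[i] by rewrite (fmorph_eq0 (real_complex R)) gt_eqF.
  (* A zero of the last factor gives [Khat d] a real value, so it is real, and monotonicity
     identifies it with the zero of its gap. *)
  have Kz : Khat d gamma z = (b^-1)%:C.
    by apply: (mulfI bC); rewrite -e -rmorphM mulfV// gt_eqF.
  have zR : z = (complex.Re z)%:C.
    by have := Khat_real_real wd np Kz; case: (z) => x y /= ->.
  set x := complex.Re z in zR; rewrite zR in np Kz *.
  have [k k1 gx] := in_gap_exists gamma_oo np.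
  exists k => //; congr (_%:C); have [gl _ hl] := hlam k k1.
  apply: (Kr_inj gamma_inc gamma_oo wd (same_gap_in gamma_inc k1 gl gx)).
  move: Kz; rewrite Khat_real// => /(@complexI R) ->.
  by apply: (mulfI (lt0r_neq0 b0)); rewrite -hl mulfV// gt_eqF.
- case=> [[k k1 <-]|[->|->]]//.
  have [gl _ hl] := hlam k k1; have np := in_gap_npole gamma_inc k1 gl.
  split => //; rewrite fac// Khat_real// -rmorphM -hl -[1]/(1%:C) subrr mulr0 //.
Qed.

(* [charzeros_pair] applies to a conjugate pair of non-real zeros, or else to two
   real zeros in a common gap. If neither exists, the zeros are exactly one per
   gap, and [wp], [wm] repeat one of them. *)
Lemma charzeros_structure : exists (lam : nat -> R) (wp wm : R[i]),
  [/\ gap_seq lam,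
    charzeros = [set (lam k)%:C | k in [set k : nat | (1 <= k)%N]]
      `|` [set wp; wm]
  & forall w, charzeros w -> 0 < complex.Im w -> wp = w /\ wm = w^*%C ].
Proof.
have [[w zw Iw]|nreal] := pselect (exists2 w, charzeros w & 0 < complex.Im w).
  have [np Fw] := zw; have npc := npole_conj np.
  have ww : w != w^*%C.
    rewrite eq_complex ImC negb_and -addr_eq0 -mulr2n mulrn_eq0 /=.
    by rewrite (gt_eqF Iw) orbT.
  have zwc : charzeros w^*%C by split=> //; rewrite charfun_conj// Fw conjc0.
  have nz k : (1 <= k)%N -> 0 < normc (w + (gamma k)%:C).
    by move=> k1; rewrite normc_gt0; have /npoleP := np; apply.
  have [||lam hlam ZE] := @charzeros_pair (fun k => c k / normc (w + (gamma k)%:C) ^+ 2)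
      w w^*%C (normc w ^+ 2) _ ww zw zwc (mulcJ w).
  - apply: prod_weightP => // k k1; first by rewrite divr_gt0 ?wc.1// exprn_gt0 ?nz.
    by rewrite conj_shift mulcJ fmorph_div.
  - rewrite exprn_gt0// normc_gt0; apply: contraTneq Iw => ->.
    by rewrite ltxx.
  exists lam, w, w^*%C; split => // w1; rewrite ZE => -[[k _ <-]|[->//|->]].
    by rewrite /= ltxx.
  by rewrite ImC oppr_gt0 ltNge ltW.
have zreal z : charzeros z -> z = (complex.Re z)%:C.
  move=> zz; have [np Fz] := zz; have [I0|I0|] := ltgtP (complex.Im z) 0; last 1 first.
  - by case: (z) => x y /= ->.
  - exfalso; apply: nreal; exists z^*%C; last by rewrite ImC oppr_gt0.
    by split; [exact: npole_conj|rewrite charfun_conj// Fz conjc0].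
  - by exfalso; apply: nreal; exists z.
have [[x [y [k [k1 xy gx gy [zx zy]]]]]|uniq] := pselect (exists x y k,
    [/\ (1 <= k)%N, x != y, in_gap k x, in_gap k y &
        charzeros x%:C /\ charzeros y%:C]).
  have sg := same_gap_in gamma_inc k1 gx gy.
  have [||||lam hlam ZE] := @charzeros_pair (fun k => c k / ((x + gamma k) * (y + gamma k)))
      x%:C y%:C (x * y) _ _ zx zy.
  - apply: prod_weightP; [exact: zx.1|exact: zy.1| |].
      by move=> j j1; rewrite divr_gt0 ?wc.1 ?sg.
    by move=> j j1; rewrite -!rmorphD -rmorphM fmorph_div.
  - by apply: contra xy => /eqP/(@complexI R) ->.
  - by rewrite rmorphM.
  - have := charzeros_lt0 zx; have := charzeros_lt0 zy => y0 x0.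
    by rewrite nmulr_rgt0.
  (* The last clause is vacuous here: no zero lies in the open upper half-plane. *)
  exists lam, x%:C, y%:C; split => // w zw Iw.
  by exfalso; apply: nreal; exists w.
have lamP k : exists x : R, (1 <= k)%N ->
    [/\ in_gap k x, x < 0 & x ^+ 2 + A = b * Kr gamma c x].
  have [k1|] := boolP (1 <= k)%N; last by exists 0.
  have [|||x hx] := @zero_in_gap R gamma gamma_inc gamma_oo c b
      (fun x => x ^+ 2 + A) (gamma k ^+ 2 + A) k wc b0 _ _ _ k1.
  - by move=> x; apply: cvgD; [exact: exprn_continuous|exact: cvg_cst].
  - move=> x /andP[x1 x2]; rewrite addr_ge0 ?sqr_ge0 ?(ltW A0)//= lerD2r.
    by rewrite -sqrrN ler_sqr ?nnegrE ?(ltW (gamma_gt0 gamma_inc k1))//; lra.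
  - by rewrite expr0n add0r.
  by exists x.
have [lam hlam] := choice lamP.
have zlam k : (1 <= k)%N -> charzeros (lam k)%:C.
  move=> k1; have [gl _ hl] := hlam k k1; have np := in_gap_npole gamma_inc k1 gl.
  by split => //; rewrite charfun_real// -hl subrr.
exists lam, (lam 1%N)%:C, (lam 1%N)%:C; split.
- by move=> k /hlam[].
- apply/seteqP; split=> z.
  + move=> zz; left; have zR := zreal z zz; set x := complex.Re z in zR.
    rewrite zR in zz *; have [np _] := zz.
    have [k k1 gx] := in_gap_exists gamma_oo np.
    exists k => //; congr (_%:C); apply/eqP; apply: contrapT => /negP ne.
    have [gl _ _] := hlam k k1.
    by apply: uniq; exists (lam k), x, k; split => //; split => //; exact: zlam.
  + by case=> [[k k1 <-]|[->|->]]; exact: zlam.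
- by move=> w zw Iw; exfalso; apply: nreal; exists w.
Qed.

End ZeroSet.

(** * Primitives and mean values *)

Section Calculus.
Variable R : realType.
Implicit Types (F G f g : R -> R) (a b x : R).

Lemma MVT_closed F f a b : a <= b ->
  (forall x, a <= x <= b -> is_derive x 1 F (f x)) ->
  exists2 x, a <= x <= b & F b - F a = f x * (b - a).
Proof.
move=> ab dF; have [||x] := @MVT_segment R F f a b ab.
- by move=> x; rewrite in_itv /= => /andP[ax xb]; apply: dF; rewrite !ltW.
- apply: derivable_within_continuous => x; rewrite in_itv /= => /dF dFx.
  exact: ex_derive.
by rewrite in_itv /= => xab e; exists x.
Qed.

(** Plays the role of monotonicity of the integral: a bound on derivatives becomes a bound on
    increments, with no integrability to check. *)
Lemma ler_increment F G f g a b : a <= b ->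
  (forall x, a <= x <= b -> is_derive x 1 F (f x)) ->
  (forall x, a <= x <= b -> is_derive x 1 G (g x)) ->
  (forall x, a <= x <= b -> f x <= g x) ->
  F b - F a <= G b - G a.
Proof.
move=> ab dF dG fg; have [|x xab +] := @MVT_closed (G - F) (fun x => g x - f x) a b ab.
  by move=> x xab; have := dF x xab; have := dG x xab => ? ?; exact: is_deriveB.
rewrite !fctE => e; have : 0 <= (g x - f x) * (b - a).
  by rewrite mulr_ge0// subr_ge0// fg.
by rewrite -e; lra.
Qed.

Lemma norm_increment F G f g a b : a <= b ->
  (forall x, a <= x <= b -> is_derive x 1 F (f x)) ->
  (forall x, a <= x <= b -> is_derive x 1 G (g x)) ->
  (forall x, a <= x <= b -> `|f x| <= g x) ->
  `|F b - F a| <= G b - G a.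
Proof.
move=> ab dF dG fg; rewrite ler_norml; apply/andP; split; last first.
  by apply: (ler_increment ab dF dG) => x /fg; apply: le_trans; exact: ler_norm.
rewrite lerNl (_ : - (F b - F a) = (- F) b - (- F) a); last by rewrite !fctE; ring.
apply: (@ler_increment (- F) G (fun x => - f x) g) => // x xab.
  by have := dF x xab => ?; exact: is_deriveN.
by apply: le_trans (fg x xab); rewrite -normrN; exact: ler_norm.
Qed.

Lemma norm_increment_le F f C a b : a <= b ->
  (forall x, a <= x <= b -> is_derive x 1 F (f x)) ->
  (forall x, a <= x <= b -> `|f x| <= C) ->
  `|F b - F a| <= C * (b - a).
Proof.
move=> ab dF fC; have [x xab ->] := MVT_closed ab dF.
by rewrite normrM [`|b - a|]ger0_norm ?subr_ge0// ler_wpM2r ?subr_ge0// fC.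
Qed.

Lemma is_derive_lin F (dF w : R) x : is_derive (w * x) 1 F dF ->
  is_derive x 1 (fun x => F (w * x)) (w * dF).
Proof.
move=> h; have hw : is_derive x 1 (fun x => w * x) w.
  by have := is_deriveZ w (is_derive_id (x : R) 1); rewrite -[w *: 1]/(w * 1) mulr1.
by have := is_derive1_comp h hw; rewrite mulrC.
Qed.

Lemma is_derive_sin_lin (w x : R) :
  is_derive x 1 (fun x => sin (w * x)) (w * cos (w * x)).
Proof. exact: is_derive_lin. Qed.

Lemma is_derive_cos_lin (w x : R) :
  is_derive x 1 (fun x => cos (w * x)) (- w * sin (w * x)).
Proof. by rewrite mulNr -mulrN; exact: is_derive_lin. Qed.

Lemma is_derive_expR_lin (w x : R) :
  is_derive x 1 (fun x => expR (w * x)) (w * expR (w * x)).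
Proof. exact: is_derive_lin. Qed.

Lemma is_derive_scale F (dF w : R) x : is_derive x 1 F dF ->
  is_derive x 1 (fun x => w * F x) (w * dF).
Proof. by move=> h; have := is_deriveZ w h. Qed.

Lemma is_derive_bigsum n (h dh : nat -> R -> R) x :
  (forall k, is_derive x 1 (h k) (dh k x)) ->
  is_derive x 1 (fun x => \sum_(k < n) h k x) (\sum_(k < n) dh k x).
Proof.
move=> hd; elim: n => [|n IHn].
  rewrite big_ord0 (_ : (fun _ => _) = cst 0); first exact: is_derive_cst.
  by apply/funext => y; rewrite big_ord0.
rewrite big_ord_recr /= (_ : (fun _ => _) =
  (fun x => \sum_(k < n) h k x) + h n); first by apply: is_deriveD.
by apply/funext => y; rewrite big_ord_recr.
Qed.

(** An integral with lower limit [- N] gives a primitive only on [x > - N]. Normalised at 0 these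
    primitives agree on overlaps, so [N] may depend on the point. *)
Lemma continuous_antiderivative f : continuous f ->
  exists F, forall x, is_derive x 1 F (f x).
Proof.
move=> cf; pose mu := @lebesgue_measure R.
pose F N x := (\int[mu]_(t in `[- N, x]) (f t))%R.
have dF N x : - N < x -> is_derive x 1 (F N) (f x).
  move=> Nx; have xu : x < x + 1 by rewrite ltrDl.
  have fi : mu.-integrable `[- N, x + 1] (EFin \o f).
    apply: continuous_compact_integrable; first exact: segment_compact.
    exact: continuous_subspaceT.
  have [d e] := continuous_FTC1_closed xu fi Nx (cf x).
  exact: (DeriveDef d (etrans (esym (derive1E _ _)) e)).
have FE N M x : `|x| < N -> N <= M -> F M x - F M 0 = F N x - F N 0.
  move=> xN NM; have /andP[xN1 xN2] : - N < x < N by rewrite -ltr_norml.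
  have N0 : 0 < N by apply: le_lt_trans xN.
  have h u v : - N < u -> u <= v -> F M v - F M u = F N v - F N u.
    move=> Nu uv; have [|y _ +] := @MVT_closed (F M - F N) (cst 0) u v uv.
      move=> y /andP[uy _]; rewrite /= -(subrr (f y)).
      by have := dF N y; have := dF M y => h1 h2; apply: is_deriveB;
        [apply: h1|apply: h2]; lra.
    by rewrite !fctE mul0r; lra.
  have [x0|x0] := leP 0 x; first by apply: h => //; lra.
  by have := h x 0 xN1 (ltW x0); lra.
exists (fun x => F (`|x| + 1) x - F (`|x| + 1) 0) => x.
(* Large enough for all [y] within 1 of [x], since [|y| + 1 <= N]. *)
pose N := `|x| + 2.
have : is_derive x 1 (fun y => F N y - F N 0) (f x).
  rewrite -[f x]subr0; apply: is_deriveB; apply: dF.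
  by rewrite /N; have := ler_norm (- x); rewrite normrN; lra.
apply: near_eq_is_derive.
near=> y.
apply: FE; first by rewrite ltrDl.
have yx : `|x - y| <= 1.
  by near: y; apply: cvgr_dist_le; [exact: cvg_id|exact: ltr01].
by rewrite /N; have := ler_normD (y - x) x; rewrite subrK distrC; lra.
Unshelve. all: by end_near. Qed.

End Calculus.

(** * Partial sums of the cosecant series *)

Section Cosecant.
Variable R : realType.
Implicit Types (x s : R) (N : nat).

Lemma norm_sin_le x : 0 <= x -> `|sin x| <= x.
Proof.
move=> x0; have := @norm_increment_le R sin cos 1 0 x x0.
by rewrite sin0 !subr0 mul1r; apply=> y _; exact: cos_max.
Qed.

Lemma is_derive_sqr_half x : is_derive x 1 (fun x => x ^+ 2 / 2) x.
Proof.
have -> : (fun x => x ^+ 2 / 2) = (fun x => 2^-1 * (fun x => x ^+ 2) x).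
  by apply/funext => y; rewrite mulrC.
have h : is_derive x 1 (fun x => x ^+ 2) (2 * x).
  by have := is_deriveX 2 (is_derive_id x 1); rewrite /GRing.scale /= expr1 mulr1.
by have := is_derive_scale 2^-1 h; rewrite mulrA mulVf ?mul1r.
Qed.

Lemma cos_ge_sqr x : 0 <= x -> 1 - cos x <= x ^+ 2 / 2.
Proof.
move=> x0; have := @ler_increment R (- cos) (fun x => x ^+ 2 / 2) sin id 0 x x0.
rewrite !fctE cos0 expr0n mul0r subr0 opprK addrC; apply.
- by move=> y _; rewrite -[sin y]opprK; apply: is_deriveN; exact: is_derive_cos.
- by move=> y _; exact: is_derive_sqr_half.
- by move=> y /andP[y0 _]; apply: le_trans (norm_sin_le y0); exact: ler_norm.
Qed.

(** A crude constant, which suffices to divide by [sin (x / 2)]. Beyond 1, monotonicity of the sine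
    and [pi / 2 < 2] are enough. *)
Lemma sin_ge x : 0 <= x <= pi / 2 -> x / 4 <= sin x.
Proof.
have hs (y : R) : 0 <= y <= 1 -> 2^-1 * y <= sin y.
  move=> /andP[y0 y1].
  have := @ler_increment R (fun z => 2^-1 * z) sin (fun=> 2^-1) cos 0 y y0.
  rewrite sin0 mulr0 !subr0; apply.
  - move=> z _; have := is_derive_scale 2^-1 (is_derive_id z 1).
    by rewrite mulr1.
  - move=> z /andP[z0 zy]; have := cos_ge_sqr z0.
    have : z ^+ 2 <= 1 by rewrite expr_le1//; lra.
    by lra.
move=> /andP[x0 xpi]; have [x1|x1] := leP x 1.
  have := hs x; rewrite x0 x1 => /(_ isT); lra.
have := hs 1; rewrite lexx ler01 => /(_ isT) h1.
have := @pihalf_ge1 R; have := @pihalf_lt2 R => pi2 pi1.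
have : sin 1 < sin x.
  by rewrite ltr_sin// in_itv /=; apply/andP; split; lra.
lra.
Qed.

Lemma dirichlet_kernel N x :
  sin (x / 2) * (1 + \sum_(k < N) 2 * cos (k.+1%:R * x)) = sin ((N%:R + 2^-1) * x).
Proof.
elim: N => [|N IHN].
  by rewrite big_ord0 add0r addr0 mulr1 mulrC.
rewrite big_ord_recr /= addrA mulrDr IHN.
rewrite (_ : (N%:R + 2^-1) * x = N.+1%:R * x - x / 2); last first.
  by rewrite -natr1; field.
rewrite (_ : (N.+1%:R + 2^-1) * x = N.+1%:R * x + x / 2); last by field.
by rewrite sinB sinD; ring.
Qed.

(** Symmetric partial sums of the Mittag-Leffler expansion of [pi / sin (pi s)], the poles at
    [k + 1] and [- (k + 1)] being paired. *)
Definition csc_sum s N := s^-1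
  + \sum_(k < N) (-1) ^+ k.+1 * ((k.+1%:R + s)^-1 - (k.+1%:R - s)^-1).

(* [gap N] is the primitive, vanishing at [0], of [cos (s x) - 1] times the
   Dirichlet kernel; at [pi] it is [sin (pi s) * csc_sum s N - pi]. *)
Let gap s N x := s^-1 * sin (s * x) + \sum_(k < N)
    ((k.+1%:R + s)^-1 * sin ((k.+1%:R + s) * x)
     + (k.+1%:R - s)^-1 * sin ((k.+1%:R - s) * x)
     - 2 * (k.+1%:R^-1 * sin (k.+1%:R * x))) - x.

Let gap_derive s N x : 0 < s < 1 -> is_derive x 1 (gap s N)
  ((cos (s * x) - 1) * (1 + \sum_(k < N) 2 * cos (k.+1%:R * x)) : R).
Proof.
move=> /andP[s0 s1].
have term (w : R) : 0 < w -> is_derive x 1 (fun x => w^-1 * sin (w * x)) (cos (w * x)).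
  move=> w0; have := is_derive_scale w^-1 (is_derive_sin_lin w x).
  by rewrite mulrA mulVf ?mul1r// gt_eqF.
have hk k : is_derive x 1 (fun x => (k.+1%:R + s)^-1 * sin ((k.+1%:R + s) * x)
     + (k.+1%:R - s)^-1 * sin ((k.+1%:R - s) * x)
     - 2 * (k.+1%:R^-1 * sin (k.+1%:R * x)))
    (cos ((k.+1%:R + s) * x) + cos ((k.+1%:R - s) * x) - 2 * cos (k.+1%:R * x)).
  have k1 : 1 <= k.+1%:R :> R by rewrite ler1n.
  apply: is_deriveB; last by apply: is_derive_scale; apply: term; lra.
  by apply: is_deriveD; apply: term; lra.
pose t (k : nat) : R :=
  cos ((k.+1%:R + s) * x) + cos ((k.+1%:R - s) * x) - 2 * cos (k.+1%:R * x).
have e : cos (s * x) + \sum_(k < N) t k - 1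
    = (cos (s * x) - 1) * (1 + \sum_(k < N) 2 * cos (k.+1%:R * x)).
  rewrite mulrDr mulr1 mulr_sumr addrAC; congr (_ + _).
  by apply: eq_bigr => k _; rewrite /t mulrDl mulrBl cosD cosB; ring.
apply: is_derive_eq e.
exact: is_deriveB (is_deriveD (term _ s0)
  (@is_derive_bigsum R N _ (fun k x => cos ((k.+1%:R + s) * x) +
     cos ((k.+1%:R - s) * x) - 2 * cos (k.+1%:R * x)) x hk)) (is_derive_id x 1).
Qed.

(** A quantitative Riemann-Lebesgue lemma: integrating by parts against [sin (nu x)] gains [1 / nu].
    The term [64 pi] bounds the integral of the derivative of [q], and [8 pi] its two boundary
    values. *)
Lemma csc_sum_bound s N : 0 < s < 1 ->
  `|sin (pi * s) * csc_sum s N - pi| <= (64 * pi + 8 * pi) / (N%:R + 2^-1).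
Proof.
move=> s01; have /andP[s0 s1] := s01.
have pi0 := @pi_gt0 R.
set nu : R := N%:R + 2^-1.
have nu0 : 0 < nu by rewrite ltr_wpDl.
have gappi : gap s N pi = sin (pi * s) * csc_sum s N - pi.
  rewrite /gap /csc_sum; congr (_ - _); rewrite [RHS]mulrDr mulr_sumr.
  rewrite (mulrC pi) (mulrC s^-1); congr (_ + _).
  apply: eq_bigr => k _.
  have e1 : sin (k.+1%:R * pi) = 0 :> R.
    rewrite mulr_natl -[_ *+ _]add0r.
    by rewrite (alternatingn (@sinDpi R)) sin0 mulr0.
  have e2 : sin ((k.+1%:R + s) * pi) = (-1) ^+ k.+1 * sin (s * pi).
    by rewrite mulrDl addrC mulr_natl (alternatingn (@sinDpi R)).
  have e3 : sin ((k.+1%:R - s) * pi) = - ((-1) ^+ k.+1 * sin (s * pi)).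
    rewrite mulrBl addrC mulr_natl (alternatingn (@sinDpi R)).
    by rewrite sinN mulrN.
  by rewrite e1 e2 e3; ring.
(* The numerator vanishes to second order at 0 and the denominator to first, so [q] and its
   derivative stay bounded. *)
pose q x := (cos (s * x) - 1) / sin (x / 2).
pose dq x := (- s * sin (s * x) * sin (x / 2)
   - (cos (s * x) - 1) * (cos (x / 2) / 2)) / sin (x / 2) ^+ 2.
have sx x : 0 < x <= pi -> x / 8 <= sin (x / 2).
  by move=> /andP[x0 xpi]; have := @sin_ge (x / 2) => h;
    apply: (le_trans _ (h _)); [lra|apply/andP; split; lra].
have sx0 x : 0 < x <= pi -> 0 < sin (x / 2).
  move=> h; have := sx x h; have /andP[x0 _] := h; lra.
have cosB1 x : 0 < x -> `|cos (s * x) - 1| <= x ^+ 2 / 2.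
  move=> x0; rewrite distrC ger0_norm ?subr_ge0 ?cos_le1//.
  apply: le_trans (cos_ge_sqr _) _; first by rewrite mulr_ge0// ltW.
  rewrite ler_pM2r ?invr_gt0// exprMn ler_piMl ?sqr_ge0// expr_le1//; lra.
have qle x : 0 < x <= pi -> `|q x| <= 4 * pi.
  move=> xpi; have /andP[x0 xp] := xpi.
  rewrite normrM normfV [`|sin _|]gtr0_norm ?sx0// ler_pdivrMr ?sx0//.
  apply: le_trans (cosB1 x x0) _.
  apply: (@le_trans _ _ (4 * pi * (x / 8))); last first.
    by rewrite ler_pM2l ?sx// mulr_gt0.
  by rewrite expr2; nra.
have dqle x : 0 < x <= pi -> `|dq x| <= 64.
  move=> xpi; have /andP[x0 xp] := xpi; have sp := sx0 x xpi.
  rewrite normrM normfV [`|sin _ ^+ 2|]ger0_norm ?sqr_ge0//.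
  rewrite ler_pdivrMr ?exprn_gt0//.
  apply: (@le_trans _ _ (64 * (x / 8) ^+ 2)); last first.
    rewrite ler_pM2l// ler_sqr ?nnegrE ?(ltW sp) ?sx//; lra.
  apply: le_trans (ler_normB _ _) _; rewrite !normrM normrN (gtr0_norm s0).
  have h1 : `|sin (s * x)| <= s * x by rewrite norm_sin_le// mulr_ge0// ltW.
  have h2 : `|sin (x / 2)| <= x / 2 by rewrite norm_sin_le//; lra.
  have h3 := cosB1 x x0.
  have h4 : `|cos (x / 2)| * `|2^-1| <= 1.
    by rewrite (gtr0_norm (_ : 0 < 2^-1 :> R)) ?invr_gt0//;
      have := cos_max (x / 2); lra.
  have h5 : s * `|sin (s * x)| * `|sin (x / 2)| <= x * (x / 2).
    apply: ler_pM => //; first by rewrite mulr_ge0// ltW.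
    apply: (@le_trans _ _ (1 * `|sin (s * x)|)).
      by rewrite ler_wpM2r// ltW.
    by rewrite mul1r (le_trans h1)// ler_piMl// ltW.
  have h6 : `|cos (s * x) - 1| * (`|cos (x / 2)| * `|2^-1|) <= x ^+ 2 / 2 * 1.
    by apply: ler_pM => //; rewrite mulr_ge0.
  rewrite expr2; rewrite expr2 in h6; lra.
have dqP x : 0 < x <= pi -> is_derive x 1 q (dq x).
  move=> xpi; have sp := sx0 x xpi.
  have hs : is_derive x 1 (fun x => sin (x / 2)) (cos (x / 2) / 2).
    have := is_derive_sin_lin 2^-1 x; rewrite mulrC.
    have -> : (fun x => sin (2^-1 * x)) = (fun x => sin (x / 2)).
      by apply/funext => y; rewrite mulrC.
    by rewrite [2^-1 * x]mulrC.
  have hc : is_derive x 1 (fun x => cos (s * x) - 1) (- s * sin (s * x)).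
    by have := is_deriveB (is_derive_cos_lin s x) (is_derive_cst (1 : R) (x : R) (1 : R)); rewrite subr0.
  have hv := is_deriveV (lt0r_neq0 sp) hs.
  apply: (@is_derive_eq _ _ _ _ _ _ _ _ (is_deriveM hc hv)).
  by rewrite /GRing.scale /= /dq; field; exact: lt0r_neq0.
(* The derivative of [gap] is [q x * sin (nu x)]; adding the boundary term of the integration by
   parts moves the derivative onto [q]. *)
pose U x := gap s N x + nu^-1 * (q x * cos (nu * x)).
have UP x : 0 < x <= pi -> is_derive x 1 U (nu^-1 * (dq x * cos (nu * x))).
  move=> xpi; have sp := sx0 x xpi.
  apply: (@is_derive_eq _ _ _ _ _ _ _ _ (is_deriveD (@gap_derive s N x s01)
    (is_derive_scale nu^-1 (is_deriveM (dqP x xpi) (is_derive_cos_lin nu x))))).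
  rewrite (_ : 1 + _ = sin (nu * x) / sin (x / 2)); last first.
    by rewrite /nu -dirichlet_kernel mulrC mulKf// gt_eqF.
  rewrite /GRing.scale /= /q; field.
  by rewrite !gt_eqF.
(* [q] is singular in form at 0, so the estimate runs on [[e, pi]]. On [[0, e]] a Lipschitz bound,
   depending on [N] but multiplied by [e], suffices, and [e] is made small last. *)
have near0 e : 0 < e <= pi ->
    `|gap s N pi| <= (64 * pi + 8 * pi) / nu + e * (2 * (1 + \sum_(k < N) 2)).
  move=> epi; have /andP[e0 ep] := epi.
  have hU : `|U pi - U e| <= 64 / nu * (pi - e).
    apply: (@norm_increment_le R U (fun x => nu^-1 * (dq x * cos (nu * x)))
      (64 / nu) e pi ep) => x /andP[ex xp].
      by apply: UP; rewrite xp (lt_le_trans e0).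
    rewrite normrM gtr0_norm ?invr_gt0// mulrC ler_pM2r ?invr_gt0// normrM.
    rewrite -[leRHS]mulr1 ler_pM ?cos_max//.
    by rewrite dqle// xp (lt_le_trans e0).
  have hg : `|gap s N e| <= e * (2 * (1 + \sum_(k < N) 2)).
    have g0 : gap s N 0 = 0.
      rewrite /gap !mulr0 sin0 mulr0 add0r subr0 big1// => k _.
      by rewrite !mulr0 sin0 !mulr0 addr0 subr0.
    have -> : gap s N e = gap s N e - gap s N 0 by rewrite g0 subr0.
    rewrite -[e in leRHS]subr0 [leRHS]mulrC.
    pose dgap x := (cos (s * x) - 1) * (1 + \sum_(k < N) 2 * cos (k.+1%:R * x)).
    apply: (@norm_increment_le R (gap s N) dgap _ 0 e (ltW e0)).
      by move=> x _; exact: gap_derive.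
    move=> x _; rewrite /dgap normrM ler_pM//.
      by apply: le_trans (ler_normB _ _) _; rewrite normr1; have := cos_max (s * x); lra.
    apply: le_trans (ler_normD _ _) _; rewrite normr1 lerD2l.
    apply: le_trans (ler_norm_sum _ _ _) _; apply: ler_sum => k _.
    by rewrite normrM normr_nat ler_piMr// cos_max.
  have hq x : 0 < x <= pi -> `|nu^-1 * (q x * cos (nu * x))| <= 4 * pi / nu.
    move=> xpi; rewrite normrM gtr0_norm ?invr_gt0// mulrC ler_pM2r ?invr_gt0//.
    by rewrite normrM -[leRHS]mulr1 ler_pM ?cos_max ?qle.
  have h1 := hq e epi; have h2 := hq pi; rewrite pi0 lexx in h2.
  have {}h2 := h2 isT.
  have : gap s N pi = (U pi - U e) + gap s N e + nu^-1 * (q e * cos (nu * e))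
     - nu^-1 * (q pi * cos (nu * pi)) by rewrite /U; ring.
  move=> ->; apply: le_trans (ler_normB _ _) _.
  apply: le_trans (lerD (ler_normD _ _) (lexx _)) _.
  apply: le_trans (lerD (lerD (ler_normD _ _) (lexx _)) (lexx _)) _.
  have : 64 / nu * (pi - e) <= 64 / nu * pi.
    by rewrite ler_pM2l ?divr_gt0//; lra.
  lra.
rewrite -gappi; apply/ler_addgt0Pr => e e0.
set C : R := 2 * (1 + \sum_(k < N) 2) in near0.
have C0 : 0 < C by rewrite mulr_gt0// ltr_pwDl// sumr_ge0.
have := near0 (Num.min pi (e / C)).
rewrite lt_min pi0 divr_gt0// ge_min lexx /= => /(_ isT) h.
apply: le_trans h _; rewrite lerD2l -ler_pdivlMr//.
by rewrite ge_min lexx orbT.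
Qed.

End Cosecant.

(** * The integral of [u ^ (s - 1) / (1 + u)] *)

Section Logistic.
Variable R : realType.
Implicit Types (s v w : R) (N : nat).

(** The form [u^(s - 1) du / (1 + u)] in the variable [u = e^v]: for [0 < s < 1] both singular ends
    become exponential decay. *)
Definition logistic s v : R := expR (s * v) / (1 + expR v).

Let den_gt0 v : 0 < 1 + expR v.
Proof. by rewrite addr_gt0// expR_gt0. Qed.

Lemma logistic_ge0 s v : 0 <= logistic s v.
Proof. by rewrite divr_ge0 ?expR_ge0// ltW. Qed.

Lemma logistic_le s v : logistic s v <= expR (s * v).
Proof.
by rewrite ler_pdivrMr// ler_peMr ?expR_ge0// lerDl expR_ge0.
Qed.

(** The symmetry between [s] and [1 - s] exchanges the half-lines, so that only [v <= 0] has to be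
    expanded. *)
Lemma logisticN s v : logistic s (- v) = logistic (1 - s) v.
Proof.
rewrite /logistic (_ : (1 - s) * v = v + s * - v); last by ring.
rewrite expRD expRN; have E0 := expR_gt0 v; field.
by apply/andP; split; rewrite gt_eqF// addr_gt0.
Qed.

Lemma continuous_logistic s : continuous (logistic s).
Proof.
move=> v; apply: cvgM.
  apply: (@continuous_comp _ _ _ (fun v => s * v) expR); last exact: continuous_expR.
  by apply: cvgMl_tmp; exact: cvg_id.
apply: cvgV; first by rewrite gt_eqF.
by apply: cvgD; [exact: cvg_cst|exact: continuous_expR].
Qed.

(** Lets [v] tend to [-oo] inside an inequality. The minimum with 1 in the proof keeps the chosen
    [v] nonpositive. *)
Lemma expR_small w (C x y : R) : 0 < w ->
  (forall v, v <= 0 -> x <= y + C * expR (w * v)) -> x <= y.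
Proof.
move=> w0 h; apply/ler_addgt0Pr => e e0.
have C1 : 0 < `|C| + 1 by rewrite ltr_wpDl.
have d0 : 0 < Num.min 1 (e / (`|C| + 1)) by rewrite lt_min ltr01 divr_gt0.
have := h (w^-1 * ln (Num.min 1 (e / (`|C| + 1)))).
rewrite mulVKf ?gt_eqF// lnK ?posrE// => h1; apply: le_trans (h1 _) _.
  by rewrite pmulr_rle0 ?invr_gt0// ln_le0// ge_min lexx.
rewrite lerD2l; apply: le_trans (ler_norm _) _.
rewrite normrM [`|Num.min _ _|]gtr0_norm//.
apply: (@le_trans _ _ ((`|C| + 1) * (e / (`|C| + 1)))).
  by apply: ler_pM => //; [exact: ltW|rewrite lerDl|rewrite ge_min lexx orbT].
by rewrite mulrCA mulfV ?mulr1// gt_eqF.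
Qed.

Let expsum s N v := \sum_(k < N) (-1) ^+ k * ((s + k%:R)^-1 * expR ((s + k%:R) * v)).

(* Expand [1 / (1 + e^v)] into a geometric series on [v <= 0]. *)
Lemma logistic_half s (G : R -> R) (m : R) N : 0 < s ->
  (forall v, is_derive v 1 G (logistic s v)) ->
  (forall v, 0 <= G v - m <= expR (s * v) / s) ->
  `|G 0 - m - \sum_(k < N) (-1) ^+ k / (s + k%:R)| <= (s + N%:R)^-1.
Proof.
move=> s0 dG Gm.
have sk k : 0 < s + k%:R by rewrite ltr_wpDr.
(* The derivative of [expsum] misses [logistic] by the remainder of the geometric series, at most
   [e^((s + N) v)]. *)
have dT v : is_derive v 1 (expsum s N)
    (logistic s v - (-1) ^+ N * expR ((s + N%:R) * v) / (1 + expR v)).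
  have hk k : is_derive v 1 (fun v => (-1) ^+ k * ((s + k%:R)^-1 * expR ((s + k%:R) * v)))
      ((-1) ^+ k * expR ((s + k%:R) * v)).
    have := is_derive_scale (s + k%:R)^-1 (is_derive_expR_lin (s + k%:R) v).
    by rewrite mulrA mulVf ?mul1r ?gt_eqF// => /(is_derive_scale ((-1) ^+ k)).
  have e : \sum_(k < N) (-1) ^+ k * expR ((s + k%:R) * v)
      = logistic s v - (-1) ^+ N * expR ((s + N%:R) * v) / (1 + expR v).
    elim: (N) => [|n IHn]; first by rewrite big_ord0 addr0 mul1r subrr.
    rewrite big_ord_recr /= {}IHn (_ : (s + n.+1%:R) * v = (s + n%:R) * v + v).
      by rewrite expRD exprS; field; rewrite gt_eqF.
    by rewrite -natr1; ring.
  apply: is_derive_eq e.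
  exact: (@is_derive_bigsum R N (fun k v => (-1) ^+ k * ((s + k%:R)^-1 * expR ((s + k%:R) * v)))
    (fun k v => (-1) ^+ k * expR ((s + k%:R) * v))).
have T0 : expsum s N 0 = \sum_(k < N) (-1) ^+ k / (s + k%:R).
  by apply: eq_bigr => k _; rewrite mulr0 expR0 mulr1.
(* By hypothesis [m] is the limit of [G] at [-oo]; both [G v - m] and [expsum s N v] are of order
   [e^(s v)] and disappear. *)
apply: (@expR_small s (s^-1 + \sum_(k < N) (s + k%:R)^-1)) => // v v0.
have h1 : `|(G - expsum s N) 0 - (G - expsum s N) v| <= (s + N%:R)^-1.
  have dE (x : R) : is_derive x 1 (fun v => (s + N%:R)^-1 * expR ((s + N%:R) * v))
      (expR ((s + N%:R) * x)).
    have := is_derive_scale (s + N%:R)^-1 (is_derive_expR_lin (s + N%:R) x).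
    by rewrite mulrA mulVf ?mul1r ?gt_eqF.
  have dD (x : R) : is_derive x 1 (G - expsum s N) (logistic s x -
      (logistic s x - (-1) ^+ N * expR ((s + N%:R) * x) / (1 + expR x))).
    exact: is_deriveB.
  apply: le_trans (norm_increment v0 (fun x _ => dD x) (fun x _ => dE x) _) _.
  - move=> x _; rewrite opprB addrC subrK -mulrA normrM normrX normrN1 expr1n mul1r.
    rewrite ger0_norm; last by rewrite divr_ge0 ?expR_ge0// ltW.
    by rewrite ler_pdivrMr// ler_peMr ?expR_ge0// lerDl expR_ge0.
  - by rewrite mulr0 expR0 mulr1 gerBl mulr_ge0 ?expR_ge0// invr_ge0 ltW.
have h2 : `|expsum s N v| <= (\sum_(k < N) (s + k%:R)^-1) * expR (s * v).
  apply: le_trans (ler_norm_sum _ _ _) _; rewrite mulr_suml; apply: ler_sum => k _.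
  rewrite normrM normrX normrN1 expr1n mul1r ger0_norm; last first.
    by rewrite mulr_ge0 ?expR_ge0// invr_ge0 ltW.
  rewrite ler_pM2l ?invr_gt0// ler_expR mulrDl gerDl.
  by rewrite mulr_ge0_le0.
have /andP[h3 h4] := Gm v.
rewrite -T0 mulrDl (mulrC s^-1).
move: h1 h2; rewrite !fctE => h1 h2.
have -> : G 0 - m - expsum s N 0 = G 0 - expsum s N 0 - (G v - expsum s N v)
   + (G v - m) - expsum s N v by ring.
apply: le_trans (ler_normB _ _) _.
apply: le_trans (lerD (ler_normD _ _) (lexx _)) _.
by rewrite (ger0_norm h3); lra.
Qed.

(** The primitive vanishing at [-oo], whose limit at [+oo] is the integral. Exponential rates at
    both ends are recorded because the ends are later evaluated at finite arguments. *)
Lemma logistic_primitive s : 0 < s < 1 -> exists Th : R -> R,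
  [/\ forall v, is_derive v 1 Th (logistic s v),
      forall v, 0 <= Th v <= expR (s * v) / s
    & forall v, 0 <= pi / sin (pi * s) - Th v <= expR (- ((1 - s) * v)) / (1 - s)].
Proof.
move=> /[dup] s01 /andP[s0 s1]; have t0 : 0 < 1 - s by lra.
have [G dG] := continuous_antiderivative (@continuous_logistic s).
have Gnd u v : u <= v -> G u <= G v.
  move=> uv; have d0 (x : R) : is_derive x 1 (cst (0 : R)) 0 by exact: is_derive_cst.
  have := ler_increment uv (fun x _ => d0 x) (fun x _ => dG x)
    (fun x _ => logistic_ge0 s x).
  by rewrite subrr subr_ge0.
have Gle u v : u <= v -> G v - G u <= expR (s * v) / s.
  move=> uv.
  have dE (x : R) : is_derive x 1 (fun v => s^-1 * expR (s * v)) (expR (s * x)).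
    have := is_derive_scale s^-1 (is_derive_expR_lin s x).
    by rewrite mulrA mulVf ?mul1r ?gt_eqF.
  apply: le_trans (ler_increment uv (fun x _ => dG x) (fun x _ => dE x) _) _.
    by move=> x _; exact: logistic_le.
  by rewrite mulrC gerBl mulr_ge0 ?expR_ge0// invr_ge0 ltW.
have Gle' u v : u <= v -> G v - G u <= expR (- ((1 - s) * u)) / (1 - s).
  move=> uv.
  have dE (x : R) : is_derive x 1 (fun v => - (1 - s)^-1 * expR (- (1 - s) * v))
      (expR (- (1 - s) * x)).
    have := is_derive_scale (- (1 - s)^-1) (is_derive_expR_lin (- (1 - s)) x).
    by rewrite mulrA mulrNN mulVf ?mul1r ?gt_eqF.
  apply: le_trans (ler_increment uv (fun x _ => dG x) (fun x _ => dE x) _) _.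
    move=> x _; have := logistic_le (1 - s) (- x).
    by rewrite logisticN mulrN -mulNr subKr.
  by rewrite !mulNr opprK addrC mulrC gerBl mulr_ge0 ?expR_ge0// invr_ge0 ltW.
pose S := range G.
have bnd v : lbound S (G v - expR (s * v) / s).
  move=> _ [u _ <-]; have [uv|/ltW vu] := leP u v; first by have := Gle u v uv; lra.
  have := Gnd v u vu; have : 0 <= expR (s * v) / s.
    by rewrite divr_ge0 ?expR_ge0// ltW.
  lra.
have bnd' v : ubound S (G v + expR (- ((1 - s) * v)) / (1 - s)).
  move=> _ [u _ <-]; have [uv|/ltW vu] := leP v u; first by have := Gle' v u uv; lra.
  have := Gnd u v vu; have : 0 <= expR (- ((1 - s) * v)) / (1 - s).
    by rewrite divr_ge0 ?expR_ge0// ltW.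
  lra.
have S0 : S !=set0 by exists (G 0), 0.
(* As [G] is nondecreasing, these are its limits at the two ends. *)
pose m := inf S; pose M := sup S.
have mP v : 0 <= G v - m <= expR (s * v) / s.
  have h1 : m <= G v by apply: ge_inf; [exists (G 0 - expR (s * 0) / s)|exists v].
  have h2 : G v - expR (s * v) / s <= m by apply: lb_le_inf.
  by apply/andP; split; lra.
have MP v : 0 <= M - G v <= expR (- ((1 - s) * v)) / (1 - s).
  have h1 : G v <= M.
    by apply: ub_le_sup; [exists (G 0 + expR (- ((1 - s) * 0)) / (1 - s))|exists v].
  have h2 : M <= G v + expR (- ((1 - s) * v)) / (1 - s) by apply: ge_sup.
  by apply/andP; split; lra.
have ps0 : 0 < sin (pi * s).
  have pi0 := @pi_gt0 R.
  by rewrite sin_gt0_pi// mulr_gt0//= gtr_pMr.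
(* Cut at 0. The half-lines give alternating sums for [s] and [1 - s]; taking [N + 1] terms of the
   first and [N] of the second reproduces [csc_sum s N] exactly. *)
have L : M - m = pi / sin (pi * s).
  pose G' v := - G (- v).
  have dG' v : is_derive v 1 G' (logistic (1 - s) v).
    have hN : is_derive v 1 (fun v => -1 * v) (-1 * 1).
      exact: is_derive_scale.
    have -> : G' = - (G \o (fun v => -1 * v)).
      by apply/funext => y; rewrite !fctE /G' /= mulN1r.
    have d1 : is_derive (-1 * v) 1 G (logistic s (-1 * v)) by exact: dG.
    apply: (@is_derive_eq _ _ _ _ _ _ _ _ (is_deriveN (is_derive1_comp d1 hN))).
    by rewrite mulN1r mulr1 logisticN mulrN1 opprK.
  have G'm v : 0 <= G' v - (- M) <= expR ((1 - s) * v) / (1 - s).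
    by have := MP (- v); rewrite mulrN opprK /G' opprK addrC.
  pose C := 72 * pi + (1 + (1 - s)^-1).
  have key N : `|sin (pi * s) * (M - m) - pi|
      <= C / (N%:R + 2^-1).
    have h1 := logistic_half N.+1 s0 dG mP.
    have h2 := logistic_half N t0 dG' G'm.
    have h3 := csc_sum_bound N s01.
    set x1 := \sum_(k < N.+1) _ in h1; set x2 := \sum_(k < N) _ in h2.
    have csc : csc_sum s N = x1 + x2.
      rewrite /csc_sum /x1 /x2 big_ord_recl /= expr0 mul1r addr0 -addrA.
      congr (_ + _); rewrite -big_split /=; apply: eq_bigr => k _.
      rewrite /bump /= add1n.
      have k1 : 1 <= k.+1%:R :> R by rewrite ler1n.
      rewrite (addrC s) (_ : 1 - s + k%:R = k.+1%:R - s); last by rewrite -natr1; ring.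
      by rewrite exprS; ring.
    rewrite csc in h3.
    have nu0 : 0 < N%:R + 2^-1 :> R by rewrite ltr_wpDl.
    have h4 : `|(M - m) - (x1 + x2)| <= (1 + (1 - s)^-1) / (N%:R + 2^-1).
      have -> : M - m - (x1 + x2) = (G 0 - m - x1) + (G' 0 - - M - x2).
        by rewrite /G' oppr0; ring.
      apply: le_trans (ler_normD _ _) _; apply: le_trans (lerD h1 h2) _.
      have a1 : (s + N.+1%:R)^-1 <= (N%:R + 2^-1)^-1 :> R.
        have n0 : 0 <= N%:R :> R by [].
        by rewrite -natr1 lef_pV2 ?posrE; lra.
      have a2 : (1 - s + N%:R)^-1 <= (1 - s)^-1 / (N%:R + 2^-1) :> R.
        have n0 : 0 <= N%:R :> R by [].
        rewrite -invfM lef_pV2 ?posrE ?mulr_gt0//; last by lra.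
        have : 0 <= s * N%:R by rewrite mulr_ge0// ltW.
        by lra.
      by rewrite mulrDl mul1r lerD.
    have -> : sin (pi * s) * (M - m) - pi = sin (pi * s) * (M - m - (x1 + x2))
       + (sin (pi * s) * (x1 + x2) - pi) by ring.
    apply: le_trans (ler_normD _ _) _; apply: le_trans (lerD (lexx _) h3) _.
    have : `|sin (pi * s) * (M - m - (x1 + x2))| <= (1 + (1 - s)^-1) / (N%:R + 2^-1).
      by apply: le_trans h4; rewrite normrM ler_piMl// sin_max.
    rewrite /C; lra.
  suff e0 : sin (pi * s) * (M - m) = pi by apply: (mulfI (lt0r_neq0 ps0)); rewrite e0 [RHS]mulrC divfK ?gt_eqF.
  apply: subr0_eq; apply/normr0_eq0/le_anti; rewrite normr_ge0 andbT.
  apply/ler_addgt0Pr => e e0; rewrite add0r.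
  have [N _ hN] := (cvgryPge _).1 (@cvgr_idn R) (C / e).
  apply: le_trans (key N) _; rewrite ler_pdivrMr ?ltr_wpDl// mulrC -ler_pdivrMr//.
  by have := hN N (leqnn _); rewrite /=; lra.
exists (fun v => G v - m); split => [v|//|v].
- by rewrite -[logistic s v]subr0; apply: is_deriveB.
- by rewrite -L opprB addrA subrK; exact: MP.
Qed.

End Logistic.

(** * Power sums and terms on the imaginary axis *)

Section PowerBounds.
Variable R : realType.
Implicit Types (p q x k : R).

Lemma powR_expR p x : 0 < x -> x `^ p = expR (p * ln x).
Proof. by move=> x0; rewrite /powR gt_eqF. Qed.

Lemma powR_double q x k : 1 <= k -> k <= x <= k + 1 -> x `^ q <= 2 `^ `|q| * k `^ q.
Proof.
move=> k1 /andP[kx xk]; have k0 : 0 < k by lra.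
have [q0|/ltW q0] := leP 0 q.
  rewrite ger0_norm// -powRM//; last exact: ltW.
  by rewrite ge0_ler_powR ?nnegrE//; lra.
apply: (@le_trans _ _ (k `^ q)).
  rewrite !powR_expR//; last by lra.
  by rewrite ler_expR ler_wnM2l// ler_ln ?posrE//; lra.
by rewrite ler_peMl ?powR_ge0// -[leLHS](powRr0 2) ler_powR// ler1n.
Qed.

Lemma powR_lipschitz p x k : 1 <= k -> k <= x <= k + 1 ->
  `|x `^ p - k `^ p| <= `|p| * 2 `^ `|p - 1| * k `^ (p - 1).
Proof.
move=> k1 /andP[kx xk]; have [|y /andP[ky yx] ->] :=
    @MVT_closed R (fun y => y `^ p) (fun y => p * y `^ (p - 1)) k x kx.
  by move=> y /andP[ky _]; apply: is_derive1_powR; lra.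
have y2 : `|y `^ (p - 1)| <= 2 `^ `|p - 1| * k `^ (p - 1).
  by rewrite ger0_norm ?powR_ge0// powR_double// ky (le_trans yx).
rewrite !normrM -mulrA -mulrA ler_wpM2l// -[leRHS]mulr1 ler_pM//.
by rewrite ger0_norm; lra.
Qed.

(** Telescoping: by the mean value theorem and [k + 1 <= 2 k], each term is at most [C] times the
    decrement of [k^(- p)]. *)
Lemma rsum_powR p : 0 < p -> exists Z, rsum (fun k : nat => k%:R `^ (- p - 1) : R) Z.
Proof.
move=> p0; pose C := 2 `^ `|- p - 1| / p.
have C0 : 0 < C by rewrite divr_gt0// powR_gt0.
apply: (@rsum_bounded _ _ C) => [k _|N]; first exact: powR_ge0.
have h (k : nat) : (1 <= k)%N ->
    k%:R `^ (- p - 1) <= C * (k%:R `^ (- p) - k.+1%:R `^ (- p)) :> R.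
  move=> k1; have k1R : 1 <= k%:R :> R by rewrite ler1n.
  have kk : k%:R <= k.+1%:R :> R by rewrite ler_nat.
  have [|y /andP[ky yk] e] :=
    @MVT_closed R (fun y => y `^ (- p)) (fun y => - p * y `^ (- p - 1)) _ _ kk.
    by move=> y /andP[ky _]; apply: is_derive1_powR; lra.
  have -> : k%:R `^ (- p) - k.+1%:R `^ (- p) = p * y `^ (- p - 1).
    by rewrite -[LHS]opprB e -natr1; ring.
  rewrite /C mulrA divfK ?gt_eqF//.
  have y0 : 0 < y by lra.
  have k0 : 0 < k%:R :> R by lra.
  rewrite !powR_expR// -expRD ler_expR.
  have l2 : ln y <= ln 2 + ln k%:R.
    rewrite -lnM ?posrE// ler_ln ?posrE//; last by rewrite mulr_gt0.
    by move: yk; rewrite -natr1; lra.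
  rewrite (_ : `|- p - 1| = p + 1); last by rewrite -opprD normrN gtr0_norm//; lra.
  have : (p + 1) * ln y <= (p + 1) * (ln 2 + ln k%:R) by rewrite ler_pM2l//; lra.
  lra.
have [N1|N1] := leqP N 1; first by rewrite big_geq// ltW.
apply: (@le_trans _ _ (\sum_(1 <= k < N) (C * (k%:R `^ (- p) - k.+1%:R `^ (- p))))).
  by apply: ler_sum_nat => k /andP[k1 _]; exact: h.
rewrite -mulr_sumr -[leRHS]mulr1 ler_pM2l//.
rewrite (eq_bigr (fun k : nat => - (k.+1%:R `^ (- p) - k%:R `^ (- p)))); last first.
  by move=> k _; rewrite opprB.
rewrite sumrN telescope_sumr; last exact: ltnW.
by rewrite opprB powR1 gerBl powR_ge0.
Qed.

End PowerBounds.

Section ImaginaryAxis.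
Variable R : realType.
Implicit Types (a g t : R).

Lemma inv_imag a g : 0 < a ->
  (0 +i* a + g%:C)^-1 = (g / (g ^+ 2 + a ^+ 2)) +i* (- (a / (g ^+ 2 + a ^+ 2))).
Proof.
move=> a0; have n0 : g ^+ 2 + a ^+ 2 != 0.
  by rewrite gt_eqF// ltr_wpDl ?sqr_ge0// exprn_gt0.
apply: (@mulfI _ (0 +i* a + g%:C)).
  by rewrite eq_complex /= addr0 (gt_eqF a0) andbF.
rewrite mulfV; last by rewrite eq_complex /= addr0 (gt_eqF a0) andbF.
apply/eqP; rewrite eq_complex Re_mul Im_mul /=; apply/andP; split; apply/eqP.
  by field.
by field.
Qed.

Lemma Re_imag_term t a g : 0 < a ->
  complex.Re (t%:C / (0 +i* a + g%:C)) = t * g / (g ^+ 2 + a ^+ 2).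
Proof. by move=> a0; rewrite inv_imag// Re_mul /= mul0r subr0 mulrA. Qed.

Lemma Im_imag_term t a g : 0 < a ->
  complex.Im (t%:C / (0 +i* a + g%:C)) = - (t * a / (g ^+ 2 + a ^+ 2)).
Proof. by move=> a0; rewrite inv_imag// Im_mul /= mul0r addr0 mulrN mulrA. Qed.

Lemma normc_imag_ge a g : 0 < a -> a <= normc (0 +i* a + g%:C).
Proof.
move=> a0; apply: le_trans (normc_ge_Im _).
by rewrite Im_add /= addr0 ler_norm.
Qed.

Lemma normc_imag_ge_real a g : g <= normc (0 +i* a + g%:C).
Proof.
apply: le_trans (normc_ge_Re _); by rewrite Re_add /= add0r ler_norm.
Qed.

(** One of the two denominators is estimated by [g] and the other by [a], so a relative error in [g]
    costs only [1 / a]. *)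
Lemma imag_term_diff t t' a g g' : 0 < a -> 0 < g ->
  normc (t%:C / (0 +i* a + g%:C) - t'%:C / (0 +i* a + g'%:C))
  <= `|t - t'| / a + `|t'| * `|g - g'| / (g * a).
Proof.
move=> a0 g0.
have h1 := normc_imag_ge g a0; have h2 := normc_imag_ge g' a0.
have h3 := normc_imag_ge_real a g.
have n1 : 0 +i* a + g%:C != 0 by rewrite -normc_gt0 (lt_le_trans a0).
have n2 : 0 +i* a + g'%:C != 0 by rewrite -normc_gt0 (lt_le_trans a0).
have -> : t%:C / (0 +i* a + g%:C) - t'%:C / (0 +i* a + g'%:C) =
    (t - t')%:C / (0 +i* a + g%:C) +
    - (t' * (g - g'))%:C / ((0 +i* a + g%:C) * (0 +i* a + g'%:C)).
  rewrite rmorphM !rmorphB /=; field.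
  by rewrite n1 n2.
apply: le_trans (ler_normcD _ _) _; rewrite !normc_div normcN !normc_real normcM.
apply: lerD.
  by rewrite ler_wpM2l// lef_pV2 ?posrE// (lt_le_trans a0).
rewrite normrM ler_wpM2l ?mulr_ge0// lef_pV2 ?posrE ?mulr_gt0//.
- by apply: ler_pM => //; exact: ltW.
- exact: lt_le_trans h1.
- exact: lt_le_trans h2.
Qed.

End ImaginaryAxis.

(** * Asymptotics on the imaginary axis *)

Section ImaginaryAsymptotics.
Variable R : realType.
Variables (c gamma : nat -> R) (A B alpha beta r C1 C2 delta : R).
Hypothesis A0 : 0 < A.
Hypothesis B0 : 0 < B.
Hypothesis alpha0 : 0 < alpha.
Hypothesis beta0 : 0 < beta.
Hypothesis r_def : r = (alpha + beta - 1) / beta.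
Hypothesis delta0 : 0 < delta.
Hypothesis c_near : forall k : nat, (1 <= k)%N ->
  `|c k - A * k%:R `^ (- alpha)| <= C1 * k%:R `^ (- alpha - 1).
Hypothesis gamma_near : forall k : nat, (1 <= k)%N ->
  `|gamma k - B * k%:R `^ beta| <= C2 * k%:R `^ (beta - 1).
Hypothesis gamma_low : forall k : nat, (1 <= k)%N ->
  delta * k%:R `^ beta <= gamma k.
Implicit Types (a x v L : R) (k n : nat) (Th : R -> R) (K : R[i]).

Let iterm a k : R[i] := (c k)%:C / (0 +i* a + (gamma k)%:C).

(** Replacing [c k] and [gamma k] by powers, and [k] by any nearby [x], costs a relative [1 / k].
    With [1 / a] set apart, the remaining [k^(- alpha - 1)] is summable. *)
Lemma iterm_near : exists C, forall a k x, 0 < a -> (1 <= k)%N ->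
  k%:R <= x <= k%:R + 1 ->
  normc (iterm a k - (A * x `^ (- alpha))%:C / (0 +i* a + (B * x `^ beta)%:C))
  <= C / a * k%:R `^ (- alpha - 1).
Proof.
pose La := `|- alpha| * 2 `^ `|- alpha - 1|.
pose Lb := `|beta| * 2 `^ `|beta - 1|.
pose D1 := C1 + A * La; pose D2 := C2 + B * Lb.
exists (D1 + A * 2 `^ `|- alpha| * D2 / delta) => a k x a0 k1 kx.
have k1R : 1 <= k%:R :> R by rewrite ler1n.
have k0 : 0 < k%:R :> R by rewrite (lt_le_trans ltr01).
have pk (p : R) : 0 < k%:R `^ p by rewrite powR_gt0.
have g0 : 0 < gamma k by apply: lt_le_trans (gamma_low k1); rewrite mulr_gt0.
have h1 : `|c k - A * x `^ (- alpha)| <= D1 * k%:R `^ (- alpha - 1).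
  have -> : c k - A * x `^ (- alpha) = (c k - A * k%:R `^ (- alpha))
     - A * (x `^ (- alpha) - k%:R `^ (- alpha)) by ring.
  apply: le_trans (ler_normB _ _) _; rewrite mulrDl lerD ?c_near//.
  by rewrite normrM gtr0_norm// -mulrA ler_pM2l// powR_lipschitz.
have h2 : `|gamma k - B * x `^ beta| <= D2 * k%:R `^ (beta - 1).
  have -> : gamma k - B * x `^ beta = (gamma k - B * k%:R `^ beta)
     - B * (x `^ beta - k%:R `^ beta) by ring.
  apply: le_trans (ler_normB _ _) _; rewrite mulrDl lerD ?gamma_near//.
  by rewrite normrM gtr0_norm// -mulrA ler_pM2l// powR_lipschitz.
have h3 : `|A * x `^ (- alpha)| <= A * 2 `^ `|- alpha| * k%:R `^ (- alpha).
  rewrite ger0_norm ?mulr_ge0 ?powR_ge0 ?(ltW A0)//.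
  by rewrite -mulrA ler_pM2l// powR_double.
apply: le_trans (imag_term_diff _ _ _ a0 g0) _.
rewrite mulrDl [leRHS]mulrDl; apply: lerD.
  by rewrite [leRHS]mulrAC ler_pM2r ?invr_gt0.
apply: (@le_trans _ _ ((A * 2 `^ `|- alpha| * k%:R `^ (- alpha)) *
   (D2 * k%:R `^ (beta - 1)) / (delta * k%:R `^ beta * a))).
  have i0 : 0 <= (gamma k * a)^-1 by rewrite invr_ge0 mulr_ge0// ltW.
  apply: (ler_pM (mulr_ge0 (normr_ge0 _) (normr_ge0 _)) i0); first exact: ler_pM.
  by rewrite lef_pV2 ?posrE ?mulr_gt0// ler_pM2r// gamma_low.
have -> : k%:R `^ (- alpha - 1) = k%:R `^ (- alpha) * k%:R `^ (beta - 1) / k%:R `^ beta :> R.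
  rewrite -powRN -!powRD; last 2 first.
  - by rewrite (gt_eqF k0) implybT.
  - by rewrite (gt_eqF k0) implybT.
  by congr (_ `^ _); ring.
rewrite le_eqVlt; apply/orP; left; apply/eqP; field.
by rewrite !gt_eqF.
Qed.

(* By the mean value theorem [F (k + 1) - F k] is a value of [f] on [[k, k + 1]],
   so that no monotonicity of [f] is needed. *)
Lemma rsum_primitive u F f D Z l s :
  (forall x, 1 <= x -> is_derive x 1 F (f x)) ->
  (forall k x, (1 <= k)%N -> k%:R <= x <= k%:R + 1 ->
     `|u k - f x| <= D * k%:R `^ (- alpha - 1)) ->
  rsum u s -> rsum (fun k => k%:R `^ (- alpha - 1)) Z ->
  (fun n => F n%:R) @ \oo --> l -> `|s - (l - F 1)| <= D * Z.
Proof.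
move=> dF uf us hZ Fl.
have ht : rsum (fun k => F k.+1%:R - F k%:R) (l - F 1).
  rewrite /rsum; have : (fun n => F n%:R - F 1) @ \oo --> l - F 1.
    by apply: cvgB => //; exact: cvg_cst.
  apply: cvg_trans; apply: near_eq_cvg; near=> n.
  have n1 : (1 <= n)%N by near: n; exact: nbhs_infty_ge.
  by rewrite (telescope_sumr (fun k => F k%:R)).
apply: (rsum_norm_le _ (rsumB us ht) (rsumZ D hZ)) => k k1.
have kk : k%:R <= k.+1%:R :> R by rewrite ler_nat.
have k1R : 1 <= k%:R :> R by rewrite ler1n.
have [|x kx ->] := @MVT_closed R F f k%:R k.+1%:R kk.
  by move=> x /andP[kx _]; apply: dF; lra.
rewrite -natr1 addrAC subrr add0r mulr1; apply: uf => //.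
by rewrite natr1.
Unshelve. all: by end_near. Qed.

(** The Jacobian factor [A / beta * B^(r - 1) * a^(- r)], obtained from
    [1 - r = (1 - alpha) / beta]; the [1 / 2] compensates for evaluating the primitive at [2 v]. *)
Definition prim_scale a := A / beta * B `^ (r - 1) * a `^ (- r) / 2.

(* The substitution [B x^beta / a = e^v] turns the primitives of the real and
   imaginary parts of [A x^(- alpha) / (i a + B x^beta)] into primitives of
   [logistic], taken at [2 v]. *)
Definition prim Th a x := prim_scale a * Th (2 * (beta * ln x + ln (B / a))).

Lemma prim_derive Th h a x : 0 < x ->
  (forall v, is_derive v 1 Th (h v)) ->
  is_derive x 1 (prim Th a)
    (prim_scale a * (h (2 * (beta * ln x + ln (B / a))) * (2 * (beta / x)))).
Proof.
move=> x0 dTh; apply: is_derive_scale.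
have dl : is_derive x 1 (fun x => 2 * (beta * ln x + ln (B / a))) (2 * (beta / x)).
  apply: is_derive_scale.
  have := is_deriveD (is_derive_scale beta (is_derive1_ln x0))
     (is_derive_cst (ln (B / a)) x (1 : R)).
  by rewrite addr0.
exact: (@is_derive1_comp R Th (fun x => 2 * (beta * ln x + ln (B / a))) x _ _
  (dTh _) dl).
Qed.

Let lnE a x : 0 < a -> 0 < x ->
  expR (beta * ln x + ln (B / a)) = B * x `^ beta / a.
Proof.
move=> a0 x0; rewrite expRD lnK ?posrE ?divr_gt0// powR_expR//; ring.
Qed.

Let prim_scaleE a x : 0 < a -> 0 < x ->
  prim_scale a * expR ((1 - r) * (beta * ln x + ln (B / a))) * (2 * (beta / x))
  = A * x `^ (- alpha) / a.
Proof.
move=> a0 x0.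
have e1 : B `^ (r - 1) * a `^ (- r) * expR ((1 - r) * (beta * ln x + ln (B / a)))
    = x * x `^ (- alpha) / a.
  rewrite !powR_expR// -[X in X * _ / _](lnK (x := x)) ?posrE//.
  rewrite -[X in _ / X](lnK (x := a)) ?posrE// -expRN -!expRD.
  congr expR; rewrite ln_div ?posrE// r_def; field.
  by rewrite gt_eqF.
rewrite (_ : prim_scale a * _ * _ = (A / x) * (B `^ (r - 1) * a `^ (- r) *
   expR ((1 - r) * (beta * ln x + ln (B / a))))); last first.
  by rewrite /prim_scale; field; rewrite !gt_eqF.
by rewrite e1; field; rewrite !gt_eqF.
Qed.

(** The numerator is [e^((2 - r) v)], against [e^((1 - r) v)] for the imaginary part; this fixes the
    parameters [1 - r / 2] and [(1 - r) / 2]. *)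
Lemma prim_derive_re Th a x : 0 < a -> 0 < x ->
  (forall v, is_derive v 1 Th (logistic (1 - r / 2) v)) ->
  is_derive x 1 (prim Th a) (A * x `^ (- alpha) * (B * x `^ beta)
    / ((B * x `^ beta) ^+ 2 + a ^+ 2)).
Proof.
move=> a0 x0 dTh; apply: (@is_derive_eq _ _ _ _ _ _ _ _ (prim_derive a x0 dTh)).
have := prim_scaleE a0 x0; have := lnE a0 x0.
set v := beta * ln x + ln (B / a) => e1 e2.
have -> : logistic (1 - r / 2) (2 * v) = expR ((1 - r) * v) * expR v / (1 + expR v ^+ 2).
  rewrite /logistic -expRD -expRM_natl; congr (expR _ / _).
  by field.
have g0 : 0 < B * x `^ beta by rewrite mulr_gt0// powR_gt0.
rewrite (_ : _ * _ = (prim_scale a * expR ((1 - r) * v) * (2 * (beta / x)))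
  * (expR v / (1 + expR v ^+ 2))); last by ring.
rewrite e2 e1; field.
by rewrite !gt_eqF ?addr_gt0 ?exprn_gt0.
Qed.

Lemma prim_derive_im Th a x : 0 < a -> 0 < x ->
  (forall v, is_derive v 1 Th (logistic ((1 - r) / 2) v)) ->
  is_derive x 1 (prim Th a) (A * x `^ (- alpha) * a
    / ((B * x `^ beta) ^+ 2 + a ^+ 2)).
Proof.
move=> a0 x0 dTh; apply: (@is_derive_eq _ _ _ _ _ _ _ _ (prim_derive a x0 dTh)).
have := prim_scaleE a0 x0; have := lnE a0 x0.
set v := beta * ln x + ln (B / a) => e1 e2.
have -> : logistic ((1 - r) / 2) (2 * v) = expR ((1 - r) * v) / (1 + expR v ^+ 2).
  rewrite /logistic -expRM_natl; congr (expR _ / _).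
  by field.
have g0 : 0 < B * x `^ beta by rewrite mulr_gt0// powR_gt0.
rewrite (_ : _ * _ = (prim_scale a * expR ((1 - r) * v) * (2 * (beta / x)))
  / (1 + expR v ^+ 2)); last by ring.
rewrite e2 e1; field.
by rewrite !gt_eqF ?addr_gt0 ?exprn_gt0.
Qed.

Lemma natr_powR_cvg0 (p : R) : 0 < p ->
  (fun n => n%:R `^ (- p) : R) @ \oo --> (0 : R).
Proof.
move=> p0; apply/cvgrPdist_le => e e0; near=> n.
have hn : expR (- ln e / p) <= n%:R.
  by near: n; exact: (cvgryPge _).1 (@cvgr_idn R) _.
have n0 : 0 < n%:R :> R by apply: lt_le_trans hn; exact: expR_gt0.
rewrite sub0r normrN ger0_norm ?powR_ge0// powR_expR//.
rewrite -[leRHS]lnK ?posrE// ler_expR mulNr lerNl.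
by rewrite mulrC -ler_pdivrMr// -ler_expR lnK.
Unshelve. all: by end_near. Qed.

Lemma prim_cvg Th a L D q : 0 < a -> 0 < q ->
  (forall v, `|L - Th v| <= D * expR (- (q * v))) ->
  (fun n => prim Th a n%:R) @ \oo --> prim_scale a * L.
Proof.
move=> a0 q0 hL; apply: cvgMl_tmp; apply/cvgrPdist_le => e e0.
have p0 : 0 < 2 * beta * q by rewrite !mulr_gt0.
pose E := D * expR (- (2 * q * ln (B / a))).
have h : (fun n => E * n%:R `^ (- (2 * beta * q)) : R) @ \oo --> (0 : R).
  by rewrite -(mulr0 E); apply: cvgMl_tmp; exact: natr_powR_cvg0.
near=> n.
have n1 : (1 <= n)%N by near: n; exact: nbhs_infty_ge.
apply: le_trans (hL _) _.
apply: (@le_trans _ _ (E * n%:R `^ (- (2 * beta * q)))).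
  rewrite powR_expR ?ltr0n// /E -mulrA -expRD.
  by rewrite le_eqVlt; apply/orP; left; apply/eqP; congr (_ * expR _); ring.
apply: le_trans (ler_norm _) _; rewrite -normrN -sub0r.
by near: n; move/cvgrPdist_le : h; apply.
Unshelve. all: by end_near. Qed.

(** The comparison starts at [x = 1], that is [v = ln (B / a)], hence the incomplete integral. *)
Lemma Re_iterm_sum Th L D q :
  (forall v, is_derive v 1 Th (logistic (1 - r / 2) v)) ->
  0 < q -> (forall v, `|L - Th v| <= D * expR (- (q * v))) ->
  exists C, forall a K, 0 < a -> csum (iterm a) K ->
   `|complex.Re K - prim_scale a * (L - Th (2 * ln (B / a)))| <= C / a.
Proof.
move=> dTh q0 hL; have [C hC] := iterm_near; have [Z hZ] := rsum_powR alpha0.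
exists (C * Z) => a K a0 [hK _].
have h1 x : 1 <= x -> is_derive x 1 (prim Th a)
    (A * x `^ (- alpha) * (B * x `^ beta) / ((B * x `^ beta) ^+ 2 + a ^+ 2)).
  by move=> x1; apply: prim_derive_re => //; lra.
have h2 k x : (1 <= k)%N -> k%:R <= x <= k%:R + 1 ->
    `|complex.Re (iterm a k) - A * x `^ (- alpha) * (B * x `^ beta)
        / ((B * x `^ beta) ^+ 2 + a ^+ 2)| <= C / a * k%:R `^ (- alpha - 1).
  move=> k1 kx; apply: le_trans (hC a k x a0 k1 kx).
  rewrite -(Re_imag_term _ _ a0) -Re_sub.
  exact: normc_ge_Re.
have := rsum_primitive h1 h2 hK hZ (prim_cvg a0 q0 hL).
by rewrite /prim ln1 mulr0 add0r -mulrBr [C / a * Z]mulrAC.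
Qed.

(** [Th] stays abstract because at [r = 1] the parameter is 0, outside the range of
    [logistic_primitive], and an elementary primitive takes over. *)
Lemma Im_iterm_sum Th L D q :
  (forall v, is_derive v 1 Th (logistic ((1 - r) / 2) v)) ->
  0 < q -> (forall v, `|L - Th v| <= D * expR (- (q * v))) ->
  exists C, forall a K, 0 < a -> csum (iterm a) K ->
   `|complex.Im K + prim_scale a * (L - Th (2 * ln (B / a)))| <= C / a.
Proof.
move=> dTh q0 hL; have [C hC] := iterm_near; have [Z hZ] := rsum_powR alpha0.
exists (C * Z) => a K a0 [_ hK].
have h1 x : 1 <= x -> is_derive x 1 (prim Th a)
    (A * x `^ (- alpha) * a / ((B * x `^ beta) ^+ 2 + a ^+ 2)).
  by move=> x1; apply: prim_derive_im => //; lra.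
have h2 k x : (1 <= k)%N -> k%:R <= x <= k%:R + 1 ->
    `|- complex.Im (iterm a k) - A * x `^ (- alpha) * a
        / ((B * x `^ beta) ^+ 2 + a ^+ 2)| <= C / a * k%:R `^ (- alpha - 1).
  move=> k1 kx; apply: le_trans (hC a k x a0 k1 kx).
  rewrite -normrN opprD opprK -(Im_imag_term _ _ a0) -Im_sub.
  exact: normc_ge_Im.
have := rsum_primitive h1 h2 (rsumN hK) hZ (prim_cvg a0 q0 hL).
by rewrite /prim ln1 mulr0 add0r -mulrBr [C / a * Z]mulrAC -opprD normrN.
Qed.

End ImaginaryAsymptotics.

(** * Main terms of the sum on the imaginary axis *)

Section MainTerms.
Variable R : realType.
Implicit Types (r v a : R).

(** Total masses of the two logistic integrals, carrying the [1 / 2] of [prim_scale]. *)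
Definition L_re r : R := pi / sin (pi * (1 - r / 2)) / 2.
Definition L_im r : R := pi / sin (pi * ((1 - r) / 2)) / 2.

(** With [y = pi r / 2] both sides equal [pi / (4 cos y)], by the double-angle formula; for [D2E]
    the common value is [- pi / (4 sin y)]. *)
Lemma D1E r : 0 < r < 1 -> D1 r = L_im r / 2.
Proof.
move=> /andP[r0 r1]; have pi0 := @pi_gt0 R.
pose y := pi * (r / 2).
have y1 : 0 < y by rewrite mulr_gt0// divr_gt0.
have y2 : y < pi / 2.
  by rewrite /y ltr_pM2l// -subr_gt0; lra.
have s0 : 0 < sin y by rewrite sin_gt0_pihalf// y1.
have c0 : 0 < cos y by rewrite cos_gt0_pihalf// y2 andbT; lra.
rewrite /D1 /L_im.
rewrite (_ : pi / 2 * (r + 1) = y + pi / 2); last by rewrite /y; field.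
rewrite (_ : pi * r = y *+ 2); last by rewrite /y mulr2n; field.
rewrite (_ : pi * ((1 - r) / 2) = - y + pi / 2); last by rewrite /y; field.
rewrite cosDpihalf sinDpihalf cosN sin_mulr2n mulr2n; field.
by rewrite !gt_eqF// addr_gt0// mulr_gt0.
Qed.

Lemma D2E r : 0 < r < 1 -> D2 r = - L_re r / 2.
Proof.
move=> /andP[r0 r1]; have pi0 := @pi_gt0 R.
pose y := pi * (r / 2).
have y1 : 0 < y by rewrite mulr_gt0// divr_gt0.
have y2 : y < pi / 2.
  by rewrite /y ltr_pM2l// -subr_gt0; lra.
have s0 : 0 < sin y by rewrite sin_gt0_pihalf// y1.
have c0 : 0 < cos y by rewrite cos_gt0_pihalf// y2 andbT; lra.
rewrite /D2 /L_re.
rewrite (_ : pi / 2 * (r + 1) = y + pi / 2); last by rewrite /y; field.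
rewrite (_ : pi * r = y *+ 2); last by rewrite /y mulr2n; field.
rewrite (_ : pi * (1 - r / 2) = - y + pi); last by rewrite /y; field.
rewrite sinDpi sinDpihalf sinN opprK sin_mulr2n mulr2n; field.
by rewrite !gt_eqF// addr_gt0// mulr_gt0.
Qed.

(* The case [s = 0] of [logistic], where the primitive is elementary. *)
Let softlog v : R := v - ln (1 + expR v).

Let softlog_derive v : is_derive v 1 softlog (logistic 0 v).
Proof.
have E0 := expR_gt0 v.
have d0 : 0 < 1 + expR v by rewrite addr_gt0.
have d1 : is_derive v 1 (fun v : R => 1 + expR v) (expR v).
  by have := is_deriveD (is_derive_cst (1 : R) (v : R) (1 : R)) (is_derive_expR v);
    rewrite add0r.
have d2 := @is_derive1_comp R (@ln R) (fun v => 1 + expR v) v _ _ (is_derive1_ln d0) d1.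
apply: (@is_derive_eq _ _ _ _ _ _ _ _ (is_deriveB (is_derive_id (v : R) 1) d2)).
by rewrite /logistic mul0r expR0; field; rewrite gt_eqF.
Qed.

Let softlog_bound v : `|0 - softlog v| <= 1 * expR (- (1 * v)).
Proof.
have E0 := expR_gt0 (- v).
have -> : 0 - softlog v = ln (1 + expR (- v)).
  rewrite /softlog sub0r opprB -[X in _ - X]expRK -ln_div ?posrE ?addr_gt0 ?expR_gt0//.
  by rewrite expRN; congr ln; field; rewrite gt_eqF ?expR_gt0.
rewrite !mul1r ger0_norm; first by rewrite le_ln1Dx// (lt_trans _ E0)// ltrN10.
by rewrite ln_ge0// lerDl ltW.
Qed.

Variables (c gamma : nat -> R) (A B alpha beta r C1 C2 delta : R).
Hypothesis A0 : 0 < A.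
Hypothesis B0 : 0 < B.
Hypothesis alpha0 : 0 < alpha.
Hypothesis beta0 : 0 < beta.
Hypothesis r_def : r = (alpha + beta - 1) / beta.
Hypothesis r01 : 0 < r <= 1.
Hypothesis delta0 : 0 < delta.
Hypothesis c_near : forall k : nat, (1 <= k)%N ->
  `|c k - A * k%:R `^ (- alpha)| <= C1 * k%:R `^ (- alpha - 1).
Hypothesis gamma_near : forall k : nat, (1 <= k)%N ->
  `|gamma k - B * k%:R `^ beta| <= C2 * k%:R `^ (beta - 1).
Hypothesis gamma_low : forall k : nat, (1 <= k)%N ->
  delta * k%:R `^ beta <= gamma k.

Definition kappa := A / beta * B `^ (r - 1).

Let kappa0 : 0 < kappa.
Proof. by rewrite mulr_gt0 ?divr_gt0 ?powR_gt0. Qed.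

(** At its lower end [Th] is of order [(B / a)^(2 s)], and [2 s >= 1 - r] gives
    [a^(- r - 2 s) <= 1 / a]: completing the integral stays within the error. *)
Let lower_end Th s a : 1 <= a -> 0 < s -> (1 - r) / 2 <= s ->
  (forall v, 0 <= Th v <= expR (s * v) / s) ->
  `|prim_scale A B beta r a * Th (2 * ln (B / a))|
    <= kappa * (B `^ (2 * s) / s) / a.
Proof.
move=> a1 s0 sr hTh; have a0 : 0 < a by lra.
have /andP[t0 t1] := hTh (2 * ln (B / a)).
have w0 : 0 < prim_scale A B beta r a.
  by rewrite /prim_scale !mulr_gt0 ?invr_gt0 ?powR_gt0.
rewrite normrM (gtr0_norm w0) (ger0_norm t0).
apply: le_trans (ler_wpM2l (ltW w0) t1) _.
have e1 : a `^ (- r) * expR (s * (2 * ln (B / a))) <= B `^ (2 * s) / a.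
  rewrite ln_div ?posrE// !powR_expR// -[X in _ / X](lnK (x := a)) ?posrE//.
  rewrite -expRN -!expRD ler_expR.
  have : 0 <= (2 * s + r - 1) * ln a by rewrite mulr_ge0 ?ln_ge0//; lra.
  lra.
have -> : prim_scale A B beta r a * (expR (s * (2 * ln (B / a))) / s)
    = kappa / s / 2 * (a `^ (- r) * expR (s * (2 * ln (B / a)))).
  by rewrite /prim_scale /kappa; field; rewrite !gt_eqF.
apply: (@le_trans _ _ (kappa / s / 2 * (B `^ (2 * s) / a))).
  by rewrite ler_pM2l// !divr_gt0.
have -> : kappa * (B `^ (2 * s) / s) / a = kappa / s * (B `^ (2 * s) / a) by ring.
rewrite ler_wpM2r ?divr_ge0 ?powR_ge0 ?(ltW a0)//.
rewrite ler_pdivrMr// ler_peMr ?divr_ge0 ?ltW//; lra.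
Qed.

Let iterm a k : R[i] := (c k)%:C / (0 +i* a + (gamma k)%:C).

Let logistic_L s : 0 < s < 1 -> exists Th : R -> R,
  [/\ forall v, is_derive v 1 Th (logistic s v),
      forall v, 0 <= Th v <= expR (s * v) / s
    & forall v, `|pi / sin (pi * s) - Th v| <= (1 - s)^-1 * expR (- ((1 - s) * v))].
Proof.
move=> /logistic_primitive[Th [h1 h2 h3]]; exists Th; split => // v.
by have /andP[g0 g1] := h3 v; rewrite ger0_norm// [leRHS]mulrC.
Qed.

Lemma Khat_imag_re : exists C, forall a K, 1 <= a -> csum (iterm a) K ->
  `|complex.Re K - kappa * a `^ (- r) * L_re r| <= C / a.
Proof.
have /andP[r0 r1] := r01.
have s01 : 0 < 1 - r / 2 < 1 by apply/andP; split; lra.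
have [Th [dTh hTh hL]] := logistic_L s01.
have q0 : 0 < 1 - (1 - r / 2) by lra.
have [C hC] := Re_iterm_sum A0 B0 alpha0 beta0 r_def delta0 c_near gamma_near
  gamma_low dTh q0 hL.
exists (C + kappa * (B `^ (2 * (1 - r / 2)) / (1 - r / 2))) => a K a1 hK.
have h1 := hC a K (lt_le_trans ltr01 a1) hK.
have sr : (1 - r) / 2 <= 1 - r / 2 by lra.
have h2 := lower_end a1 (proj1 (andP s01)) sr hTh.
have -> : complex.Re K - kappa * a `^ (- r) * L_re r =
   (complex.Re K - prim_scale A B beta r a * (pi / sin (pi * (1 - r / 2)) - Th (2 * ln (B / a))))
   - prim_scale A B beta r a * Th (2 * ln (B / a)).
  by rewrite /prim_scale /kappa /L_re; ring.
by apply: le_trans (ler_normB _ _) _; rewrite [leRHS]mulrDl lerD.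
Qed.

Lemma Khat_imag_im : r < 1 -> exists C, forall a K, 1 <= a -> csum (iterm a) K ->
  `|complex.Im K + kappa * a `^ (- r) * L_im r| <= C / a.
Proof.
move=> r1; have /andP[r0 _] := r01.
have s01 : 0 < (1 - r) / 2 < 1 by apply/andP; split; lra.
have [Th [dTh hTh hL]] := logistic_L s01.
have q0 : 0 < 1 - (1 - r) / 2 by lra.
have [C hC] := Im_iterm_sum A0 B0 alpha0 beta0 r_def delta0 c_near gamma_near
  gamma_low dTh q0 hL.
exists (C + kappa * (B `^ (2 * ((1 - r) / 2)) / ((1 - r) / 2))) => a K a1 hK.
have h1 := hC a K (lt_le_trans ltr01 a1) hK.
have h2 := lower_end a1 (proj1 (andP s01)) (lexx _) hTh.
have -> : complex.Im K + kappa * a `^ (- r) * L_im r =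
   (complex.Im K + prim_scale A B beta r a * (pi / sin (pi * ((1 - r) / 2)) - Th (2 * ln (B / a))))
   + prim_scale A B beta r a * Th (2 * ln (B / a)).
  by rewrite /prim_scale /kappa /L_im; ring.
by apply: le_trans (ler_normD _ _) _; rewrite [leRHS]mulrDl lerD.
Qed.

(** At parameter 0 the integrand does not decay at [-oo], so the lower end [2 ln (B / a)] itself
    supplies the main term and the logarithm. What is left, [ln B] and [ln (1 + (B / a)^2)], is
    bounded. *)
Lemma Khat_imag_im1 : r = 1 -> exists C, forall a K, 1 <= a -> csum (iterm a) K ->
  `|complex.Im K + A / beta * (ln a / a)| <= C / a.
Proof.
move=> r1.
have dTh v : is_derive v 1 softlog (logistic ((1 - r) / 2) v).
  by rewrite r1 subrr mul0r; exact: softlog_derive.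
have [C hC] := Im_iterm_sum A0 B0 alpha0 beta0 r_def delta0 c_near gamma_near
  gamma_low dTh ltr01 softlog_bound.
exists (C + A / beta / 2 * (2 * `|ln B| + B ^+ 2)) => a K a1 hK.
have a0 : 0 < a by lra.
have h1 := hC a K a0 hK.
have wE : prim_scale A B beta r a = A / beta / 2 / a.
  by rewrite /prim_scale r1 subrr powRr0 powR_inv1 ?(ltW a0)//; field; rewrite !gt_eqF.
have sq : expR (2 * ln (B / a)) = (B / a) ^+ 2.
  by rewrite expRM_natl lnK ?posrE ?divr_gt0.
have l0 : 0 <= ln (1 + (B / a) ^+ 2) <= B ^+ 2.
  rewrite ln_ge0 ?lerDl ?sqr_ge0//=; apply: le_trans (le_ln1Dx _) _.
    by apply: lt_le_trans (sqr_ge0 _); rewrite ltrN10.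
  rewrite exprMn ler_piMr ?sqr_ge0// exprVn invf_le1 ?exprn_gt0//.
  by rewrite exprn_ege1.
have -> : complex.Im K + A / beta * (ln a / a) =
   (complex.Im K + prim_scale A B beta r a * (0 - softlog (2 * ln (B / a))))
   + A / beta / 2 / a * (2 * ln B - ln (1 + (B / a) ^+ 2)).
  rewrite wE /softlog sq ln_div ?posrE//; field; by rewrite !gt_eqF.
apply: le_trans (ler_normD _ _) _; rewrite [leRHS]mulrDl lerD//.
have w0 : 0 < A / beta / 2 / a by rewrite !divr_gt0.
rewrite normrM gtr0_norm// [leRHS]mulrAC ler_pM2l//.
apply: le_trans (ler_normB _ _) _; rewrite normrM (ger0_norm (_ : 0 <= 2))//.
by have /andP[l1 l2] := l0; rewrite (ger0_norm l1) lerD2l.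
Qed.

End MainTerms.

(** * A contraction principle *)

Section Contraction.
Variable R : realType.
Implicit Types (z w : R[i]) (n m : nat).

(** Banach's iteration in a closed disc. The initial step [rho / 2] and the ratio [1 / 2] make the
    steps sum to [rho], so no iterate leaves the disc; the limit is formed by coordinates. *)
Lemma complex_contraction (T : R[i] -> R[i]) z0 (rho : R) :
  (forall z w, normc (z - z0) <= rho -> normc (w - z0) <= rho ->
     normc (T z - T w) <= normc (z - w) / 2) ->
  normc (T z0 - z0) <= rho / 2 ->
  exists2 z, normc (z - z0) <= rho & T z = z.
Proof.
move=> hT hz0.
have rho0 : 0 <= rho by have := normc_ge0 (T z0 - z0); lra.
pose u n := iter n T z0; pose q n : R := 2^-1 ^+ n.
have q0 n : 0 < q n by rewrite exprn_gt0.
have qS n : q n.+1 = q n / 2 by rewrite /q exprSr.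
have hu n : normc (u n - z0) <= rho * (1 - q n) /\ normc (u n.+1 - u n) <= rho * q n.+1.
  elim: n => [|n [h1 h2]].
    by rewrite subrr (normc_real 0) normr0 /q expr0 subrr mulr0 expr1.
  have h3 : normc (u n.+1 - z0) <= rho * (1 - q n.+1).
    have -> : u n.+1 - z0 = (u n.+1 - u n) + (u n - z0) by ring.
    apply: le_trans (ler_normcD _ _) _; apply: le_trans (lerD h2 h1) _.
    by rewrite qS; lra.
  split => //; rewrite qS mulrA.
  apply: le_trans (hT (u n.+1) (u n) _ _) _; last by rewrite ler_pM2r.
  - by apply: le_trans h3 _; rewrite ler_piMr//; have := q0 n.+1; lra.
  - by apply: le_trans h1 _; rewrite ler_piMr//; have := q0 n; lra.
have [Z hZ] : exists Z, rsum (fun k => rho * q k) Z.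
  apply: (@rsum_bounded _ _ rho) => [k _|N]; first by rewrite mulr_ge0// ltW.
  rewrite -mulr_sumr ler_piMr//.
  have e n : \sum_(1 <= k < n.+1) q k = 1 - q n.
    elim: n => [|n IHn]; first by rewrite big_geq// /q expr0 subrr.
    by rewrite big_nat_recr//= IHn qS; field.
  by case: N => [|N]; [rewrite big_geq|rewrite e; have := q0 N; lra].
have lim (p : R[i] -> R) : (forall z w, p (z - w) = p z - p w) ->
    (forall z, `|p z| <= normc z) -> exists l : R, (fun n => p (u n)) @ \oo --> l.
  move=> pB pn.
  have [k k1|s hs] := @rsum_major _ (fun k => p (u k - u k.-1)) _ _ _ hZ.
    by apply: le_trans (pn _) _; case: k k1 => // k _; exact: (hu k).2.
  exists (s + p (u 0%N)).
  have h : (fun n => \sum_(1 <= k < n.+1) p (u k - u k.-1)) @ \oo --> s.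
    by move: hs; rewrite /rsum -cvg_shiftS.
  have -> : (fun n => p (u n))
      = (fun n => \sum_(1 <= k < n.+1) p (u k - u k.-1) + p (u 0%N)).
    apply/funext => n; elim: n => [|n IHn]; first by rewrite big_geq// add0r.
    by rewrite big_nat_recr//= addrAC -IHn pB addrC subrK.
  by apply: cvgD => //; exact: cvg_cst.
have [x hx] := lim (@complex.Re R) (@Re_sub R) (@normc_ge_Re R).
have [y hy] := lim (@complex.Im R) (@Im_sub R) (@normc_ge_Im R).
have close z' w M N : (forall n, (N <= n)%N -> normc (u n - w) <= M) ->
    z' = x +i* y -> normc (z' - w) <= M.
  move=> hM ->; apply/ler_addgt0Pr => e e0; near \oo => n.
  have nN : (N <= n)%N by near: n; exact: nbhs_infty_ge.
  have -> : x +i* y - w = (x +i* y - u n) + (u n - w) by ring.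
  apply: le_trans (ler_normcD _ _) _; rewrite addrC lerD ?hM//.
  apply: le_trans (normc_le_sum _) _; rewrite (splitr e) lerD//.
  - rewrite (_ : complex.Re _ = x - complex.Re (u n)); last by case: (u n).
    by near: n; move/cvgrPdist_le : hx; apply; rewrite divr_gt0.
  - rewrite (_ : complex.Im _ = y - complex.Im (u n)); last by case: (u n).
    by near: n; move/cvgrPdist_le : hy; apply; rewrite divr_gt0.
set z := x +i* y.
have zball : normc (z - z0) <= rho.
  apply: (@close z z0 rho 0%N) => // n _; apply: le_trans (hu n).1 _.
  by rewrite ler_piMr//; have := q0 n; lra.
exists z => //.
have ub n : normc (u n - z0) <= rho.
  by apply: le_trans (hu n).1 _; rewrite ler_piMr//; have := q0 n; lra.
have tail m n : normc (u (m + n)%N - u m) <= rho * (q m - q (m + n)%N).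
  elim: n => [|n IHn]; first by rewrite addn0 !subrr (normc_real 0) normr0 mulr0.
  rewrite addnS (_ : u (m + n).+1 - u m = (u (m + n).+1 - u (m + n)%N) + (u (m + n)%N - u m)); last by ring.
  apply: le_trans (ler_normcD _ _) _; apply: le_trans (lerD (hu _).2 IHn) _.
  by rewrite qS; lra.
have zu m : normc (z - u m) <= rho * q m.
  apply: (@close z (u m) _ m) => // n mn; rewrite -(subnKC mn).
  apply: le_trans (tail _ _) _; rewrite ler_wpM2l//.
  by have := q0 (m + (n - m))%N; lra.
apply/eqP; rewrite -subr_eq0 -normc_eq0 eq_le normc_ge0 andbT.
have small m : normc (T z - z) <= rho * q m.
  have -> : T z - z = (T z - T (u m)) - (z - u m.+1) by rewrite /u /=; ring.
  apply: le_trans (ler_normcD _ _) _; rewrite normcN.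
  have h1 := hT z (u m) zball (ub m); have h2 := zu m; have h3 := zu m.+1.
  rewrite qS in h3; lra.
apply/ler_addgt0Pr => e e0; rewrite add0r.
have qc : (fun m => rho * q m) @ \oo --> rho * 0.
  apply: cvgMl_tmp; apply: cvg_expr.
  by rewrite ger0_norm// invf_lt1// ltr1n.
near \oo => m; apply: le_trans (small m) _; apply: le_trans (ler_norm _) _.
rewrite -normrN -sub0r -(mulr0 rho).
by near: m; move/cvgrPdist_le : qc; apply.
Unshelve. all: by end_near. Qed.

End Contraction.

(** * The zeros near [i a] *)

Section NearImaginaryAxis.
Variable R : realType.
Variable gamma : nat -> R.
Hypothesis gamma_inc : forall k, (1 <= k)%N -> 0 < gamma k < gamma k.+1.
Hypothesis gamma_oo : gamma @ \oo --> +oo.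
Variable c : nat -> R.
Hypothesis wc : weight gamma c.
Variables a b S : R.
Hypothesis a0 : 0 < a.
Hypothesis b0 : 0 < b.
Hypothesis hS : rsum (fun k => c k / (a + gamma k)) S.
Implicit Types (z w : R[i]).

Let ia : R[i] := 0 +i* a.
Let g0 k : (1 <= k)%N -> 0 < gamma k.
Proof. exact: gamma_gt0. Qed.
Let K z := Khat c gamma z.

Let near z := normc (z - ia) <= a / 4.

Let near_ia : near ia.
Proof. by rewrite /near subrr (normc_real 0) normr0 divr_ge0// ltW. Qed.

(** [|i a + g| >= (a + g) / sqrt 2 >= 7 / 10 (a + g)], and a displacement of [a / 4] leaves at least
    a third. *)
Let near_shift z k : near z -> (1 <= k)%N ->
  (a + gamma k) / 3 <= normc (z + (gamma k)%:C).
Proof.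
rewrite /near => hz k1; have gk := g0 k1.
have h1 : 7 / 10 * (a + gamma k) <= normc (ia + (gamma k)%:C).
  rewrite normc_sqrtE Re_add Im_add /= add0r addr0.
  rewrite -ler_sqr ?nnegrE ?sqrtr_ge0 ?mulr_ge0 ?addr_ge0 ?ltW//.
  rewrite sqr_sqrtr ?addr_ge0 ?sqr_ge0//.
  have := sqr_ge0 (a - gamma k); rewrite !expr2; nra.
have h2 : normc (ia + (gamma k)%:C) <= normc (z + (gamma k)%:C) + normc (z - ia).
  rewrite -(normcN (z - ia)); apply: le_trans (ler_normcD _ _).
  by rewrite (_ : _ + - (z - ia) = ia + (gamma k)%:C)//; ring.
have h3 : (a + gamma k) / 3 + a / 4 <= 7 / 10 * (a + gamma k).
  by have := a0; lra.
rewrite -(lerD2r (a / 4)); apply: le_trans h3 _; apply: le_trans h1 _.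
by apply: le_trans h2 _; rewrite lerD2l.
Qed.

Let near_npole z : near z -> npole gamma z.
Proof.
move=> hz; apply/npoleP => k k1; rewrite -normc_gt0.
apply: lt_le_trans (near_shift hz k1).
by rewrite divr_gt0// addr_gt0// g0.
Qed.

Let normK z : near z -> normc (K z) <= 3 * S.
Proof.
move=> hz; apply: (csum_norm_le _ (csum_term gamma_inc gamma_oo wc (near_npole hz))
  (rsumZ 3 hS)) => k k1.
have p0 : 0 < a + gamma k by rewrite addr_gt0// g0.
rewrite normc_div normc_real gtr0_norm ?wc.1// mulrCA ler_pM2l ?wc.1//.
rewrite (_ : 3 / _ = ((a + gamma k) / 3)^-1); last by rewrite invf_div.
have h := near_shift hz k1.
by rewrite lef_pV2// posrE ?(lt_le_trans _ h)// divr_gt0.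
Qed.

Let diffK z w : near z -> near w -> exists2 Q : R[i],
  K z - K w = - (z - w) * Q & normc Q <= 9 / a * S.
Proof.
move=> hz hw.
have [Q hQ] := csum_term2 gamma_inc gamma_oo wc (near_npole hz) (near_npole hw).
exists Q.
  exact: (KhatB gamma_inc gamma_oo wc (near_npole hz) (near_npole hw) hQ).
apply: (csum_norm_le _ hQ (rsumZ (9 / a) hS)) => k k1.
have p0 : 0 < a + gamma k by rewrite addr_gt0// g0.
rewrite normc_div normc_real gtr0_norm ?wc.1// mulrCA ler_pM2l ?wc.1// normcM.
have h1 := near_shift hz k1; have h2 := near_shift hw k1.
have p3 : 0 < (a + gamma k) / 3 by rewrite divr_gt0.
apply: (@le_trans _ _ ((a + gamma k) / 3 * ((a + gamma k) / 3))^-1).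
  have z1 := lt_le_trans p3 h1; have z2 := lt_le_trans p3 h2.
  by rewrite lef_pV2 ?posrE ?mulr_gt0//; apply: ler_pM => //; exact: ltW.
rewrite (_ : 9 / a / (a + gamma k) = (a * (a + gamma k) / 9)^-1); last first.
  by rewrite invf_div invfM mulrA.
rewrite lef_pV2 ?posrE ?mulr_gt0 ?divr_gt0//.
have : a * (a + gamma k) <= (a + gamma k) * (a + gamma k).
  by rewrite ler_pM2r// lerDl ltW ?g0.
by have := a0; lra.
Qed.

Let ia2 : ia ^+ 2 + (a ^+ 2)%:C = 0.
Proof.
apply/eqP; rewrite eq_complex expr2 Re_add Im_add Re_mul Im_mul /=.
by apply/andP; split; apply/eqP; ring.
Qed.

Let normc_2ia : normc (2 * ia) = 2 * a.
Proof.
rewrite normcM (_ : 2 = (2 : R)%:C) ?normc_real; last by rewrite rmorph_nat.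
by rewrite normr_nat normc_sqrtE /= expr0n add0r sqrtr_sqr gtr0_norm.
Qed.

Let n2ia : 2 * ia != 0.
Proof. by rewrite -normc_gt0 normc_2ia mulr_gt0. Qed.

Let nia : ia != 0.
Proof. by move: n2ia; rewrite mulf_eq0 negb_or => /andP[]. Qed.

Let S0 : 0 <= S.
Proof.
apply: le_trans (rsum_part_le 1 _ hS); first by rewrite big_geq.
by move=> k k1; rewrite divr_ge0 ?addr_ge0// ltW// ?wc.1 ?g0.
Qed.

(** The threshold [18^-1] makes [b |Q| <= a / 2]; together with [|2 i a - (z + w)| <= a / 2] the
    ratio is at most [a / (2 a) = 1 / 2]. *)
Lemma charzero_exists : b <= a ^+ 2 -> S <= 18^-1 ->
  exists2 z, charzeros gamma c (a ^+ 2) b z & normc (z - ia) <= a / 4.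
Proof.
move=> ba S18.
(* Newton's iteration with the derivative frozen at its leading term. *)
pose T z := z - charfun gamma c (a ^+ 2) b z / (2 * ia).
have [||z hz Tz] := @complex_contraction R T ia (a / 4).
- move=> z w hz hw; have [Q eQ nQ] := diffK hz hw.
  have -> : T z - T w = (z - w) * ((2 * ia - (z + w)) - b%:C * Q) / (2 * ia).
    have e : K z = K w - (z - w) * Q by rewrite -mulNr -eQ addrC subrK.
    rewrite /T /charfun -/(K z) -/(K w) e; field; exact: nia.
  rewrite normc_div normc_2ia normcM -mulrA ler_wpM2l ?normc_ge0//.
  rewrite ler_pdivrMr ?mulr_gt0//; apply: le_trans (ler_normcD _ _) _.
  have h1 : normc (2 * ia - (z + w)) <= a / 2.
    have -> : 2 * ia - (z + w) = - (z - ia) + - (w - ia) by ring.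
    apply: le_trans (ler_normcD _ _) _; rewrite !normcN.
    by have := a0; move: hz hw; rewrite /near; lra.
  have h2 : normc (- (b%:C * Q)) <= a / 2.
    rewrite normcN normcM normc_real gtr0_norm//.
    apply: (@le_trans _ _ (a ^+ 2 * (9 / a * 18^-1))).
      apply: ler_pM; rewrite ?normc_ge0 ?(ltW b0)//.
      by apply: le_trans nQ _; rewrite ler_pM2l// divr_gt0.
    by rewrite le_eqVlt; apply/orP; left; apply/eqP; field; rewrite gt_eqF.
  lra.
- have -> : T ia - ia = b%:C * K ia / (2 * ia).
    by rewrite /T /charfun ia2 -/(K ia); field; exact: nia.
  rewrite normc_div normc_2ia normcM normc_real gtr0_norm//.
  rewrite ler_pdivrMr ?mulr_gt0//.
  apply: (@le_trans _ _ (a ^+ 2 * (3 * 18^-1))).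
    apply: ler_pM; rewrite ?normc_ge0 ?(ltW b0)//.
    by apply: le_trans (normK near_ia) _; rewrite ler_pM2l.
  by rewrite expr2; have := mulr_gt0 a0 a0; lra.
exists z => //; split; first exact: near_npole.
move: Tz => /eqP; rewrite /T -subr_eq0 addrAC subrr sub0r oppr_eq0 mulf_eq0 invr_eq0.
by rewrite (negbTE n2ia) orbF => /eqP.
Qed.

(** For [d = z - i a] the equation reads [d (z + i a) = b K z], so [|d| <= 3 b S / a]. Fed back, the
    errors from [K z - K (i a)] and from [d^2] are [27] and [9] times [(b S)^2 / a^2], then divided
    by [2 a]. *)
Lemma charzero_expansion z : charzeros gamma c (a ^+ 2) b z ->
  normc (z - ia) <= a / 4 ->
  normc (z - ia - b%:C * K ia / (2 * ia)) <= 18 * (b * S) ^+ 2 / a ^+ 3.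
Proof.
move=> [np Fz] hz; set d := z - ia.
have zE : z = ia + d by rewrite /d; ring.
have e1 : d * (z + ia) = b%:C * K z.
  move: Fz; rewrite /charfun -/(K z) => /subr0_eq <-.
  rewrite -[RHS]subr0 -ia2 zE; ring.
have zi : a <= normc (z + ia).
  have : normc (2 * ia) <= normc (z + ia) + normc d.
    rewrite -(normcN d); apply: le_trans (ler_normcD _ _).
    by rewrite (_ : _ + - d = 2 * ia)// /d; ring.
  by rewrite normc_2ia; have := a0; move: hz; rewrite -/d; lra.
have nd : normc d <= 3 * (b * S) / a.
  rewrite ler_pdivlMr//; apply: (@le_trans _ _ (normc d * normc (z + ia))).
    by rewrite ler_wpM2l ?normc_ge0.
  rewrite -normcM e1 normcM normc_real gtr0_norm//.
  by rewrite mulrCA ler_pM2l// normK.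
have [Q eQ nQ] := diffK hz near_ia.
have -> : d - b%:C * K ia / (2 * ia) = (- (b%:C * (d * Q)) - d * d) / (2 * ia).
  have e2 : K ia = K z + d * Q by rewrite /d -[_ * Q]opprK -mulNr -eQ; ring.
  rewrite e2 mulrDr -e1 zE; field; exact: nia.
have bS0 : 0 <= b * S by rewrite mulr_ge0// ltW.
rewrite normc_div normc_2ia ler_pdivrMr ?mulr_gt0//.
apply: le_trans (ler_normcD _ _) _; rewrite !normcN !normcM normc_real (gtr0_norm b0).
have h1 : b * (normc d * normc Q) <= b * ((3 * (b * S) / a) * (9 / a * S)).
  by rewrite ler_pM2l// ler_pM// normc_ge0.
have h2 : normc d * normc d <= (3 * (b * S) / a) * (3 * (b * S) / a).
  by rewrite ler_pM// normc_ge0.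
apply: le_trans (lerD h1 h2) _.
by rewrite le_eqVlt; apply/orP; left; apply/eqP; field; rewrite gt_eqF.
Qed.

(** Termwise this is [a^2 + g^2 <= (a + g)^2]. The asymptotics of [Khat] at [i a] thereby also bound
    the error sum [S]. *)
Lemma rsum_abs_le : S <= complex.Re (K ia) - complex.Im (K ia).
Proof.
have [h1 h2] := csum_term gamma_inc gamma_oo wc (near_npole near_ia).
apply: (ler_rsum _ hS (rsumB h1 h2)) => k k1.
have gk := g0 k1; have ck := wc.1 k k1.
rewrite /term Re_imag_term// Im_imag_term// opprK -mulrDl -mulrDr -mulrA ler_pM2l//.
rewrite ler_pdivlMr; last by rewrite addr_gt0// exprn_gt0.
rewrite mulrC ler_pdivrMr ?addr_gt0//.
have := mulr_gt0 a0 gk; rewrite !expr2; lra.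
Qed.

End NearImaginaryAxis.

(** * Landau notation and main terms *)

Section Glue.
Variable R : realType.
Implicit Types (a b C : R) (z K : R[i]).

(** Turns a Landau estimate into one constant valid from index 1 on; the finitely many early ratios
    are absorbed because [h] does not vanish. *)
Lemma eqaddO_nat (f g h : nat -> R) : f = g +O_\oo h ->
  (forall k, (1 <= k)%N -> h k != 0) ->
  exists C, forall k, (1 <= k)%N -> `|f k - g k| <= C * `|h k|.
Proof.
move=> /eqaddOP hO h0.
have [C hC] : exists C : R, \forall k \near \oo, `|(f - g) k| <= C * `|h k|.
  have [M [Mr hM]] := hO; exists (M + 1); apply: hM; rewrite ltrDl//.
have [|C' _ hC'] := @near_bounded R (fun k => `|f k - g k| / `|h k|) C.
  near=> k; have k1 : (1 <= k)%N by near: k; exact: nbhs_infty_ge.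
  by rewrite ler_pdivrMr ?normr_gt0 ?h0//; near: k.
exists C' => k k1; have := hC' k.
by rewrite ler_pdivrMr// normr_gt0 h0.
Unshelve. all: by end_near. Qed.

Lemma rsum_nneseries (u : nat -> R) : (forall k, (1 <= k)%N -> 0 <= u k) ->
  (\sum_(1 <= k <oo) (u k)%:E < 1%:E)%E -> exists2 s, s < 1 & rsum u s.
Proof.
move=> u0 hlt.
have part N : ((\sum_(1 <= k < N) u k)%:E <= \sum_(1 <= k <oo) (u k)%:E)%E.
  rewrite -sumEFin; apply: nneseries_lim_ge => k k1 _.
  by rewrite lee_fin u0.
move: hlt part; set E := (\sum_(1 <= k <oo) _)%E; case: E => [e| |]//; last first.
  by move=> _ /(_ 0%N).
rewrite lte_fin => e1 part.
have [|s hs] := @rsum_bounded R u e u0.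
  by move=> N; have := part N; rewrite lee_fin.
exists s => //; apply: le_lt_trans e1.
apply: (ler_cvg_to hs (cvg_cst e)); apply: nearW => N.
by have := part N; rewrite lee_fin.
Qed.

Lemma ell_zerosE (c gamma : nat -> R) (theta a : R) :
  ell_zeros c gamma theta a
  = charzeros gamma c (a ^+ 2) (a ^+ 2 / a `^ (2 * (1 - theta))).
Proof.
have e z : ell c gamma theta a z
    = charfun gamma c (a ^+ 2) (a ^+ 2 / a `^ (2 * (1 - theta))) z.
  by rewrite /ell /charfun mul1r rmorphM /=; ring.
by apply/seteqP; split => z [h1 h2]; split => //; rewrite -h2 e.
Qed.

Lemma normc_conj z : normc z^*%C = normc z.
Proof. by case: z => x y /=; rewrite sqrrN. Qed.

Lemma pair_asymptotics_intro (lp lm : nat -> R[i]) (re im err : nat -> R) C :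
  (\forall n \near \oo, [/\ normc (lp n - (re n +i* im n)) <= C * err n,
     lm n = (lp n)^*%C & 0 <= err n]) ->
  pair_asymptotics lp lm re im err.
Proof.
move=> h.
have main (w : nat -> R[i]^o) (u : nat -> R[i]^o) :
    (\forall n \near \oo, normc (w n - u n) <= C * err n /\ 0 <= err n) ->
    w = u +O_\oo (fun n => (err n)%:C : R[i]^o).
  move=> hw; apply/eqaddOP; exists C%:C; split.
    by rewrite complex_real.
  move=> [k k'] /=; rewrite ltcE /= => /andP[/eqP -> Ck]; near=> n.
  have [h1 h2] : normc (w n - u n) <= C * err n /\ 0 <= err n by near: n.
  rewrite fctE normcP normcP normc_real (ger0_norm h2) -[k +i* 0]/(k%:C).
  rewrite -rmorphM lecR; apply: le_trans h1 _.
  by rewrite ler_wpM2r// ltW.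
split; apply: main; apply: filterS h => n [h1 h2 h3]; split => //.
apply: le_trans h1; rewrite h2 -(normc_conj (lp n - _)) conjcB.
by rewrite (_ : (re n +i* im n)^*%C = re n -i* im n).
Unshelve. all: by end_near. Qed.

(** Division by [2 i a] turns by a right angle: the imaginary part of [Khat] moves the zero off the
    imaginary axis, the real part shifts its height. *)
Lemma div_2imag a b K : 0 < a -> b%:C * K / (2 * (0 +i* a))
  = (b / (2 * a) * complex.Im K) +i* (- (b / (2 * a) * complex.Re K)).
Proof.
move=> a0.
have e : 2 * (0 +i* a) = 0 +i* (2 * a) :> R[i].
  rewrite (_ : 2 = (2 : R)%:C); last by rewrite rmorph_nat.
  by apply/eqP; rewrite eq_complex Re_mul Im_mul /=; apply/andP; split; apply/eqP; ring.
have n0 : 0 +i* (2 * a) != 0 :> R[i].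
  by rewrite eq_complex /= mulf_eq0 (gt_eqF a0) pnatr_eq0 andbF.
rewrite e; apply: (canLR (mulfK n0)).
apply/eqP; rewrite eq_complex !Re_mul !Im_mul /=; apply/andP; split; apply/eqP.
  by field; rewrite gt_eqF.
by field; rewrite gt_eqF.
Qed.

Lemma zero_main_terms a b C E K z (m1 m2 : R) : 0 < a -> 0 < b ->
  normc (z - (0 +i* a) - b%:C * K / (2 * (0 +i* a))) <= E ->
  `|complex.Re K - m1| <= C / a -> `|complex.Im K - m2| <= C / a ->
  normc (z - ((b / (2 * a) * m2) +i* (a - b / (2 * a) * m1))) <= E + C * (b / a ^+ 2).
Proof.
move=> a0 b0; rewrite div_2imag// => hE h1 h2.
set X := (b / (2 * a) * complex.Im K) +i* _ in hE.
have -> : z - ((b / (2 * a) * m2) +i* (a - b / (2 * a) * m1)) = (z - (0 +i* a) - X)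
  + ((b / (2 * a) * (complex.Im K - m2)) +i* (- (b / (2 * a) * (complex.Re K - m1)))).
  rewrite /X; case: (z) => x y; apply/eqP; rewrite eq_complex /=.
  by apply/andP; split; apply/eqP; ring.
apply: le_trans (ler_normcD _ _) _; rewrite lerD//.
apply: le_trans (normc_le_sum _) _; rewrite /= normrN !(normrM (b / (2 * a))).
have w0 : 0 < b / (2 * a) by rewrite divr_gt0// mulr_gt0.
rewrite (gtr0_norm w0).
apply: (@le_trans _ _ (b / (2 * a) * (C / a) + b / (2 * a) * (C / a))).
  by rewrite lerD// ler_pM2l.
by rewrite le_eqVlt; apply/orP; left; apply/eqP; field; rewrite gt_eqF.
Qed.

Lemma powR_le_exp a (p q : R) : 1 <= a -> p <= q -> a `^ p <= a `^ q.
Proof. by move=> a1 pq; rewrite ler_powR. Qed.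

Lemma powR_ge_near (a : nat -> R) (p M : R) : a @ \oo --> +oo -> 0 < p ->
  \forall n \near \oo, M <= a n `^ p.
Proof.
move=> ha p0; pose M' := Num.max M 1.
have M0 : 0 < M' by rewrite lt_max ltr01 orbT.
near=> n.
have hn : expR (ln M' / p) <= a n by near: n; exact: (cvgryPge _).1 ha _.
apply: (@le_trans _ _ M'); first by rewrite le_max lexx.
have an : 0 < a n by apply: lt_le_trans hn; exact: expR_gt0.
rewrite powR_expR// -[leLHS]lnK ?posrE// ler_expR mulrC -ler_pdivrMr//.
by rewrite -ler_expR lnK.
Unshelve. all: by end_near. Qed.

End Glue.

(** * From the sum on the imaginary axis to the zeros *)

Section Assembly.
Variable R : realType.
Variables (a c gamma : nat -> R) (theta A B alpha beta r C1 C2 delta : R).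
Hypothesis a_ge1 : forall n, (1 <= n)%N -> 1 <= a n.
Hypothesis a_oo : a @ \oo --> +oo.
Hypothesis gamma_inc : forall k : nat, (1 <= k)%N -> 0 < gamma k < gamma k.+1.
Hypothesis gamma_oo : gamma @ \oo --> +oo.
Hypothesis theta01 : 0 <= theta <= 1.
Hypothesis c_gt0 : forall k : nat, (1 <= k)%N -> 0 < c k.
Variable K0 : R.
Hypothesis K0_lt1 : K0 < 1.
Hypothesis K0_sum : rsum (fun k => c k / gamma k) K0.
Hypothesis A0 : 0 < A.
Hypothesis B0 : 0 < B.
Hypothesis alpha0 : 0 < alpha.
Hypothesis beta0 : 0 < beta.
Hypothesis r_def : r = (alpha + beta - 1) / beta.
Hypothesis r01 : 0 < r <= 1.
Hypothesis delta0 : 0 < delta.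
Hypothesis c_near : forall k : nat, (1 <= k)%N ->
  `|c k - A * k%:R `^ (- alpha)| <= C1 * k%:R `^ (- alpha - 1).
Hypothesis gamma_near : forall k : nat, (1 <= k)%N ->
  `|gamma k - B * k%:R `^ beta| <= C2 * k%:R `^ (beta - 1).
Hypothesis gamma_low : forall k : nat, (1 <= k)%N ->
  delta * k%:R `^ beta <= gamma k.
Implicit Types (x S : R) (n k : nat) (z K : R[i]).

Let wc : weight gamma c.
Proof. by split => //; exists K0. Qed.

Let coef x := x ^+ 2 / x `^ (2 * (1 - theta)).

Let coefE x : 1 <= x -> coef x = x `^ (2 * theta).
Proof.
move=> x1; have x0 : 0 < x by lra.
rewrite /coef -powR_mulrn ?(ltW x0)// -powRB ?(gt_eqF x0) ?implybT//.
by congr (_ `^ _); ring.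
Qed.

Let coef_gt0 x : 1 <= x -> 0 < coef x.
Proof. by move=> x1; rewrite coefE// powR_gt0//; lra. Qed.

Let coef_le x : 1 <= x -> coef x <= x ^+ 2.
Proof.
move=> x1; rewrite coefE// -powR_mulrn; last by lra.
by rewrite powR_le_exp//; have /andP[_ ?] := theta01; lra.
Qed.

Local Notation zeros x := (charzeros gamma c (x ^+ 2) (coef x)).

Let gap_condition x : 1 <= x -> coef x * Kr gamma c 0 < x ^+ 2.
Proof.
move=> x1; have -> : Kr gamma c 0 = K0.
  apply: rsum_unique (rsum_Kr gamma_inc gamma_oo wc (npole_ge0 gamma_inc (lexx 0))) _.
  by apply: rsum_ext K0_sum => k _; rewrite add0r.
have K1 := K0_lt1; apply: lt_le_trans (coef_le x1).
by rewrite gtr_pMr ?coef_gt0.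
Qed.

Lemma zeros_structure x : 1 <= x -> exists (lam : nat -> R) (wp wm : R[i]),
  [/\ gap_seq gamma lam,
    zeros x = [set (lam k)%:C | k in [set k : nat | (1 <= k)%N]] `|` [set wp; wm]
  & forall w, zeros x w -> 0 < complex.Im w -> wp = w /\ wm = w^*%C].
Proof.
move=> x1; apply: charzeros_structure => //.
- exact: coef_gt0.
- by rewrite exprn_gt0//; lra.
- exact: gap_condition.
Qed.

(** A zero in the gap forces [Kr >= a_n^(2 (1 - theta))], which is unbounded for [theta < 1]; by
    [Kr_le] this is possible only close to [- gamma k]. *)
Lemma gap_zeros_cvg (lam : nat -> R) k : theta < 1 -> (1 <= k)%N ->
  (forall n, (1 <= n)%N -> in_gap gamma k (lam n) /\ zeros (a n) (lam n)%:C) ->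
  lam @ \oo --> - gamma k.
Proof.
move=> th1 k1 hlam; have [C hC] := Kr_le gamma_inc gamma_oo wc k1.
have ck := c_gt0 k1; have p0 : 0 < 2 * (1 - theta) by lra.
apply/cvgrPdist_le => e e0; near=> n.
have n1 : (1 <= n)%N by near: n; exact: nbhs_infty_ge.
have [gl [np Fz]] := hlam n n1; have a1 := a_ge1 n1; have lk := gl.1.
have an0 : 0 < a n by lra.
have big : c k / e + C <= a n `^ (2 * (1 - theta)).
  by near: n; exact: powR_ge_near.
have P0 : 0 < a n `^ (2 * (1 - theta)) by rewrite powR_gt0.
have gk : 0 < lam n + gamma k by lra.
have Klow : a n `^ (2 * (1 - theta)) <= Kr gamma c (lam n).
  move: Fz; rewrite charfun_real// => /(@complexI R)/subr0_eq e1.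
  have : a n ^+ 2 <= coef (a n) * Kr gamma c (lam n).
    by rewrite -e1 lerDr sqr_ge0.
  by rewrite /coef mulrAC ler_pdivlMr// ler_pM2l// exprn_gt0.
have h : c k / e <= c k / (lam n + gamma k) by have := hC _ gl; lra.
move: h; rewrite ler_pM2l// lef_pV2 ?posrE// => h.
by rewrite -opprD normrN gtr0_norm addrC.
Unshelve. all: by end_near. Qed.

Let iterm x k : R[i] := (c k)%:C / (0 +i* x + (gamma k)%:C).

Let csum_iterm x : 0 < x -> csum (iterm x) (Khat c gamma (0 +i* x)).
Proof.
move=> x0; apply: csum_term => //; apply: npole_nonreal.
by rewrite /= gt_eqF.
Qed.

Let abs_sum x : 1 <= x -> exists S, rsum (fun k => c k / (x + gamma k)) S.
Proof.
move=> x1; apply: (rsum_major _ K0_sum) => k k1.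
have gk := gamma_gt0 gamma_inc k1; have ck := c_gt0 k1.
have x0 : 0 < x by lra.
rewrite gtr0_norm ?divr_gt0 ?addr_gt0// ler_pM2l// lef_pV2 ?posrE ?addr_gt0//.
by rewrite lerDr ltW.
Qed.

(** For [r < 1] take [rho = r]. At [r = 1] the true size [ln x / x] is weakened to [x^(- 1 / 2)]:
    the quadratic error then has exponent [4 theta - 4 <= 2 theta - 2], and no logarithm
    survives. *)
Lemma abs_sum_bound : exists rho C, [/\ 0 < rho,
  4 * theta - 3 - 2 * rho <= Num.max (2 * theta - 2) (4 * theta - 3 - 2 * r)
  & forall x S, 1 <= x -> rsum (fun k => c k / (x + gamma k)) S -> S <= C * x `^ (- rho)].
Proof.
have [Cr hr] := Khat_imag_re A0 B0 alpha0 beta0 r_def r01 delta0 c_near gamma_near gamma_low.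
have /andP[r0 r1] := r01; have /andP[t0 t1] := theta01.
have le_inv x (C p : R) : 1 <= x -> p <= 1 -> C / x <= `|C| * x `^ (- p).
  move=> x1 p1; have x0 : 0 < x by lra.
  apply: (@le_trans _ _ (`|C| / x)); first by rewrite ler_pM2r ?invr_gt0// ler_norm.
  by rewrite ler_wpM2l// -powR_inv1 ?(ltW x0)// powR_le_exp//; lra.
have base x S : 1 <= x -> rsum (fun k => c k / (x + gamma k)) S ->
    S <= complex.Re (Khat c gamma (0 +i* x)) - complex.Im (Khat c gamma (0 +i* x)).
  by move=> x1 hS; apply: (rsum_abs_le gamma_inc gamma_oo wc _ hS); lra.
move: r1; rewrite le_eqVlt => /predU1P[r1|r1].
- have [Ci hi] := Khat_imag_im1 A0 B0 alpha0 beta0 r_def delta0 c_near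
    gamma_near gamma_low r1.
  exists 2^-1, (`|Cr + kappa A B beta r * L_re r| + (`|Ci| + 2 * (A / beta))); split => //.
    by rewrite le_max; apply/orP; left; lra.
  move=> x S x1 hS; have x0 : 0 < x by lra.
  have h := base x S x1 hS.
  have := hr x _ x1 (csum_iterm x0); have := hi x _ x1 (csum_iterm x0).
  rewrite !ler_norml => /andP[i1 _] /andP[_ i2].
  have h1 := le_inv x (Cr + kappa A B beta r * L_re r) 2^-1 x1 _.
  have h2 := le_inv x Ci 2^-1 x1 _.
  have half1 : 2^-1 <= 1 :> R by rewrite invf_le1// ler1n.
  have {}h1 := h1 half1; have {}h2 := h2 half1.
  have hl : A / beta * (ln x / x) <= 2 * (A / beta) * x `^ (- 2^-1).
    rewrite (_ : 2 * (A / beta) * _ = A / beta * (2 * x `^ (- 2^-1))); last by ring.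
    rewrite ler_pM2l ?divr_gt0//.
    have lx : ln x <= 2 * x `^ 2^-1.
      have -> : ln x = 2 * ln (x `^ 2^-1) by rewrite ln_powR mulrA mulfV ?mul1r.
      by rewrite ler_pM2l//; apply/ltW/ln_sublinear; rewrite powR_gt0.
    have Px : x `^ (- 2^-1) * x = x `^ 2^-1.
      rewrite -[X in _ * X](powRr1 (ltW x0)) -powRD ?(gt_eqF x0) ?implybT//.
      by congr (_ `^ _); field.
    by rewrite ler_pdivrMr// -mulrA Px.
  rewrite mulrDl in h1; rewrite r1 powR_inv1 ?(ltW x0)// in i2 h1 *.
  rewrite mulrDl mulrDl.
  lra.
- have [Ci hi] := Khat_imag_im A0 B0 alpha0 beta0 r_def r01 delta0 c_near
    gamma_near gamma_low r1.
  exists r, (`|Cr| + `|Ci| + kappa A B beta r * L_re r + kappa A B beta r * L_im r).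
  split => //; first by rewrite le_max lexx orbT.
  move=> x S x1 hS; have x0 : 0 < x by lra.
  have h := base x S x1 hS.
  have := hr x _ x1 (csum_iterm x0); have := hi x _ x1 (csum_iterm x0).
  rewrite !ler_norml => /andP[i1 _] /andP[_ i2].
  have h1 := le_inv x Cr r x1 (ltW r1); have h2 := le_inv x Ci r x1 (ltW r1).
  rewrite 3!mulrDl; lra.
Qed.

Lemma upper_zero_exists : \forall n \near \oo,
  exists2 z, zeros (a n) z & normc (z - (0 +i* a n)) <= a n / 4.
Proof.
have [rho [C [rho0 _ hC]]] := abs_sum_bound.
near=> n.
have n1 : (1 <= n)%N by near: n; exact: nbhs_infty_ge.
have a1 := a_ge1 n1; have a0 : 0 < a n by lra.
have [S hS] := abs_sum a1.
apply: (charzero_exists gamma_inc gamma_oo wc a0 (coef_gt0 a1) hS (coef_le a1)).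
have big : 18 * C <= a n `^ rho by near: n; exact: powR_ge_near.
apply: le_trans (hC _ _ a1 hS) _; rewrite powRN ler_pdivrMr ?powR_gt0//.
by rewrite mulrC ler_pdivlMr//; lra.
Unshelve. all: by end_near. Qed.

(** Shared by all cases, which differ only in the main terms [m1], [m2] of [Khat] and in the
    exponent [e]. The condition on [e] covers the quadratic remainder and the [C0 / x] error in
    [Khat] together. *)
Lemma pair_of_Khat (lp lm : nat -> R[i]) (m1 m2 : R -> R) (re im : nat -> R) (C0 e : R) :
  (\forall n \near \oo, [/\ zeros (a n) (lp n),
     normc (lp n - (0 +i* a n)) <= a n / 4 & lm n = (lp n)^*%C]) ->
  (forall x K, 1 <= x -> csum (iterm x) K -> `|complex.Re K - m1 x| <= C0 / x) ->
  (forall x K, 1 <= x -> csum (iterm x) K -> `|complex.Im K - m2 x| <= C0 / x) ->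
  (forall n, (1 <= n)%N -> re n = coef (a n) / (2 * a n) * m2 (a n)) ->
  (forall n, (1 <= n)%N -> im n = a n - coef (a n) / (2 * a n) * m1 (a n)) ->
  Num.max (2 * theta - 2) (4 * theta - 3 - 2 * r) <= - e ->
  pair_asymptotics lp lm re im (fun n => 1 / a n `^ e).
Proof.
move=> hlp h1 h2 hre him; rewrite ge_max => /andP[e1 e2].
have [rho [C [rho0 hrho hC]]] := abs_sum_bound.
have e3 : 4 * theta - 3 - 2 * rho <= - e.
  by apply: le_trans hrho _; rewrite ge_max e1.
apply: (@pair_asymptotics_intro _ _ _ _ _ _ (18 * C ^+ 2 + `|C0|)).
near=> n.
have n1 : (1 <= n)%N by near: n; exact: nbhs_infty_ge.
have [zl nl cl] : [/\ zeros (a n) (lp n),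
  normc (lp n - (0 +i* a n)) <= a n / 4 & lm n = (lp n)^*%C] by near: n.
have a1 := a_ge1 n1; have a0 : 0 < a n by lra.
have [S hS] := abs_sum a1.
split => //; last by rewrite divr_ge0// powR_ge0.
have hE := charzero_expansion gamma_inc gamma_oo wc a0 (coef_gt0 a1) hS zl nl.
have hK := csum_iterm a0.
have := zero_main_terms a0 (coef_gt0 a1) hE (h1 _ _ a1 hK) (h2 _ _ a1 hK).
rewrite -hre// -him// => /le_trans; apply.
have S0 : 0 <= S.
  apply: le_trans (rsum_part_le 1 _ hS); first by rewrite big_geq.
  move=> k k1; rewrite divr_ge0 ?(ltW (c_gt0 k1))// addr_ge0 ?(ltW a0)//.
  by rewrite ltW// (gamma_gt0 gamma_inc).
rewrite mul1r -powRN [leRHS]mulrDl; apply: lerD.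
- have bS : coef (a n) * S <= C * a n `^ (2 * theta - rho).
    rewrite coefE// powRB ?(gt_eqF a0) ?implybT// mulrCA ler_pM2l ?powR_gt0//.
    by rewrite -powRN; exact: hC.
  have bS0 : 0 <= coef (a n) * S by rewrite mulr_ge0// ltW// coef_gt0.
  apply: (@le_trans _ _ (18 * (C * a n `^ (2 * theta - rho)) ^+ 2 / a n ^+ 3)).
    rewrite ler_pM2r ?invr_gt0 ?exprn_gt0// ler_pM2l// ler_sqr ?nnegrE//.
    exact: le_trans bS0 bS.
  have -> : 18 * (C * a n `^ (2 * theta - rho)) ^+ 2 / a n ^+ 3
    = 18 * C ^+ 2 * (a n `^ (2 * theta - rho) ^+ 2 / a n ^+ 3).
    by rewrite exprMn; ring.
  apply: ler_wpM2l; first exact: (mulr_ge0 _ (sqr_ge0 _)).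
  rewrite -(powR_mulrn 2) ?powR_ge0// -(powR_mulrn 3) ?(ltW a0)//.
  rewrite -powRrM -powRB ?(gt_eqF a0) ?implybT//.
  by rewrite powR_le_exp//; lra.
- apply: (@le_trans _ _ (`|C0| * (coef (a n) / a n ^+ 2))).
    by rewrite ler_wpM2r ?ler_norm// divr_ge0 ?sqr_ge0// ltW// coef_gt0.
  rewrite ler_wpM2l// coefE// -powR_mulrn ?(ltW a0)//.
  rewrite -powRB ?(gt_eqF a0) ?implybT// powR_le_exp//; lra.
Unshelve. all: by end_near. Qed.

Lemma pair_asymptotics_lt1 (lp lm : nat -> R[i]) (e : R) : r < 1 ->
  (\forall n \near \oo, [/\ zeros (a n) (lp n),
     normc (lp n - (0 +i* a n)) <= a n / 4 & lm n = (lp n)^*%C]) ->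
  Num.max (2 * theta - 2) (4 * theta - 3 - 2 * r) <= - e ->
  pair_asymptotics lp lm
    (fun n => - (A * D1 r * B `^ (r - 1) / (beta * a n `^ n1 theta r)))
    (fun n => a n + A * D2 r * B `^ (r - 1) / (beta * a n `^ n1 theta r))
    (fun n => 1 / a n `^ e).
Proof.
move=> r1 hlp he; have /andP[r0 _] := r01.
have r011 : 0 < r < 1 by rewrite r0.
have [Cr hr] := Khat_imag_re A0 B0 alpha0 beta0 r_def r01 delta0 c_near gamma_near gamma_low.
have [Ci hi] := Khat_imag_im A0 B0 alpha0 beta0 r_def r01 delta0 c_near
  gamma_near gamma_low r1.
(* [2 theta - 1 - r] is [- n1 theta r]; the factor [1 / 2] is the one in [D1E] and [D2E]. *)
have powE n : (1 <= n)%N ->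
    coef (a n) / (2 * a n) * a n `^ (- r) = 2^-1 / a n `^ n1 theta r.
  move=> nn; have a1 := a_ge1 nn; have a0 : 0 < a n by lra.
  rewrite coefE// (_ : _ / (2 * a n) * _ =
    2^-1 * (a n `^ (2 * theta) * a n `^ (- 1) * a n `^ (- r))); last first.
    by rewrite powR_inv1 ?(ltW a0)//; field; rewrite gt_eqF.
  rewrite -!powRD ?(gt_eqF a0) ?implybT// -powRN; congr (_ * _ `^ _).
  by rewrite /n1; field.
apply: (@pair_of_Khat lp lm (fun x => kappa A B beta r * x `^ (- r) * L_re r)
  (fun x => - (kappa A B beta r * x `^ (- r) * L_im r)) _ _ (Num.max Cr Ci) e hlp) => //.
- move=> x K x1 hK; apply: le_trans (hr x K x1 hK) _.
  by rewrite ler_pM2r ?invr_gt0 ?le_max ?lexx//; lra.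
- move=> x K x1 hK; rewrite opprK; apply: le_trans (hi x K x1 hK) _.
  by rewrite ler_pM2r ?invr_gt0 ?le_max ?lexx ?orbT//; lra.
- move=> n n1; rewrite D1E//.
  have -> : coef (a n) / (2 * a n) * - (kappa A B beta r * a n `^ (- r) * L_im r)
    = - (coef (a n) / (2 * a n) * a n `^ (- r) * (kappa A B beta r * L_im r)) by ring.
  by rewrite powE// /kappa invfM; congr (- _); ring.
- move=> n n1; rewrite D2E//.
  have -> : coef (a n) / (2 * a n) * (kappa A B beta r * a n `^ (- r) * L_re r)
    = coef (a n) / (2 * a n) * a n `^ (- r) * (kappa A B beta r * L_re r) by ring.
  by rewrite powE// /kappa invfM; congr (_ + _); ring.
Qed.

(** At [r = 1] the real part of [Khat (i a)] is itself [O(1 / a)], so [m1 = 0] and the height [a_n]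
    receives no correction. *)
Lemma pair_asymptotics_1 (lp lm : nat -> R[i]) : r = 1 ->
  (\forall n \near \oo, [/\ zeros (a n) (lp n),
     normc (lp n - (0 +i* a n)) <= a n / 4 & lm n = (lp n)^*%C]) ->
  pair_asymptotics lp lm
    (fun n => - (1 / 2 * (A / beta) * (ln (a n) / a n `^ (2 * (1 - theta)))))
    (fun n => a n) (fun n => 1 / a n `^ (2 * (1 - theta))).
Proof.
move=> r1 hlp; have /andP[t0 t1] := theta01.
have [Cr hr] := Khat_imag_re A0 B0 alpha0 beta0 r_def r01 delta0 c_near gamma_near gamma_low.
have [Ci hi] := Khat_imag_im1 A0 B0 alpha0 beta0 r_def delta0 c_near
  gamma_near gamma_low r1.
pose C0 := Num.max (Cr + `|kappa A B beta r * L_re r|) Ci.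
apply: (@pair_of_Khat lp lm (fun=> 0) (fun x => - (A / beta * (ln x / x)))
  _ _ C0 _ hlp) => //.
- move=> x K x1 hK; have x0 : 0 < x by lra.
  apply: (@le_trans _ _ ((Cr + `|kappa A B beta r * L_re r|) / x)).
    have -> : complex.Re K - 0 = (complex.Re K - kappa A B beta r * x `^ (- r) * L_re r)
      + kappa A B beta r * L_re r / x.
      by rewrite r1 powR_inv1 ?(ltW x0)//; ring.
    apply: le_trans (ler_normD _ _) _; rewrite mulrDl lerD ?hr//.
    by rewrite normrM [`|x^-1|]gtr0_norm ?invr_gt0.
  by rewrite ler_pM2r ?invr_gt0// /C0 le_max lexx.
- move=> x K x1 hK; rewrite opprK; apply: le_trans (hi x K x1 hK) _.
  by rewrite ler_pM2r ?invr_gt0 /C0 ?le_max ?lexx ?orbT//; lra.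
- move=> n n1; have a1 := a_ge1 n1; have a0 : 0 < a n by lra.
  have p0 : 0 < a n `^ (2 * (1 - theta)) by rewrite powR_gt0.
  by rewrite /coef; field; rewrite !gt_eqF.
- by move=> n _; rewrite mulr0 subr0.
- by rewrite r1 ge_max; apply/andP; split; lra.
Qed.

End Assembly.

(** * The theorem *)

Theorem theorem3p3 (R : realType)
    (a c gamma : nat -> R) (theta calA calB alpha beta r : R)
    (a_ge1 : 1 <= a 1%N)
    (a_nondecreasing : forall n : nat, (1 <= n)%N -> a n <= a n.+1)
    (a_cvg : a @ \oo --> +oo)
    (c_gt0 : forall k : nat, (1 <= k)%N -> 0 < c k)
    (gamma_increasing : forall k : nat, (1 <= k)%N -> 0 < gamma k < gamma k.+1)
    (gamma_cvg : gamma @ \oo --> +oo)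
    (gamma_gaps :
       ereal_sup [set (gamma k * (gamma k.+1 - gamma k))%:E
                 | k in [set k : nat | (1 <= k)%N]] = +oo%E)
    (theta01 : 0 <= theta <= 1)
    (beta_gt : 1 / 2 < beta)
    (sum_lt1 : (\sum_(1 <= k <oo) (c k / gamma k)%:E < 1%:E)%E)
    (calA_gt0 : 0 < calA) (calB_gt0 : 0 < calB)
    (alpha01 : 0 < alpha <= 1)
    (alpha_beta : 1 < alpha + beta)
    (c_asymp : c = (fun k : nat => calA / k%:R `^ alpha)
                   +O_\oo (fun k : nat => 1 / k%:R `^ (alpha + 1)))
    (gamma_asymp : gamma = (fun k : nat => calB * k%:R `^ beta)
                   +O_\oo (fun k : nat => k%:R `^ (beta - 1)))
    (r_def : r = (alpha + beta - 1) / beta) :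
  exists (lam : nat -> nat -> R) (lp lm : nat -> R[i]),
    (forall n : nat, (1 <= n)%N ->
       [/\ ell_zeros c gamma theta (a n)
           = [set (lam n k)%:C | k in [set k : nat | (1 <= k)%N]]
             `|` [set lp n; lm n],
           - gamma 1%N < lam n 1%N < 0
         & forall k : nat, (2 <= k)%N -> - gamma k < lam n k < - gamma k.-1])
    /\ (* at theta = 1 the limit is the zero of 1 - Khat instead of - gamma k *)
       (theta < 1 -> forall k : nat, (1 <= k)%N ->
          (fun n => lam n k) @ \oo --> - gamma k)
    /\ (\forall n \near \oo, complex.Im (lp n) != 0 /\ lp n = (lm n)^*)
    /\ (0 < r < 1 / 2 -> 1 / 2 <= theta < 1 ->
          pair_asymptotics lp lm
            (fun n => - (calA * D1 r * calB `^ (r - 1)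
                         / (beta * a n `^ n1 theta r)))
            (fun n => a n + calA * D2 r * calB `^ (r - 1)
                            / (beta * a n `^ n1 theta r))
            (fun n => 1 / a n `^ n2 theta r))
    /\ (0 < r < 1 -> 1 / 2 <= r < 1 \/ 0 < theta < 1 / 2 ->
          pair_asymptotics lp lm
            (fun n => - (calA * D1 r * calB `^ (r - 1)
                         / (beta * a n `^ n1 theta r)))
            (fun n => a n + calA * D2 r * calB `^ (r - 1)
                            / (beta * a n `^ n1 theta r))
            (fun n => 1 / a n `^ (2 * (1 - theta))))
    /\ (r = 1 ->
          pair_asymptotics lp lm
            (fun n => - (1 / 2 * (calA / beta)
                         * (ln (a n) / a n `^ (2 * (1 - theta)))))
            (fun n => a n)
            (fun n => 1 / a n `^ (2 * (1 - theta)))).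
Proof.
have a1 n : (1 <= n)%N -> 1 <= a n.
  elim: n => // n IHn _; case: n IHn => // n IHn.
  by apply: le_trans (IHn isT) _; exact: a_nondecreasing.
have beta0 : 0 < beta by lra.
have /andP[alpha0 alpha1] := alpha01.
have r01 : 0 < r <= 1.
  by rewrite r_def divr_gt0 ?ler_pdivrMr//=; lra.
have kpow (k : nat) (p : R) : (1 <= k)%N -> 0 < k%:R `^ p :> R.
  by move=> k1; rewrite powR_gt0// ltr0n.
have [C1 hC1] : exists C1, forall k, (1 <= k)%N ->
    `|c k - calA * k%:R `^ (- alpha)| <= C1 * k%:R `^ (- alpha - 1).
  have [|C hC] := eqaddO_nat c_asymp.
    by move=> k k1; rewrite mul1r invr_eq0 gt_eqF ?kpow.
  exists C => k k1; have := hC k k1.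
  by rewrite mul1r -!powRN opprD [X in C * X]ger0_norm ?powR_ge0.
have [C2 hC2] : exists C2, forall k, (1 <= k)%N ->
    `|gamma k - calB * k%:R `^ beta| <= C2 * k%:R `^ (beta - 1).
  have [|C hC] := eqaddO_nat gamma_asymp.
    by move=> k k1; rewrite gt_eqF ?kpow.
  exists C => k k1; have := hC k k1.
  by rewrite [X in C * X]ger0_norm ?powR_ge0.
have [delta delta0 hdelta] : exists2 delta, 0 < delta & forall k, (1 <= k)%N ->
    delta * k%:R `^ beta <= gamma k.
  have g0 k : (1 <= k)%N -> 0 < gamma k by move=> /gamma_increasing/andP[].
  (* Eventually [gamma k >= calB k^beta / 2]; the remaining finitely many indices only lower
     [delta]. *)
  have [|C C0 hC] := @near_bounded R (fun k => k%:R `^ beta / gamma k) (2 / calB).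
    near=> k; have k1 : (1 <= k)%N by near: k; exact: nbhs_infty_ge.
    have kC : 2 * `|C2| / calB <= k%:R.
      by near: k; exact: (cvgryPge _).1 (@cvgr_idn R) _.
    have k0 : 0 < k%:R :> R by rewrite ltr0n.
    rewrite ler_pdivrMr ?g0// mulrAC ler_pdivlMr// mulrC.
    have := hC2 k k1; rewrite ler_norml => /andP[h _].
    have e : k%:R `^ beta = k%:R * k%:R `^ (beta - 1) :> R by rewrite mulr_powRB1// ltW.
    have h2 : 2 * (C2 * k%:R `^ (beta - 1)) <= calB * k%:R `^ beta.
      rewrite e !mulrA ler_pM2r ?kpow// (mulrC calB).
      by move: kC; rewrite ler_pdivrMr//; apply: le_trans; rewrite ler_pM2l// ler_norm.
    lra.
  exists C^-1; first by rewrite invr_gt0.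
  by move=> k k1; rewrite ler_pdivrMl// -ler_pdivrMr ?g0.
have [K0 K01 hK0] : exists2 s, s < 1 & rsum (fun k => c k / gamma k) s.
  apply: rsum_nneseries => // k k1; rewrite divr_ge0// ltW ?c_gt0//.
  by have /andP[] := gamma_increasing k k1.
pose coef x := x ^+ 2 / x `^ (2 * (1 - theta)).
pose zeros n := charzeros gamma c (a n ^+ 2) (coef (a n)).
(* The pair is chosen for every [n], real or not; the last clause identifies it with the conjugate
   pair once a zero in the upper half-plane is known. Index 0 receives a default. *)
have structure n : exists p : (nat -> R) * R[i] * R[i], (1 <= n)%N ->
    [/\ gap_seq gamma p.1.1,
      zeros n = [set (p.1.1 k)%:C | k in [set k : nat | (1 <= k)%N]] `|` [set p.1.2; p.2]
    & forall w, zeros n w -> 0 < complex.Im w -> p.1.2 = w /\ p.2 = w^*%C].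
  have [n1|] := boolP (1 <= n)%N; last by exists (fun=> 0, 0, 0).
  have [lam [wp [wm h]]] := zeros_structure gamma_increasing gamma_cvg theta01
    c_gt0 K01 hK0 (a1 n n1).
  by exists (lam, wp, wm).
have [F hF] := choice structure.
pose lam n := (F n).1.1; pose lp n := (F n).1.2; pose lm n := (F n).2.
have gaps n : (1 <= n)%N -> gap_seq gamma (lam n) by move=> /hF[].
have zerosE n : (1 <= n)%N -> zeros n =
    [set (lam n k)%:C | k in [set k : nat | (1 <= k)%N]] `|` [set lp n; lm n].
  by move=> /hF[].
have upper : \forall n \near \oo, [/\ zeros n (lp n),
    normc (lp n - (0 +i* a n)) <= a n / 4 & lm n = (lp n)^*%C].
  have := upper_zero_exists a1 a_cvg gamma_increasing gamma_cvg theta01 c_gt0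
    hK0 calA_gt0 calB_gt0 alpha0 beta0 r_def r01 delta0 hC1 hC2 hdelta.
  move=> hU; near=> n.
  have n1 : (1 <= n)%N by near: n; exact: nbhs_infty_ge.
  have [z zz nz] : exists2 z, zeros n z & normc (z - (0 +i* a n)) <= a n / 4.
    by near: n.
  have Iz : 0 < complex.Im z.
    have := le_trans (normc_ge_Im _) nz; have := a1 n n1.
    case: (z) => x y /=; rewrite ler_norml => an /andP[h _]; lra.
  have [_ _ h] := hF n n1; have [e1 e2] := h z zz Iz.
  by rewrite /lp /lm e1 e2.
exists lam, lp, lm; split; [|split; [|split; [|split; [|split]]]].
- move=> n n1; split.
  + by rewrite ell_zerosE; exact: zerosE.
  + by have [[h1 _] h2] := gaps n n1 1%N (leqnn _); rewrite h1 h2.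
  + move=> k k2; have [[h1 h2] _] := gaps n n1 k (ltnW k2).
    by rewrite h1 (h2 k2).
- move=> th1 k k1.
  apply: (gap_zeros_cvg a1 a_cvg gamma_increasing gamma_cvg c_gt0 hK0 th1 k1).
  move=> n n1; split; first by have [] := gaps n n1 k k1.
  by have := zerosE n n1; rewrite /zeros => ->; left; exists k.
- near=> n.
  have n1 : (1 <= n)%N by near: n; exact: nbhs_infty_ge.
  have [zl nl cl] : [/\ zeros n (lp n),
    normc (lp n - (0 +i* a n)) <= a n / 4 & lm n = (lp n)^*%C] by near: n.
  split; last by rewrite cl -[RHS]/((lp n)^*%C)^*%C conjcK.
  have := le_trans (normc_ge_Im _) nl; have := a1 n n1.
  case: (lp n) => x y /=; rewrite ler_norml => an /andP[h _].
  by rewrite gt_eqF//; lra.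
- move=> /andP[r0 r2] /andP[t2 t1].
  apply: (pair_asymptotics_lt1 a1 gamma_increasing gamma_cvg theta01 c_gt0 hK0
    calA_gt0 calB_gt0 alpha0 beta0 r_def r01 delta0 hC1 hC2 hdelta _ upper).
    by lra.
  rewrite /n2 ge_max; apply/andP; split; rewrite lerNr ge_min; apply/orP;
    [left|right]; lra.
- move=> /andP[r0 r1] hr; have /andP[t0 t1] := theta01.
  apply: (pair_asymptotics_lt1 a1 gamma_increasing gamma_cvg theta01 c_gt0 hK0
    calA_gt0 calB_gt0 alpha0 beta0 r_def r01 delta0 hC1 hC2 hdelta r1 upper).
  rewrite ge_max; apply/andP; split; first by lra.
  (* The claim amounts to [theta <= r + 1 / 2], which [r >= 1 / 2] or [theta < 1 / 2] ensures. *)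
  by case: hr => /andP[h1 h2]; lra.
- move=> r1.
  exact: (pair_asymptotics_1 a1 gamma_increasing gamma_cvg theta01 c_gt0 hK0
    calA_gt0 calB_gt0 alpha0 beta0 r_def r01 delta0 hC1 hC2 hdelta r1 upper).
Unshelve. all: by end_near. Qed.
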